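(* Let $0<\eta_\star<\eta^\star$ and $\lambda^\star\ge 0$ be constants and let $\eta,\lambda$ be progressively measurable real processes such that a.s. for all $t\in[0,T]$: $\eta_\star\le\eta_t\le\eta^\star$ and $0\le\lambda_t\le\lambda^\star$. Assume that $\eta$ is an Itô process $d\eta_t=b^\eta_t\,dt+\sigma^\eta_t\,dW_t$ with $b^\eta\in L^\infty(\Omega\times[0,T];\mathbb R)$, $\sigma^\eta\in L^\infty(\Omega\times[0,T];\mathbb R^{1\times d})$. Let $f:\mathbb R\to\mathbb R$ be continuous and non-increasing with $f(0)=0$, and concave and of class $C^2$ on $[0,\infty)$, such that $G(x)=\int_x^\infty\frac{1}{-f(y)}\,dy$ is well-defined with values in $(0,\infty)$ for every $x\in(0,\infty)$. Let $Y$ be the first component of the unique non-negative solution of the BSDE with terminal value $+\infty$ described in the context. Assume that there exist $\tau\in[0,T)$, an (explicit) adapted process $(\xi_t)_{t\in[\tau,T)}$ with $\xi_t\ge 0$ a.s., and constants $C\in[1,\infty)$, $\alpha\in(0,\infty)$ such that $\|Y_t-\xi_t\|_\infty\le C(T-t)^\alpha$ for all $t\in[\tau,T)$. For every $\Delta\in(0,T-\tau]$ with $\Delta<T$ and every $N\in\mathbb N$, put $h=(T-\Delta)/N$ and $t_i=ih$, and let discretization data $(\overline a_i)_{0\le i\le N}$, $(\overline\lambda_i)_{0\le i\le N}$, $\overline\xi$ and the associated implicit Euler scheme $(\overline Y_i)_{0\le i\le N}$ be given as described in the context (all of these may depend on $\Delta$ and $N$). Assume that there exist constants $C_2>0$,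 $\beta>0$ and a function $\Phi:(0,T]\to[0,\infty)$ such that for all such $\Delta$ and $N$ and all $i\in\{0,\dots,N\}$, a.s., $$\mathbb E_{t_i}\bigg[\int_{t_i}^{T-\Delta}|a_s-\overline a_s|\,ds+\int_{t_i}^{T-\Delta}|\lambda_s-\overline\lambda_s|\,ds\bigg]\le C_2h^\beta,\qquad \mathbb E_{t_i}\big[|\xi_{T-\Delta}-\overline\xi|\big]\le C_2\Phi(\Delta)h^\beta .$$ Then there exist a constant $C_3>0$ and two functions $\Psi_1$ and $\Psi_2$, which only depend on $f$, $\eta$, $\lambda$, such that for all $\Delta\in(0,T-\tau]$ with $\Delta<T$, all $N\in\mathbb N$ (with $h=(T-\Delta)/N$) and all $i\in\{0,\dots,N\}$, a.s., $$|Y_{t_i}-\overline Y_i|\le C_3\big[\Delta^\alpha+h^\beta+\Psi_1(\Delta)h^\beta+\Psi_2(\Delta)h\big].$$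
   Context: $T\in(0,\infty)$ is fixed and $W$ is a $d$-dimensional Brownian motion on a filtered probability space $(\Omega,\mathcal F_T,(\mathcal F_t)_{t\in[0,T]},\mathbb P)$ satisfying the usual conditions, where $(\mathcal F_t)$ is the filtration generated by $W$. $\mathbb E_t[\cdot]$ denotes conditional expectation given $\mathcal F_t$. $\|\cdot\|_\infty$ is the $L^\infty(\Omega)$ norm. Put $a_t=1/\eta_t$. For $p\ge1$, $\mathbb S^p(0,s)$ is the set of pairs $(Y,Z)$ with $Y$ adapted càdlàg, $\mathbb E[\sup_{t\in[0,s]}|Y_t|^p]<\infty$, $Z$ predictable, $\mathbb E[(\int_0^s|Z_t|^2dt)^{p/2}]<\infty$; $\mathbb S^\infty(0,T-)=\bigcap_{\varepsilon>0}\bigcap_{p\ge1}\mathbb S^p(0,T-\varepsilon)$. Singular BSDE: under the assumptions on $\eta,\lambda,f$ made in the first paragraph of the claim, it is known that there is a unique pair $(Y,Z)\in\mathbb S^\infty(0,T-)$ such that a.s. for all $0\le s\le t<T$, $Y_s=Y_t+\int_s^t[\frac1{\eta_u}f(Y_u)+\lambda_u]du-\int_s^tZ_u\,dW_u$; $Y_t\ge0$ for all $t\in[0,T)$; and $\lim_{t\to T}Y_t=+\infty$ a.s. Implicit Euler scheme on $[0,T-\Delta]$: for $h=(T-\Delta)/N$ and $t_i=ih$, $i=0,\dots,N$, let $(\overline a_i)_{i=0,\dots,N}$ and $(\overline\lambda_i)_{i=0,\dots,N}$ be $(\mathcal F_{t_i})$-adapted with $0\le\overline a_i\le1/\eta_\star$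 and $0\le\overline\lambda_i\le\lambda^\star$, and let $\overline\xi$ be an $\mathcal F_{T-\Delta}$-measurable random variable with $0\le\overline\xi\le\|\xi_{T-\Delta}\|_\infty$. Then $(\overline Y_i)_{i=0,\dots,N}$ is the unique non-negative $(\mathcal F_{t_i})$-adapted process with $\overline Y_N=\overline\xi$ and $\overline Y_i=\mathbb E_{t_i}[\overline Y_{i+1}]+h\overline a_if(\overline Y_i)+h\overline\lambda_i$ for $i=0,\dots,N-1$. For $s\in[t_k,t_{k+1})$ one writes $\overline a_s=\overline a_k$, $\overline\lambda_s=\overline\lambda_k$.
   Formalization: The function Ψ1 may depend also on the rate function Φ (not only on f, η, λ), since otherwise at i=N a large Φ lets ξ̄ violate the bound; Ψ2 depends only on f, η, λ and the fixed setting. *)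

(* Defs.v *)
From HB Require Import structures.
From mathcomp Require Import all_boot all_order all_algebra.
From mathcomp Require Import all_classical all_reals all_analysis.

Set Implicit Arguments.
Unset Strict Implicit.
Unset Printing Implicit Defensive.

Import Order.TTheory GRing.Theory Num.Theory.
Import numFieldNormedType.Exports.

Local Open Scope classical_set_scope.
Local Open Scope ring_scope.

(* Sub-sigma-algebras of Omega are plain [set (set Omega)]; real processes are
   total functions R -> Omega -> R, only their values on the relevant time
   interval matter; an R^d-valued process is indexed by its component 'I_d. *)

Section Generator.
Context {R : realType}.
Implicit Type f : R -> R.

(* derivatives at 0 are one-sided: f is arbitrary on the negative half-line *)
Definition deriv_nonneg f (f' : R -> R) :=
  forall x : R, 0 <= x ->
    (fun y => (f y - f x) / (y - x)) @
      within [set y | 0 <= y /\ y <> x] (nbhs x) --> f' x.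

Definition C2_nonneg f := exists f1 f2 : R -> R,
  [/\ deriv_nonneg f f1, deriv_nonneg f1 f2 &
      {within `[0, +oo[, continuous f2}].

Definition Gfun f (x : R) : \bar R :=
  (\int[lebesgue_measure]_(y in `[x, +oo[) ((- f y)^-1)%:E)%E.

(* Division by 0 is total in the library, hence the explicit requirement
   f < 0 on (0, oo): it is what makes the integrand 1 / (- f) meaningful. *)
Definition singular_generator f :=
  [/\ continuous f, {homo f : x y / x <= y >-> y <= x}, f 0 = 0,
      convex_function (`[0, +oo[ : set R^o) (fun x : R^o => - f x : R^o) &
      C2_nonneg f] /\
  (forall x : R, 0 < x -> f x < 0) /\
  (forall x : R, 0 < x -> (0 < Gfun f x < +oo)%E).

End Generator.

Section Probability.
Context {R : realType} {disp : measure_display} {Omega : measurableType disp}.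
Variable P : probability Omega R.

Definition meas_wrt (G : set (set Omega)) (X : Omega -> R) :=
  forall B : set R, measurable B -> G (X @^-1` B).

(* V is a version of the conditional expectation of the integrable X given G *)
Definition is_condexp (G : set (set Omega)) (X V : Omega -> R) :=
  [/\ P.-integrable setT (EFin \o X), meas_wrt G V,
      P.-integrable setT (EFin \o V) &
      forall A, G A ->
        (\int[P]_(w in A) (V w)%:E = \int[P]_(w in A) (X w)%:E)%E].

Definition condexp_le (G : set (set Omega)) (X : Omega -> R) (c : R) :=
  exists V, is_condexp G X V /\ {ae P, forall w, V w <= c}.

Definition adapted (F : R -> set (set Omega)) (I : set R) (X : R -> Omega -> R) :=
  forall t, I t -> meas_wrt (F t) (X t).

Definition prod_sigma (G : set (set Omega)) : set (set (R * Omega)) :=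
  <<s [set C | exists A B, [/\ measurable A, G B & C = A `*` B] ] >>.

Definition progressive (F : R -> set (set Omega)) (T : R) (X : R -> Omega -> R) :=
  forall t : R, 0 <= t <= T -> forall B : set R, measurable B ->
    prod_sigma (F t) [set z | 0 <= z.1 <= t /\ B (X z.1 z.2)].

Definition predictable_sigma (F : R -> set (set Omega)) : set (set (R * Omega)) :=
  <<s [set C | exists2 A, F 0 A & C = [set 0] `*` A] `|`
      [set C | exists (s t : R) A, [/\ 0 <= s <= t, F s A & C = `]s, t] `*` A] ] >>.

(* only the trace on [0, T] x Omega of the generating rectangles matters *)
Definition predictable (F : R -> set (set Omega)) (T : R) (X : R -> Omega -> R) :=
  forall B : set R, measurable B ->
    predictable_sigma F [set z | 0 <= z.1 <= T /\ B (X z.1 z.2)].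

Definition ess_bounded (T : R) (X : R -> Omega -> R) :=
  exists K : R, {ae (lebesgue_measure \x P)%E, forall z : R * Omega,
    0 <= z.1 <= T -> `|X z.1 z.2| <= K}.

Definition cadlag (s : R) (y : R -> R) :=
  (forall t : R, 0 <= t < s -> y u @[u --> t^'+] --> y t) /\
  (forall t : R, 0 < t <= s -> cvg (y u @[u --> t^'-])).

Section Brownian.
Variables (d : nat) (W : 'I_d -> R -> Omega -> R).

(* the null sets of P are added, as required by the usual conditions *)
Definition brownian_filtration (t : R) : set (set Omega) :=
  <<s P.-negligible `|`
      [set A | exists j (s : R) B,
         [/\ 0 <= s <= t, measurable B & A = W j s @^-1` B] ] >>.

(* The last clause says that W t - W s is independent of F s with law
   N(0, (t - s) I_d); the second parameter of normal_prob is the standard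
   deviation. *)
Definition brownian_motion (F : R -> set (set Omega)) (T : R) :=
  [/\ forall j, adapted F `[0, T] (W j),
      forall j, {ae P, forall w, W j 0 w = 0},
      forall j, {ae P, forall w, {within `[0, T], continuous (W j ^~ w)}} &
      forall (s t : R) (A : set Omega) (B : 'I_d -> set R),
        0 <= s -> s < t -> t <= T -> F s A -> (forall j, measurable (B j)) ->
        P (A `&` [set w | forall j, B j (W j t w - W j s w)]) =
        (P A * \prod_(j < d) normal_prob 0 (Num.sqrt (t - s)) (B j))%E].

Definition usual_conditions (F : R -> set (set Omega)) (T : R) :=
  [/\ measure_is_complete P,
      forall t : R, 0 <= t <= T -> P.-negligible `<=` F t &
      forall t : R, 0 <= t < T ->
        F t = [set A | forall s : R, t < s <= T -> F s A] ].

(* the process sum_k H_k 1_{]t_k, t_{k+1}]} with H_k valued in R^d *)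
Record simple_process := SimpleProcess {
  sp_size : nat;
  sp_time : nat -> R;
  sp_coef : nat -> 'I_d -> Omega -> R }.

Definition simple_wf (F : R -> set (set Omega)) (S : R) (K : simple_process) :=
  [/\ 0 <= sp_time K 0,
      forall k, (k < sp_size K)%N -> sp_time K k <= sp_time K k.+1,
      sp_time K (sp_size K) <= S,
      exists c : R, forall k j w, `|sp_coef K k j w| <= c &
      forall k j, (k < sp_size K)%N ->
        meas_wrt (F (sp_time K k)) (sp_coef K k j)].

Definition simple_val (K : simple_process) (j : 'I_d) (u : R) (w : Omega) : R :=
  \sum_(k < sp_size K)
    sp_coef K k j w * (sp_time K k < u <= sp_time K k.+1)%R%:R.

Definition simple_int (K : simple_process) (t : R) (w : Omega) : R :=
  \sum_(k < sp_size K) \sum_(j < d)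
    sp_coef K k j w * (W j (Num.min (sp_time K k.+1) t) w
                       - W j (Num.min (sp_time K k) t) w).

(* M is the (continuous version of the) Ito integral t |-> int_0^t Z dW on
   [0, S], for Z square integrable: the L^2 limit of integrals of simple
   processes approximating Z. *)
Definition ito_integral (F : R -> set (set Omega)) (S : R)
    (Z : 'I_d -> R -> Omega -> R) (M : R -> Omega -> R) :=
  [/\ adapted F `[0, S] M,
      {ae P, forall w, {within `[0, S], continuous (M ^~ w)}} &
      exists K : nat -> simple_process,
      [/\ forall m, simple_wf F S (K m),
          (fun m => \int[P]_w \int[lebesgue_measure]_(u in `[0%R, S])
             (\sum_(j < d) (Z j u w - simple_val (K m) j u w) ^+ 2)%:E)%E
            @ \oo --> 0%E &
          forall t : R, 0 <= t <= S ->
            (fun m => \int[P]_w ((M t w - simple_int (K m) t w) ^+ 2)%:E)%E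
              @ \oo --> 0%E]].

Definition bounded_ito_process (F : R -> set (set Omega)) (T : R)
    (eta : R -> Omega -> R) :=
  exists (b : R -> Omega -> R) (sigma : 'I_d -> R -> Omega -> R)
         (M : R -> Omega -> R),
  [/\ progressive F T b /\ ess_bounded T b,
      forall j, progressive F T (sigma j) /\ ess_bounded T (sigma j),
      ito_integral F T sigma M &
      {ae P, forall w, forall t : R, 0 <= t <= T ->
        eta t w = eta 0 w
          + \int[lebesgue_measure]_(u in `[0, t]) b u w + M t w}].

Definition Sp_space (F : R -> set (set Omega)) (p s : R)
    (Y : R -> Omega -> R) (Z : 'I_d -> R -> Omega -> R) :=
  [/\ adapted F `[0, s] Y /\ {ae P, forall w, cadlag s (Y ^~ w)},
      (\int[P]_w ereal_sup [set (`|Y t w| `^ p)%:E | t in `[0%R, s] ] < +oo)%E,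
      forall j, predictable F s (Z j) &
      (\int[P]_w ((\int[lebesgue_measure]_(t in `[0%R, s])
         (\sum_(j < d) Z j t w ^+ 2)%:E) `^ (p / 2)) < +oo)%E].

Definition Sinfty_space (F : R -> set (set Omega)) (T : R)
    (Y : R -> Omega -> R) (Z : 'I_d -> R -> Omega -> R) :=
  forall eps p : R, 0 < eps < T -> 1 <= p -> Sp_space F p (T - eps) Y Z.

(* Since Z is only integrable away from T, its integral M is an Ito integral on
   each [0, S] with S < T, and int_s^t Z dW is M t - M s. *)
Definition singular_bsde_solution (F : R -> set (set Omega)) (T : R)
    (eta lambda : R -> Omega -> R) (f : R -> R)
    (Y : R -> Omega -> R) (Z : 'I_d -> R -> Omega -> R) :=
  [/\ Sinfty_space F T Y Z,
      exists M : R -> Omega -> R,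
        (forall S : R, 0 <= S < T -> ito_integral F S Z M) /\
        {ae P, forall w, forall s t : R, 0 <= s -> s <= t -> t < T ->
           Y s w = Y t w
             + \int[lebesgue_measure]_(u in `[s, t])
                 ((eta u w)^-1 * f (Y u w) + lambda u w)
             - (M t w - M s w)},
      {ae P, forall w, forall t : R, 0 <= t < T -> 0 <= Y t w} &
      {ae P, forall w, Y t w @[t --> T^'-] --> +oo}].

End Brownian.

Section Scheme.
Variables (F : R -> set (set Omega)) (T Delta : R) (N : nat).

Definition mesh : R := (T - Delta) / N%:R.
Definition grid (i : nat) : R := i%:R * mesh.

(* s in [t_k, t_{k+1}) is mapped to x k *)
Definition step_ext (x : nat -> Omega -> R) (s : R) : Omega -> R :=
  x (Num.truncn (s / mesh)).

Definition discretization_data (eta_lo lambda_hi : R) (xi : R -> Omega -> R)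
    (abar lbar : nat -> Omega -> R) (xibar : Omega -> R) :=
  [/\ forall i, (i <= N)%N -> meas_wrt (F (grid i)) (abar i) /\
        {ae P, forall w, 0 <= abar i w <= eta_lo^-1},
      forall i, (i <= N)%N -> meas_wrt (F (grid i)) (lbar i) /\
        {ae P, forall w, 0 <= lbar i w <= lambda_hi},
      meas_wrt (F (T - Delta)) xibar &
      {ae P, forall w, 0 <= xibar w /\
        ((xibar w)%:E <= 'N[P]_+oo[EFin \o xi (T - Delta)%R])%E}].

Definition implicit_euler (f : R -> R) (abar lbar : nat -> Omega -> R)
    (xibar : Omega -> R) (Ybar : nat -> Omega -> R) :=
  [/\ forall i, (i <= N)%N -> meas_wrt (F (grid i)) (Ybar i) /\
        {ae P, forall w, 0 <= Ybar i w},
      {ae P, forall w, Ybar N w = xibar w} &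
      forall i, (i < N)%N -> exists V,
        is_condexp (F (grid i)) (Ybar i.+1) V /\
        {ae P, forall w, Ybar i w =
           V w + mesh * abar i w * f (Ybar i w) + mesh * lbar i w}].

Definition discretization_error (C2 beta : R) (Phi : R -> R)
    (eta lambda xi : R -> Omega -> R)
    (abar lbar : nat -> Omega -> R) (xibar : Omega -> R) :=
  forall i, (i <= N)%N ->
    condexp_le (F (grid i))
      (fun w => \int[lebesgue_measure]_(s in `[grid i, T - Delta])
                   `|(eta s w)^-1 - step_ext abar s w|
              + \int[lebesgue_measure]_(s in `[grid i, T - Delta])
                   `|lambda s w - step_ext lbar s w|)
      (C2 * mesh `^ beta) /\
    condexp_le (F (grid i)) (fun w => `|xi (T - Delta) w - xibar w|)
      (C2 * Phi Delta * mesh `^ beta).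

End Scheme.
End Probability.

(* Main.v *)
(* Only the conditional mean dynamics y_s = E_s [y_t + int_s^t (a f(y) + lambda)] of the BSDE are
   needed. Comparing y on the dyadic levels 2^k, where its drift is at most f(2^k) / (2 eta_hi)
   as soon as k is large, y goes back from 2^(k+1) to 2^k within a time of order 2^k / (- f(2^k)).
   Finiteness of G makes these times summable, which bounds y on [0, T - Delta / 2] by a level
   U(Delta) depending on f and the bounds of eta and lambda only.

   In the one step recursion for |Y - Ybar| the implicit term has the right sign, since f is
   non-increasing. There remain the errors of a and lambda, with weight 1 - f(U(Delta)), and
   int (f(Y_s) - f(Y_(t_i))) ds. By a second order Taylor expansion of f the latter is, in
   conditional mean, O(h) (drift of Y) plus O(E_(t_i) (Y_s - Y_(t_i))^2), and the squares are
   increments of E Y^2 up to O(h). These telescope, so the sum is O(h), with constants depending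
   on Delta only through U(Delta). *)

Require Import Defs.
From HB Require Import structures.
From mathcomp Require Import all_boot all_order all_algebra.
From mathcomp Require Import all_classical all_reals all_analysis.
From mathcomp Require Import ring lra measurable_realfun ess_sup_inf.

Set Implicit Arguments.
Unset Strict Implicit.
Unset Printing Implicit Defensive.

Import Order.TTheory GRing.Theory Num.Theory.
Import numFieldNormedType.Exports.

Local Open Scope classical_set_scope.
Local Open Scope ring_scope.


(** * Expectations, and conditional expectations tested against bounded weights *)

Section expectation.
Context {R : realType} {disp : measure_display} {Omega : measurableType disp}.
Variable P : probability Omega R.
Implicit Types (X Y Z zeta : Omega -> R) (G : set (set Omega)).

(** Two difficulties shape the argument. The terminal value is infinite, so no estimate can start at
    T: the a priori bound starts at a time t + e where y is merely integrable. The mean excess of y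
    over 2^n at that time tends to 0 as n grows, while the time needed to go back from 2^n to 2^j
    stays below e for every n. Moreover positive parts, squares and absolute errors are handled
    without an Ito formula: conditional statements are tested against bounded [F s]-measurable
    weights, under which the martingale part vanishes, and an almost sure inequality is recovered at
    the end by testing with the indicator of the event where it fails.

    The level U(Delta) and the Taylor constants on [0, U(Delta)] have to be fixed before Y, xi and
    the scheme are introduced, so they are extracted from f and the bounds of eta and lambda alone.
    Almost sure properties are turned into properties of every path by changing the processes on a
    null set; completeness keeps them measurable. *)

Definition rintegrable X := P.-integrable setT (EFin \o X).
Definition mean X := \int[P]_w X w.
Definition bounded_meas G zeta :=
  meas_wrt G zeta /\ exists c : R, forall w, `|zeta w| <= c.
(** Encodes E[X | G] = 0 by testing, so that no version of a conditional expectation has to be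
    chosen. *)
Definition cond_mean_zero G X := rintegrable X /\
  forall zeta, bounded_meas G zeta -> mean (fun w => zeta w * X w) = 0.
Definition sub_sigma G := sigma_algebra setT G /\ G `<=` @measurable _ Omega.

Lemma rintegrable_measurable X : rintegrable X -> measurable_fun setT X.
Proof. by move=> /integrableP[/measurable_EFinP]. Qed.

Lemma rintegrableD X Y : rintegrable X -> rintegrable Y ->
  rintegrable (fun w => X w + Y w).
Proof. by move=> iX iY; exact: (integrableD measurableT iX iY). Qed.

Lemma rintegrableB X Y : rintegrable X -> rintegrable Y ->
  rintegrable (fun w => X w - Y w).
Proof. by move=> iX iY; exact: (integrableB measurableT iX iY). Qed.

Lemma rintegrableN X : rintegrable X -> rintegrable (fun w => - X w).
Proof. by move=> iX; exact: (integrableN iX). Qed.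

Lemma rintegrableZ c X : rintegrable X -> rintegrable (fun w => c * X w).
Proof. by move=> iX; exact: (integrableZl measurableT c iX). Qed.

Lemma rintegrable_norm X : rintegrable X -> rintegrable (fun w => `|X w|).
Proof. by move=> iX; exact: (integrable_abse iX). Qed.

Lemma rintegrable_le X Y : measurable_fun setT X ->
  (forall w, `|X w| <= `|Y w|) -> rintegrable Y -> rintegrable X.
Proof.
move=> mX XY iY; apply: (le_integrable _ _ _ iY) => //.
  exact/measurable_EFinP.
by move=> w _; rewrite /= lee_fin.
Qed.

Lemma rintegrable_bounded X c : measurable_fun setT X ->
  (forall w, `|X w| <= c) -> rintegrable X.
Proof.
move=> mX Xc; apply: measurable_bounded_integrable => //.
  by have /= -> := @probability_setT _ _ _ P; rewrite ltry.
exists c; split; first exact: num_real.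
by move=> x cx w _; exact: le_trans (Xc w) (ltW cx).
Qed.

Lemma rintegrable_cst c : rintegrable (fun=> c).
Proof. by apply: (@rintegrable_bounded _ `|c|). Qed.

Lemma rintegrableM zeta X : measurable_fun setT zeta ->
  (exists c : R, forall w, `|zeta w| <= c) -> rintegrable X ->
  rintegrable (fun w => zeta w * X w).
Proof.
move=> mz [c zc] iX; apply: (@rintegrable_le _ (fun w => `|c| * X w)).
- by apply: measurable_funM => //; exact: rintegrable_measurable.
- move=> w; rewrite !normrM normr_id ler_wpM2r//.
  exact: le_trans (zc w) (ler_norm _).
- exact: rintegrableZ.
Qed.

Lemma rintegrable_sum (I : Type) (s : seq I) (X : I -> Omega -> R) :
  (forall i, rintegrable (X i)) -> rintegrable (fun w => \sum_(i <- s) X i w).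
Proof.
move=> iX; elim: s => [|i s IH].
  by under eq_fun do rewrite big_nil; exact: rintegrable_cst.
by under eq_fun do rewrite big_cons; exact: rintegrableD.
Qed.

Lemma rintegrable_ae X Y : measurable_fun setT Y ->
  {ae P, forall w, X w = Y w} -> rintegrable X -> rintegrable Y.
Proof.
move=> mY XY iX; apply/integrableP; split; first exact/measurable_EFinP.
have /integrableP[mX] := iX.
rewrite (@ae_eq_integral _ _ _ P setT (fun w => `|(Y w)%:E|)%E)//.
- by apply: measurableT_comp.
- by apply: measurableT_comp => //; exact/measurable_EFinP.
- by apply: filterS XY => w /= -> _.
Qed.

Lemma meanD X Y : rintegrable X -> rintegrable Y ->
  mean (fun w => X w + Y w) = mean X + mean Y.
Proof. exact: RintegralD. Qed.

Lemma meanB X Y : rintegrable X -> rintegrable Y ->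
  mean (fun w => X w - Y w) = mean X - mean Y.
Proof. exact: RintegralB. Qed.

Lemma meanZ c X : rintegrable X -> mean (fun w => c * X w) = c * mean X.
Proof. by move=> iX; exact: RintegralZl. Qed.

Lemma meanN X : rintegrable X -> mean (fun w => - X w) = - mean X.
Proof.
move=> iX; rewrite -mulN1r -meanZ//; congr mean; apply/funext => w.
by rewrite mulN1r.
Qed.

Lemma mean_sum (I : Type) (s : seq I) (X : I -> Omega -> R) :
  (forall i, rintegrable (X i)) ->
  mean (fun w => \sum_(i <- s) X i w) = \sum_(i <- s) mean (X i).
Proof.
move=> iX; elim: s => [|i s IH].
  rewrite big_nil; under [LHS]eq_Rintegral do rewrite big_nil.
  by rewrite /mean Rintegral_cst// mul0r.
rewrite big_cons -IH -meanD//; last exact: rintegrable_sum.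
by apply: eq_Rintegral => w _; rewrite big_cons.
Qed.

Lemma mean_cst c : mean (fun=> c) = c.
Proof.
rewrite /mean Rintegral_cst//.
by have /= -> := @probability_setT _ _ _ P; rewrite mulr1.
Qed.

Lemma ae_eq_mean X Y : measurable_fun setT X -> measurable_fun setT Y ->
  {ae P, forall w, X w = Y w} -> mean X = mean Y.
Proof.
move=> mX mY XY; congr fine; apply: ae_eq_integral => //.
- exact/measurable_EFinP.
- exact/measurable_EFinP.
- by apply: filterS XY => w /= -> _.
Qed.

Lemma mean_ge0 X : (forall w, 0 <= X w) -> 0 <= mean X.
Proof. by move=> X0; apply: Rintegral_ge0 => w _. Qed.

Lemma le_mean X Y : rintegrable X -> rintegrable Y ->
  (forall w, X w <= Y w) -> mean X <= mean Y.
Proof. by move=> iX iY XY; apply: le_Rintegral. Qed.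

(** The maximum of X and Y dominates X everywhere and equals Y almost everywhere, which reduces the
    claim to [le_mean]. *)
Lemma ae_le_mean X Y : rintegrable X -> rintegrable Y ->
  {ae P, forall w, X w <= Y w} -> mean X <= mean Y.
Proof.
move=> iX iY XY.
have mX := rintegrable_measurable iX; have mY := rintegrable_measurable iY.
have iM : rintegrable (fun w => Num.max (X w) (Y w)).
  apply: (@rintegrable_le _ (fun w => `|X w| + `|Y w|)).
  - exact: measurable_maxr.
  - move=> w; rewrite [leRHS]ger0_norm ?addr_ge0// maxEle.
    by case: ifP => _; rewrite ?lerDl ?lerDr.
  - by apply: rintegrableD; exact: rintegrable_norm.
rewrite (_ : mean Y = mean (fun w => Num.max (X w) (Y w))).
  by apply: le_mean => // w; rewrite le_max lexx.
apply: ae_eq_mean => //; first exact: measurable_maxr.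
by apply: filterS XY => w /max_idPr ->.
Qed.

Lemma norm_mean_le X : rintegrable X -> `|mean X| <= mean (fun w => `|X w|).
Proof. by move=> iX; exact: le_normr_Rintegral. Qed.

Lemma mean_EFin X : rintegrable X -> (mean X)%:E = (\int[P]_w (X w)%:E)%E.
Proof. by move=> iX; rewrite /mean /Rintegral fineK//; exact: integrable_fin_num. Qed.

Lemma mean_le0_ae X : rintegrable X -> (forall w, 0 <= X w) -> mean X <= 0 ->
  {ae P, forall w, X w = 0}.
Proof.
move=> iX X0 EX.
have : (\int[P]_w `|(X w)%:E| = 0)%E.
  under eq_integral do rewrite abse_EFin ger0_norm//.
  rewrite -mean_EFin//; congr EFin.
  by apply/eqP; rewrite eq_le EX mean_ge0.
move=> /ae_eq_integral_abs H.
have /H : measurable_fun setT (EFin \o X).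
  by apply/measurable_EFinP; exact: rintegrable_measurable.
by move=> /(_ measurableT); apply: filterS => w /= /(_ I) [].
Qed.

(** * Functions measurable for a sub-sigma-algebra *)

(** A sigma-algebra given as a plain set of sets generates itself, so the closure properties of
    measurable functions on [g_sigma_algebraType G] become available. *)
Lemma meas_wrtP G X : sigma_algebra setT G ->
  meas_wrt G X <-> measurable_fun setT (X : g_sigma_algebraType G -> R).
Proof.
move=> sG; split.
  by move=> mX _ B mB; rewrite setTI /measurable/= sigma_algebra_id//; exact: mX.
move=> mX B mB; have := mX measurableT B mB.
by rewrite setTI /measurable/= sigma_algebra_id.
Qed.

Lemma meas_wrt_measurable G X : sub_sigma G -> meas_wrt G X ->
  measurable_fun setT X.
Proof. by move=> [_ GO] mX _ B mB; rewrite setTI; apply: GO; exact: mX. Qed.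

Lemma meas_wrtS G H X : G `<=` H -> meas_wrt G X -> meas_wrt H X.
Proof. by move=> GH mX B mB; apply: GH; exact: mX. Qed.

Lemma meas_wrt_comp G (f : R -> R) X : measurable_fun setT f -> meas_wrt G X ->
  meas_wrt G (fun w => f (X w)).
Proof.
move=> mf mX B mB; apply: (mX (f @^-1` B)).
by rewrite -[X in measurable X]setTI; exact: mf.
Qed.

Section closure.
Variable G : set (set Omega).
Hypothesis sG : sigma_algebra setT G.

Lemma meas_wrt_cst (c : R) : meas_wrt G (fun=> c).
Proof. by apply/meas_wrtP. Qed.

Lemma meas_wrtB X Y : meas_wrt G X -> meas_wrt G Y ->
  meas_wrt G (fun w => X w - Y w).
Proof. by rewrite !meas_wrtP// => mX mY; exact: measurable_funB. Qed.

Lemma meas_wrtM X Y : meas_wrt G X -> meas_wrt G Y ->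
  meas_wrt G (fun w => X w * Y w).
Proof. by rewrite !meas_wrtP// => mX mY; exact: measurable_funM. Qed.

Lemma meas_wrt_indic A : G A -> meas_wrt G (\1_A : Omega -> R).
Proof.
move=> GA; rewrite meas_wrtP//.
apply: (measurable_indic (T := g_sigma_algebraType G)).
by rewrite /measurable/= sigma_algebra_id.
Qed.

Lemma bounded_measM X Y : bounded_meas G X -> bounded_meas G Y ->
  bounded_meas G (fun w => X w * Y w).
Proof.
move=> [mX [c Xc]] [mY [d Yd]]; split; first exact: meas_wrtM.
exists (c * d) => w; rewrite normrM ler_pM//.
Qed.

Lemma bounded_meas_cst (c : R) : bounded_meas G (fun=> c).
Proof. by split; [exact: meas_wrt_cst|exists `|c|]. Qed.

Lemma bounded_meas_indic A : G A -> bounded_meas G (\1_A : Omega -> R).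
Proof.
move=> GA; split; first exact: meas_wrt_indic.
by exists 1 => w; rewrite indicE ger0_norm// lern1 leq_b1.
Qed.

End closure.

(** Preimages under X and Y differ by negligible sets only, and these belong to G. *)
Lemma meas_wrt_ae G X Y : sigma_algebra setT G -> P.-negligible `<=` G ->
  {ae P, forall w, X w = Y w} -> meas_wrt G X -> meas_wrt G Y.
Proof.
move=> sG nG XY mX B mB.
have -> : Y @^-1` B = (X @^-1` B `&` [set w | X w = Y w]) `|`
    (Y @^-1` B `&` [set w | X w <> Y w]).
  apply/seteqP; split => w /=.
    by case: (pselect (X w = Y w)) => [e|e] BY; [left; rewrite e|right].
  by move=> [[+ <-]|[]].
have GN : G (~` [set w | X w = Y w]) by exact: nG.
have mG A : G A = measurable (A : set (g_sigma_algebraType G)).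
  by rewrite /measurable/= sigma_algebra_id.
rewrite mG; apply: measurableU.
  apply: measurableI; rewrite -mG; first exact: mX.
  by rewrite mG -[X in measurable X]setCK; apply: measurableC; rewrite -mG.
by rewrite -mG; apply: nG; apply: (negligibleS _ XY) => w [].
Qed.

Lemma rintegrable_bM G zeta X : sub_sigma G -> bounded_meas G zeta ->
  rintegrable X -> rintegrable (fun w => zeta w * X w).
Proof.
by move=> sG [mz bz]; apply: rintegrableM => //; exact: meas_wrt_measurable mz.
Qed.

Lemma bounded_meas_rintegrable G X : sub_sigma G -> bounded_meas G X -> rintegrable X.
Proof.
move=> sG [mX [c Xc]]; apply: (@rintegrable_bounded _ c) => //.
exact: meas_wrt_measurable mX.
Qed.

Lemma cond_mean_zeroD G X Y : sub_sigma G ->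
  cond_mean_zero G X -> cond_mean_zero G Y ->
  cond_mean_zero G (fun w => X w + Y w).
Proof.
move=> sG [iX X0] [iY Y0]; split; first exact: rintegrableD.
move=> zeta bz; under [mean _]eq_Rintegral do rewrite mulrDr.
by rewrite -/(mean _) meanD ?X0 ?Y0 ?addr0//; exact: rintegrable_bM sG bz _.
Qed.

Lemma cond_mean_zeroM G X Y : sub_sigma G -> bounded_meas G X ->
  cond_mean_zero G Y -> cond_mean_zero G (fun w => X w * Y w).
Proof.
move=> sG bX [iY Y0]; split; first exact: rintegrable_bM sG bX iY.
move=> zeta bz; under [mean _]eq_Rintegral do rewrite mulrA.
by apply: Y0; apply: bounded_measM => //; case: sG.
Qed.

Lemma cond_mean_zeroS G H X : G `<=` H ->
  cond_mean_zero H X -> cond_mean_zero G X.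
Proof.
move=> GH [iX X0]; split => // zeta [mz bz]; apply: X0; split => //.
exact: meas_wrtS GH mz.
Qed.

Lemma cond_mean_zero0 G : cond_mean_zero G (fun=> 0).
Proof.
split; first exact: rintegrable_cst.
move=> z _; under [mean _]eq_Rintegral do rewrite mulr0.
exact: mean_cst.
Qed.

Lemma cond_mean_zero_sum G (I : Type) (s : seq I) (X : I -> Omega -> R) : sub_sigma G ->
  (forall i, cond_mean_zero G (X i)) ->
  cond_mean_zero G (fun w => \sum_(i <- s) X i w).
Proof.
move=> sG X0; elim: s => [|i s IH].
  by under eq_fun do rewrite big_nil; exact: cond_mean_zero0.
by under eq_fun do rewrite big_cons; exact: cond_mean_zeroD.
Qed.

Lemma cond_mean_zero_ae G X Y : sub_sigma G -> measurable_fun setT Y ->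
  {ae P, forall w, X w = Y w} -> cond_mean_zero G X -> cond_mean_zero G Y.
Proof.
move=> sG mY XY [iX X0]; have iY := rintegrable_ae mY XY iX.
split=> // zeta bz; rewrite -(X0 _ bz); apply: ae_eq_mean.
- exact: (rintegrable_measurable (rintegrable_bM sG bz iY)).
- exact: (rintegrable_measurable (rintegrable_bM sG bz iX)).
- by apply: filterS XY => w /= ->.
Qed.

(* A bounded weight is a uniform limit of the step functions
   floor (n * zeta) / n. *)
Lemma cond_mean_zero_sets G X : sub_sigma G -> rintegrable X ->
  (forall A, G A -> mean (fun w => \1_A w * X w) = 0) -> cond_mean_zero G X.
Proof.
move=> sG iX X0; split=> // zeta [mz [c zc]].
have [sGG GO] := sG.
have iz : rintegrable (fun w => zeta w * X w).
  by apply: rintegrable_bM sG _ iX; split => //; exists c.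
(* An error 1 / n in the weight costs at most E|X| / n in the mean; since n is arbitrary, the mean
   vanishes. *)
suff key (n : nat) : (0 < n)%N ->
    `|mean (fun w => zeta w * X w)| * n%:R <= mean (fun w => `|X w|).
  apply/eqP; rewrite -normr_le0 leNgt; apply/negP => a0.
  set a := `|mean _| in key a0.
  have := key (Num.truncn (mean (fun w => `|X w|) / a)).+1 isT.
  apply/negP; rewrite -ltNge mulrC -ltr_pdivrMr//.
  exact: truncnS_gt.
move=> n0.
have nR : (0 : R) < n%:R by rewrite ltr0n.
(* The shift by [c] makes the argument of [Num.truncn] non-negative, and [m] bounds the number of
   its values, so the step function is a finite combination of indicators of sets of G. *)
pose m := (Num.truncn (n%:R * (c + c)) ).+1.
pose k w := Num.truncn (n%:R * (zeta w + c)).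
have zc0 w : 0 <= n%:R * (zeta w + c).
  apply: mulr_ge0; first exact: ltW.
  by have := zc w; rewrite ler_norml => /andP[]; lra.
have km w : (k w < m)%N.
  rewrite /k /m ltnS; apply: le_truncn; rewrite ler_pM2l// lerD2r.
  exact: le_trans (ler_norm _) (zc w).
pose A i := [set w | k w = i].
have GA i : G (A i).
  have -> : A i = zeta @^-1` [set x | i%:R <= n%:R * (x + c) < i.+1%:R].
    apply/seteqP; split => w /=.
      by rewrite /A/= => <-; rewrite /k truncn_itv.
    by move=> h; apply/truncn_def.
  apply: mz.
  rewrite (_ : [set _ | _] = `[(i%:R / n%:R - c), (i.+1%:R / n%:R - c)[%classic)//.
  apply/seteqP; split => x /=; rewrite in_itv/= lerBlDr ltrBrDr ler_pdivrMr//;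
    by rewrite ltr_pdivlMr// mulrC.
pose z w := \sum_(i < m) (i%:R / n%:R - c) * \1_(A i) w.
have zE w : z w = (k w)%:R / n%:R - c.
  rewrite /z (bigD1 (Ordinal (km w)))//= indicE mem_set// mulr1 big1 ?addr0//.
  move=> i ik; rewrite indicE memNset ?mulr0//= => e.
  by move/negP: ik; apply; apply/eqP/val_inj.
have zz w : `|zeta w - z w| * n%:R <= 1.
  rewrite zE -[X in _ * X]gtr0_norm// -normrM.
  have -> : (zeta w - ((k w)%:R / n%:R - c)) * n%:R = n%:R * (zeta w + c) - (k w)%:R.
    by field; rewrite gt_eqF.
  have /andP[k1 k2] := truncn_itv (zc0 w).
  rewrite -/(k w) in k1 k2; rewrite -natr1 in k2.
  by rewrite ger0_norm ?subr_ge0//; lra.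
have iA i : rintegrable (fun w => \1_(A i) w * X w).
  by apply: rintegrable_bM sG _ iX; exact: bounded_meas_indic.
have izX : rintegrable (fun w => z w * X w).
  under eq_fun do rewrite /z mulr_suml.
  apply: rintegrable_sum => i; under eq_fun do rewrite -mulrA.
  exact: rintegrableZ.
have mzX : mean (fun w => z w * X w) = 0.
  under [mean _]eq_Rintegral do rewrite /z mulr_suml.
  rewrite -/(mean _) mean_sum; last first.
    by move=> i; under eq_fun do rewrite -mulrA; exact: rintegrableZ.
  apply: big1 => i _; under [mean _]eq_Rintegral do rewrite -mulrA.
  by rewrite -/(mean _) meanZ// X0// mulr0.
have -> : mean (fun w => zeta w * X w) = mean (fun w => (zeta w - z w) * X w).
  under [RHS]eq_Rintegral do rewrite mulrBl.
  by rewrite -/(mean _) meanB// mzX subr0.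
have idX : rintegrable (fun w => (zeta w - z w) * X w).
  by under eq_fun do rewrite mulrBl; exact: rintegrableB.
rewrite mulrC -[X in X * _]gtr0_norm// -normrM -meanZ//.
apply: le_trans (norm_mean_le _) _; first exact: rintegrableZ.
apply: le_mean; [by apply: rintegrable_norm; exact: rintegrableZ|exact: rintegrable_norm|].
move=> w; rewrite mulrA normrM ler_piMl//.
by rewrite normrM gtr0_norm// mulrC.
Qed.

(** [is_condexp] tests with sets of G only; [cond_mean_zero_sets] applied to V - X extends this to
    bounded weights. *)
Lemma condexp_mean G X V zeta : sub_sigma G -> is_condexp P G X V ->
  bounded_meas G zeta ->
  mean (fun w => zeta w * V w) = mean (fun w => zeta w * X w).
Proof.
move=> sG [iX mV iV XV] bz; apply/eqP; rewrite -subr_eq0 -meanB; last 2 first.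
- exact: rintegrable_bM sG bz iV.
- exact: rintegrable_bM sG bz iX.
under [mean _]eq_Rintegral do rewrite -mulrBr.
have iVX : rintegrable (fun w => V w - X w) by exact: rintegrableB.
apply/eqP; apply: (@cond_mean_zero_sets G (fun w => V w - X w) sG iVX _).2 => // A GA.
have mA : measurable A by exact: sG.2.
have e X0 : mean (fun w => \1_A w * X0 w) = \int[P]_(w in A) X0 w.
  rewrite [RHS]Rintegral_mkcond; apply: eq_Rintegral => w _.
  by rewrite patchE indicE; case: (w \in A); rewrite ?mul1r ?mul0r.
have iS X0 : rintegrable X0 -> P.-integrable A (EFin \o X0).
  by move=> iX0; apply: integrableS iX0.
by rewrite e RintegralB//; [rewrite /Rintegral XV// subrr|exact: iS|exact: iS].
Qed.

End expectation.

(** * Density, symmetry and first absolute moment of the Gaussian law *)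

Section gaussian_increment.
Context {R : realType}.
Local Notation mu := (@lebesgue_measure R).

(** The Radon-Nikodym derivative of the law agrees almost everywhere with [normal_pdf], since both
    have the same integral over every measurable set. *)
Lemma integral_normal_prob (s : R) (g : R -> \bar R) :
  measurable_fun setT g -> (forall x, 0 <= g x)%E ->
  (\int[normal_prob 0 s]_x g x = \int[mu]_x (g x * (normal_pdf 0 s x)%:E))%E.
Proof.
move=> mg g0.
have dom := @normal_prob_dominates R 0 s.
rewrite -(Radon_Nikodym_SigmaFinite.change_of_variables dom)//.
apply: ae_eq_integral => //.
- apply: emeasurable_funM => //; apply: (measurable_int mu).
  exact: Radon_Nikodym_SigmaFinite.f_integrable.
- apply: emeasurable_funM => //; apply/measurable_EFinP.
  exact: measurable_normal_pdf.
- apply: ae_eqe_mul2l; apply: integral_ae_eq => //=.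
  + exact: Radon_Nikodym_SigmaFinite.f_integrable.
  + by apply/measurable_EFinP; exact: measurable_normal_pdf.
  + by move=> E _ mE; rewrite -Radon_Nikodym_SigmaFinite.f_integral.
Qed.

(** The density is even and Lebesgue measure is invariant under reflection. *)
Lemma normal_prob_opp (s : R) (B : set R) : s != 0 -> measurable B ->
  normal_prob 0 s (-%R @^-1` B) = normal_prob 0 s B.
Proof.
move=> s0 mB; rewrite /normal_prob.
transitivity (\int[pushforward mu (-%R : _ -> measurableTypeR R)]_(y in B)
    (normal_pdf 0 s y)%:E)%E.
  rewrite ge0_integral_pushforward//=.
  - apply: eq_integral => x _ /=; congr EFin.
    by rewrite !normal_pdfE// /normal_fun !subr0 sqrrN.
  - by apply/measurable_EFinP/measurable_funTS; exact: measurable_normal_pdf.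
  - by move=> x _; rewrite lee_fin normal_pdf_ge0.
by apply: eq_measure_integral => A mA _; exact: lebesgue_measureN.
Qed.

(* |x| times the density is dominated by a multiple of the density of variance 4 s^2. *)
Lemma normal_abs_moment (s : R) : 0 < s ->
  (\int[normal_prob 0 s]_x `|x|%:E < +oo)%E.
Proof.
move=> s0; rewrite integral_normal_prob//; last first.
  by apply/measurable_EFinP; exact: normr_measurable.
have s2 : s *+ 2 != 0 by rewrite mulrn_eq0/= gt_eqF.
(* The quotient of the two exponentials is exp(u) with u = 3/8 x^2 / s^2, and |x| <= 1 + x^2 = 1 +
   8/3 s^2 u <= (1 + 8/3 s^2) (1 + u) <= (1 + 8/3 s^2) exp(u). The peaks account for the
   normalizations. *)
pose K := (1 + 8 / 3 * s ^+ 2) * normal_peak s / normal_peak (s *+ 2).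
have p2 : 0 < normal_peak (s *+ 2) by exact: normal_peak_gt0.
have p1 : 0 < normal_peak s by apply: normal_peak_gt0; rewrite gt_eqF.
apply: (@le_lt_trans _ _ (\int[mu]_x (K%:E * (normal_pdf 0 (s *+ 2) x)%:E))%E).
  apply: ge0_le_integral => //.
  - by move=> x _; rewrite -EFinM lee_fin mulr_ge0// normal_pdf_ge0.
  - apply/measurable_EFinP/measurable_funM; first exact: normr_measurable.
    exact: measurable_normal_pdf.
  - by apply/measurable_EFinP/measurable_funM => //; exact: measurable_normal_pdf.
  - move=> x _; rewrite -!EFinM lee_fin !normal_pdfE// ?gt_eqF// /normal_fun !subr0.
    rewrite /K -!mulrA (mulKf (lt0r_neq0 p2)).
    rewrite [leLHS]mulrCA [leRHS]mulrCA ler_pM2l//.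
    pose u := 3 / 8 * (x ^+ 2 / s ^+ 2).
    have ss : s != 0 by rewrite gt_eqF.
    have -> : expR (- x ^+ 2 / ((s *+ 2) ^+ 2 *+ 2)) =
      expR u * expR (- x ^+ 2 / (s ^+ 2 *+ 2)).
      by rewrite -expRD; congr expR; rewrite /u; field.
    rewrite [8 * _]mulrA [leRHS]mulrA ler_pM2r ?expR_gt0//.
    have eu : 1 + u <= expR u by exact: expR_ge1Dx.
    have u0 : 0 <= u by rewrite mulr_ge0// divr_ge0// sqr_ge0.
    apply: (@le_trans _ _ ((1 + 8 / 3 * s ^+ 2) * (1 + u))); last first.
      by rewrite ler_pM2l// ltr_pwDl// mulr_ge0// sqr_ge0.
    have xu : x ^+ 2 = 8 / 3 * s ^+ 2 * u by rewrite /u; field.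
    have : `|x| <= 1 + x ^+ 2.
      by rewrite -real_normK ?num_real//; nra.
    rewrite {1}xu; have : 0 <= 8 / 3 * s ^+ 2 by rewrite mulr_ge0// sqr_ge0.
    nra.
rewrite ge0_integralZl//; last 3 first.
- by apply/measurable_EFinP; exact: measurable_normal_pdf.
- by move=> x _; rewrite lee_fin normal_pdf_ge0.
- by rewrite lee_fin divr_ge0 ?(ltW p2)// mulr_ge0 ?(ltW p1)// addr_ge0// mulr_ge0// sqr_ge0.
by rewrite integral_normal_pdf mule1 ltry.
Qed.

End gaussian_increment.

(** * Symmetric laws and Brownian increments *)

Section martingale.
Context {R : realType} {disp : measure_display} {Omega : measurableType disp}.
Variable P : probability Omega R.
Implicit Types (X : Omega -> R) (G : set (set Omega)).
Local Notation rintegrable := (rintegrable P).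
Local Notation mean := (mean P).
Local Notation cond_mean_zero := (cond_mean_zero P).

(** The positive parts of X and - X have the same law, hence the same mean, and X is their
    difference. *)
Lemma mean_symmetric X : rintegrable X ->
  (forall B, measurable B -> P (X @^-1` B) = P ((fun w => - X w) @^-1` B)) ->
  mean X = 0.
Proof.
move=> iX XN; have mX := rintegrable_measurable iX.
have mNX : measurable_fun setT (fun w => - X w) by exact: measurableT_comp.
have mp : measurable_fun setT (fun x : R => Num.max x 0) by exact: measurable_maxr.
have pE (Y : Omega -> R) : measurable_fun setT Y ->
    mean (fun w => Num.max (Y w) 0) =
    fine (\int[pushforward P Y]_x (Num.max x 0)%:E).
  move=> mY; rewrite ge0_integral_pushforward//.
  - by apply/measurable_EFinP.
  - by move=> x _; rewrite lee_fin le_max lexx orbT.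
have iM (Y : Omega -> R) : rintegrable Y -> rintegrable (fun w => Num.max (Y w) 0).
  move=> iY; apply: (rintegrable_le _ _ iY).
    exact: measurableT_comp mp (rintegrable_measurable iY).
  by move=> w; rewrite maxEle; case: ifP => // _; rewrite normr0.
transitivity (mean (fun w => Num.max (X w) 0) - mean (fun w => Num.max (- X w) 0)).
  rewrite -meanB; [|exact: iM|by apply: iM; exact: rintegrableN].
  apply: eq_Rintegral => w _.
  by rewrite !maxEle; do 2 case: ifP; lra.
apply/eqP; rewrite subr_eq0; apply/eqP; rewrite !pE//; congr fine.
by apply: eq_measure_integral => B mB _; exact: XN.
Qed.

Lemma integral_law (X : Omega -> measurableTypeR R)
    (nu : {measure set (measurableTypeR R) -> \bar R}) (g : measurableTypeR R -> \bar R) :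
  measurable_fun setT X ->
  (forall B, measurable B -> P (X @^-1` B) = nu B) ->
  measurable_fun setT g -> (forall x, 0 <= g x)%E ->
  (\int[P]_w g (X w) = \int[nu]_x g x)%E.
Proof.
move=> mX XB mg g0.
pose M := isMeasurableFun.Build _ _ _ _ _ mX.
pose V : {RV P >-> measurableTypeR R} := HB.pack X M.
rewrite -(ge0_integral_distribution V)//.
have := @eq_measure_integral _ (measurableTypeR R) R setT nu (distribution P V) g.
apply=> B mB _; exact: XB.
Qed.

(** By independence from G and evenness of the Gaussian law, 1_A X is symmetric for every A in G, so
    its mean vanishes. *)
Lemma gaussian_cond_mean_zero G X (s : R) : sub_sigma G -> 0 < s ->
  measurable_fun setT X ->
  (forall A B, G A -> measurable B ->
     P (A `&` X @^-1` B) = (P A * normal_prob 0 s B)%E) ->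
  cond_mean_zero G X.
Proof.
move=> sG s0 mX law; have [sGG GO] := sG; have [G0 GC _] := sGG.
have GT : G setT by rewrite -setC0 -setTD; exact: GC.
have iX : rintegrable X.
  apply/integrableP; split; first exact/measurable_EFinP.
  rewrite (@integral_law _ (normal_prob 0 s) (fun x => `|x|%:E)) ?normal_abs_moment//.
  - move=> B mB; have := law _ _ GT mB; rewrite setTI => ->.
    by have /= -> := @probability_setT _ _ _ P; rewrite mul1e.
  - by apply/measurable_EFinP; exact: normr_measurable.
apply: cond_mean_zero_sets => // A GA.
have mA : measurable A by exact: GO.
have lawN B : measurable B -> P (A `&` X @^-1` B) = P (A `&` X @^-1` (-%R @^-1` B)).
  move=> mB; rewrite !law ?normal_prob_opp ?gt_eqF//.
  by rewrite -[X in measurable X]setTI; exact: (@oppr_measurable R setT).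
apply: mean_symmetric.
  by apply: rintegrable_bM sG _ iX; exact: bounded_meas_indic.
have mI B : measurable B -> measurable (A `&` X @^-1` B).
  by move=> mB; apply: measurableI => //; rewrite -[X in measurable X]setTI; exact: mX.
have mNB (B : set R) : measurable B -> measurable (-%R @^-1` B : set R).
  by move=> mB; rewrite -[X in measurable X]setTI; exact: (@oppr_measurable R setT).
move=> B mB.
(* Outside A the variable is 0, so that part of the preimage depends only on whether 0 lies in B and
   is the same for X and - X. *)
have dec (Y : Omega -> R) : (fun w => \1_A w * Y w) @^-1` B =
    (A `&` Y @^-1` B) `|` (~` A `&` [set w | B 0]).
  apply/seteqP; split => w /=; rewrite indicE.
    by have [/set_mem Aw|/negP/(contra_not (@mem_set _ _ _)) Aw] := boolP (w \in A);
      rewrite ?mul1r ?mul0r; [left|right].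
  by move=> [[Aw]|[Aw]]; [rewrite mem_set// mul1r|rewrite memNset// mul0r].
have -> : (fun w => - (\1_A w * X w)) = (fun w => \1_A w * - X w).
  by apply/funext => w; rewrite mulrN.
rewrite !dec.
have mC : measurable (~` A `&` [set w | B 0]).
  apply: measurableI; first exact: measurableC.
  case: (pselect (B 0)) => b.
    by rewrite (_ : [set _ | _] = setT)//; apply/seteqP; split.
  by rewrite (_ : [set _ | _] = set0)//; apply/seteqP; split.
rewrite !measureU//=.
- by rewrite lawN.
- exact: (mI _ (mNB _ mB)).
- by apply/seteqP; split => w // [[? _] []].
- exact: mI.
- by apply/seteqP; split => w // [[? _] []].
Qed.

(** * The stochastic integral is a martingale *)

Section ito.
Variables (d : nat) (W : 'I_d -> R -> Omega -> R) (F : R -> set (set Omega)) (T : R).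
Hypothesis Fsub : forall t : R, 0 <= t <= T -> sub_sigma (F t).
Hypothesis Fmono : forall s t : R, 0 <= s -> s <= t -> t <= T -> F s `<=` F t.
Hypothesis BM : brownian_motion P W F T.
Implicit Type K : @simple_process R _ Omega d.

Lemma brownian_measurable j t : 0 <= t <= T -> measurable_fun setT (W j t).
Proof.
move=> t0T; have [Wad _ _ _] := BM.
by apply: meas_wrt_measurable (Fsub t0T) _; apply: Wad; rewrite /= in_itv.
Qed.

Lemma brownian_increment j s t : 0 <= s -> s <= t -> t <= T ->
  cond_mean_zero (F s) (fun w => W j t w - W j s w).
Proof.
move=> s0 st tT; have [_ _ _ Winc] := BM.
move: st; rewrite le_eqVlt => /predU1P[<-|st].
  by under eq_fun do rewrite subrr; exact: cond_mean_zero0.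
have sT : 0 <= s <= T by rewrite s0 (le_trans (ltW st)).
have tT' : 0 <= t <= T by rewrite tT (le_trans s0 (ltW st)).
apply: (@gaussian_cond_mean_zero _ _ (Num.sqrt (t - s))); first exact: Fsub.
- by rewrite sqrtr_gt0 subr_gt0.
- by apply: measurable_funB; exact: brownian_measurable.
move=> A B FA mB.
(* The joint law is tested with the whole line in every component other than j, which leaves a
   single factor of the product. *)
have := Winc s t A (fun i => if i == j then B else setT) s0 st tT FA.
rewrite (_ : [set w | _] = (fun w => W j t w - W j s w) @^-1` B); last first.
  apply/seteqP; split => w /=; first by move=> /(_ j); rewrite eqxx.
  by move=> Bw i; case: eqP => [->|].
move=> ->; last by move=> i; case: ifP.
rewrite (bigD1 j)//= eqxx big1 ?mule1// => i /negbTE ->.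
have /= := @probability_setT _ _ _ (normal_prob 0 (Num.sqrt (t - s)) :
  probability (measurableTypeR R) R).
by move=> ->.
Qed.

Lemma simple_wf_time S K : simple_wf F S K ->
  forall k, (k <= sp_size K)%N -> 0 <= sp_time K k <= S.
Proof.
move=> [t0 tle tS _ _] k kn.
have mono i j : (i <= j)%N -> (j <= sp_size K)%N -> sp_time K i <= sp_time K j.
  move=> ij; rewrite -(subnKC ij); elim: (j - i)%N => [|l IH]; first by rewrite addn0.
  rewrite addnS => h; apply: le_trans (IH (ltnW h)) _; exact: tle.
by rewrite (le_trans t0 (mono _ _ (leq0n _) kn))/= (le_trans (mono _ _ kn (leqnn _))).
Qed.

Lemma simple_int_measurable S K t : S <= T -> 0 <= t <= S -> simple_wf F S K ->
  measurable_fun setT (simple_int W K t).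
Proof.
move=> ST /andP[t0 tS] wf; have [_ _ _ _ adK] := wf.
apply: measurable_sum => k; apply: measurable_sum => j.
have /andP[p0 pS] := simple_wf_time wf (ltnW (ltn_ord k)).
have /andP[q0 qS] := simple_wf_time wf (ltn_ord k).
apply: measurable_funM.
  apply: meas_wrt_measurable (adK k j (ltn_ord k)).
  by apply: Fsub; rewrite p0 (le_trans pS).
by apply: measurable_funB; apply: brownian_measurable;
  rewrite le_min ge_min ?p0 ?q0 t0 (le_trans tS ST) orbT.
Qed.

(** Each summand is a coefficient known at time [p] times an increment of W that starts after both
    [s] and [p]; conditioning at the later of these two times kills it. The case distinction locates
    [s, t] relative to [p, q]. *)
Lemma simple_int_martingale S K s t : S <= T -> simple_wf F S K ->
  0 <= s -> s <= t -> t <= S ->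
  cond_mean_zero (F s) (fun w => simple_int W K t w - simple_int W K s w).
Proof.
move=> ST wf s0 st tS; have [_ tle _ [c Kc] adK] := wf.
have tT := le_trans tS ST.
have sFs : sub_sigma (F s) by apply: Fsub; rewrite s0 (le_trans st).
under eq_fun => w.
  rewrite /simple_int -sumrB.
  under eq_bigr do rewrite -sumrB.
  over.
apply: cond_mean_zero_sum => // k; apply: cond_mean_zero_sum => // j.
under eq_fun do rewrite -mulrBr.
set p := sp_time K k; set q := sp_time K k.+1.
have /andP[p0 pS] : 0 <= p <= S by apply: simple_wf_time wf _ (ltnW (ltn_ord k)).
have /andP[q0 qS] : 0 <= q <= S by apply: simple_wf_time wf _ (ltn_ord k).
have pq : p <= q by exact: tle.
have sFp : sub_sigma (F p) by apply: Fsub; rewrite p0 (le_trans pS).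
have bH : bounded_meas (F p) (sp_coef K k j).
  by split; [exact: adK|exists c => w; exact: Kc].
have main r r' : s <= r -> p <= r -> r <= r' -> r' <= T ->
    cond_mean_zero (F s) (fun w => sp_coef K k j w * (W j r' w - W j r w)).
  move=> sr pr rr' r'T; have rT := le_trans rr' r'T.
  apply: (@cond_mean_zeroS _ _ _ P _ (F r)); first exact: Fmono.
  apply: cond_mean_zeroM.
  - by apply: Fsub; rewrite (le_trans s0 sr).
  - case: bH => mH bH; split => //; apply: meas_wrtS mH; exact: Fmono.
  - by apply: brownian_increment => //; exact: le_trans s0 sr.
have ext r r' (X : Omega -> R) : s <= r -> p <= r -> r <= r' -> r' <= T ->
    (forall w, X w = sp_coef K k j w * (W j r' w - W j r w)) -> cond_mean_zero (F s) X.
  by move=> h1 h2 h3 h4 /funext ->; exact: main h1 h2 h3 h4.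
have zero (X : Omega -> R) : (forall w, X w = 0) -> cond_mean_zero (F s) X.
  by move=> /funext ->; exact: cond_mean_zero0.
have mqT : Num.min q t <= T by rewrite ge_min tT orbT.
have [sp|/ltW ps] := leP s p.
  have [tp|/ltW pt] := leP t p.
    apply: zero => w; rewrite !min_r ?subrr ?mulr0 ?(le_trans tp)//.
    by rewrite (le_trans st)// (le_trans tp).
  apply: (ext p (Num.min q t)) => //; first by rewrite le_min pq pt.
  by move=> w; rewrite (min_r (le_trans sp pq)) subrr subr0.
have pt := le_trans ps st.
have [qs|/ltW sq] := leP q s.
  by apply: zero => w; rewrite !min_l ?subrr ?mulr0// (le_trans qs).
apply: (ext s (Num.min q t)) => //; first by rewrite le_min sq st.
by move=> w; rewrite (min_l pt); congr (_ * _); ring.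
Qed.

(** Young's inequality |x| <= x^2 / (2 e) + e / 2 gives integrability and the bound on the mean at
    once. *)
Lemma small_square_mean X (e : R) : 0 < e -> measurable_fun setT X ->
  (\int[P]_w ((X w) ^+ 2)%:E < (e ^+ 2)%:E)%E ->
  rintegrable X /\ mean (fun w => `|X w|) <= e.
Proof.
move=> e0 mX X2.
have iX2 : rintegrable (fun w => X w ^+ 2).
  apply/integrableP; split; first by apply/measurable_EFinP/measurable_funX.
  under eq_integral do rewrite /= ger0_norm ?sqr_ge0//.
  exact: lt_trans X2 (ltry _).
have X2e : mean (fun w => X w ^+ 2) <= e ^+ 2.
  by rewrite -lee_fin mean_EFin//; exact: ltW.
have dom w : `|X w| <= e^-1 / 2 * X w ^+ 2 + e / 2.
  rewrite -[X w ^+ 2]real_normK ?num_real//.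
  have := sqr_ge0 (`|X w| - e); set a := `|X w| => h.
  rewrite -(ler_pM2l e0) mulrDr !mulrA divff ?gt_eqF// mul1r; nra.
have iD : rintegrable (fun w => e^-1 / 2 * X w ^+ 2 + e / 2).
  by apply: rintegrableD; [exact: rintegrableZ|exact: rintegrable_cst].
have iX : rintegrable X.
  apply: rintegrable_le iD => // w; rewrite [leRHS]ger0_norm//.
  exact: le_trans (dom w).
split=> //; apply: le_trans (le_mean (rintegrable_norm iX) iD dom) _.
rewrite meanD ?mean_cst ?meanZ//; [|exact: rintegrableZ|exact: rintegrable_cst].
have : e^-1 / 2 * mean (fun w => X w ^+ 2) <= e^-1 / 2 * e ^+ 2.
  by rewrite ler_wpM2l// divr_ge0// invr_ge0 ltW.
have -> : e^-1 / 2 * e ^+ 2 = e / 2 by field; rewrite gt_eqF.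
lra.
Qed.

(** The property passes from the simple integrals to the limit: closeness in L^2 at the two times s
    and t bounds the L^1 error, which is all that a bounded weight sees. *)
Lemma ito_integral_martingale S Z M s t : S <= T -> ito_integral P W F S Z M ->
  0 <= s -> s <= t -> t <= S -> cond_mean_zero (F s) (fun w => M t w - M s w).
Proof.
move=> ST [Mad _ [K [wf _ L2]]] s0 st tS.
have sS := le_trans st tS; have t0 := le_trans s0 st.
have t0S : 0 <= t <= S by rewrite t0.
have s0S : 0 <= s <= S by rewrite s0.
have sFs : sub_sigma (F s) by apply: Fsub; rewrite s0 (le_trans sS).
have mM u : 0 <= u <= S -> measurable_fun setT (M u).
  move=> /andP[u0 uS]; apply: meas_wrt_measurable (Mad u _).
    by apply: Fsub; rewrite u0 (le_trans uS).
  by rewrite /= in_itv/= u0.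
have near_M (e : R) : 0 < e -> exists m, forall u, u = s \/ u = t ->
    rintegrable (fun w => M u w - simple_int W (K m) u w) /\
    mean (fun w => `|M u w - simple_int W (K m) u w|) <= e.
  move=> e0.
  have near_u u : 0 <= u <= S ->
      \forall m \near \oo, (\int[P]_w ((M u w - simple_int W (K m) u w) ^+ 2)%:E <
        (e ^+ 2)%:E)%E.
    move=> u0S; have := L2 u u0S [set x | (x < (e ^+ 2)%:E)%E]; apply.
    apply: open_nbhs_nbhs; split; first exact: open_ereal_lt_ereal.
    by rewrite /= lte_fin exprn_gt0.
  have [m [hs ht]] := filter_ex (filterI (near_u s s0S) (near_u t t0S)).
  have mI u : 0 <= u <= S -> measurable_fun setT (simple_int W (K m) u).
    by move=> u0S; exact: simple_int_measurable ST u0S (wf m).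
  by exists m => u [->|->]; apply: small_square_mean => //;
    apply: measurable_funB => //; [exact: mM|exact: mI|exact: mM|exact: mI].
have dec m w : M t w - M s w = (M t w - simple_int W (K m) t w) -
    (M s w - simple_int W (K m) s w) +
    (simple_int W (K m) t w - simple_int W (K m) s w) by ring.
have iM : rintegrable (fun w => M t w - M s w).
  have [m hm] := near_M 1 ltr01.
  under eq_fun do rewrite (dec m).
  apply: rintegrableD.
    by apply: rintegrableB; apply: (hm _ _).1; [right|left].
  exact: (simple_int_martingale ST (wf m) s0 st tS).1.
split=> // zeta bz; have [mz [c zc]] := bz.
have c0 : 0 <= c by have := zc point; apply: le_trans.
apply/eqP; rewrite -normr_le0; apply/ler_addgt0Pr => e e0; rewrite add0r.
(* Two errors, each multiplied by the bound [c] of the weight, must add up to at most e; adding 1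
   covers c = 0. *)
have d0 : 0 < e / (2 * (c + 1)) by rewrite divr_gt0// mulr_gt0// ltr_wpDl.
have [m hm] := near_M _ d0.
have [iIm Im0] := simple_int_martingale ST (wf m) s0 st tS.
have [iA hA] := hm t (or_intror erefl).
have [iB hB] := hm s (or_introl erefl).
have -> : mean (fun w => zeta w * (M t w - M s w)) =
    mean (fun w => zeta w * ((M t w - simple_int W (K m) t w) -
      (M s w - simple_int W (K m) s w))).
  rewrite -[RHS]addr0 -(Im0 _ bz) -meanD.
  - by apply: eq_Rintegral => w _; rewrite (dec m) mulrDr.
  - by apply: rintegrable_bM sFs bz _; exact: rintegrableB.
  - exact: rintegrable_bM sFs bz iIm.
apply: le_trans (norm_mean_le _) _.
  by apply: rintegrable_bM sFs bz _; exact: rintegrableB.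
apply: (@le_trans _ _ (mean (fun w => c * `|M t w - simple_int W (K m) t w| +
    c * `|M s w - simple_int W (K m) s w|))).
  apply: le_mean.
  - by apply: rintegrable_norm; apply: rintegrable_bM sFs bz _; exact: rintegrableB.
  - by apply: rintegrableD; apply: rintegrableZ; exact: rintegrable_norm.
  - move=> w; rewrite normrM -mulrDr ler_pM//; exact: ler_normB.
rewrite meanD ?meanZ; try by [exact: rintegrable_norm|apply: rintegrableZ; exact: rintegrable_norm].
apply: (@le_trans _ _ (c * (e / (2 * (c + 1))) + c * (e / (2 * (c + 1))))).
  by rewrite lerD// ler_wpM2l.
have -> : c * (e / (2 * (c + 1))) + c * (e / (2 * (c + 1))) = e * (c / (c + 1)).
  by field; rewrite gt_eqF// ltr_wpDl.
by rewrite ler_piMr ?(ltW e0)// ler_pdivrMr ?ltr_wpDl// mul1r lerDl.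
Qed.

End ito.
End martingale.

(** * The generator *)

Section generator.
Context {R : realType}.
Local Notation mu := (@lebesgue_measure R).

(** x^-1 = x (x^2)^-1 reduces the inverse to a power of a non-negative number; at 0 both sides
    vanish by convention. *)
Lemma measurable_invr : measurable_fun [set: R] (@GRing.inv R).
Proof.
rewrite (_ : @GRing.inv R = fun x => x * powR (x ^+ 2) (-1)).
  apply: measurable_funM => //.
  apply: (measurableT_comp (measurable_powR (-1))); exact: measurable_funX.
apply/funext => x; have [->|x0] := eqVneq x 0; first by rewrite invr0 mul0r.
by rewrite powR_inv1 ?sqr_ge0//; field.
Qed.

Variable f : R -> R.
Hypothesis gf : singular_generator f.

Lemma generator_lt0 x : 0 < x -> f x < 0.
Proof. by case: gf => _ [+ _]; apply. Qed.

Lemma generator0 : f 0 = 0.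
Proof. by case: gf => -[]. Qed.

Lemma generator_mono x y : x <= y -> f y <= f x.
Proof. by case: gf => -[_ h _ _ _] _; apply: h. Qed.

Lemma generator_le0 x : 0 <= x -> f x <= 0.
Proof. by move=> x0; rewrite -generator0 generator_mono. Qed.

Lemma generator_continuous : continuous f.
Proof. by case: gf => -[]. Qed.

Lemma measurable_generator : measurable_fun setT f.
Proof. by apply: continuous_measurable_fun; exact: generator_continuous. Qed.

Definition level (k : nat) : R := 2 ^+ k.

Lemma level_gt0 k : 0 < level k.
Proof. by rewrite exprn_gt0. Qed.

Lemma levelS k : level k.+1 = level k + level k.
Proof. by rewrite /level exprS mulr_natl mulr2n. Qed.

(** On [[level k, level k.+1[], an interval of length [level k], the integrand is at least its value
    at the right end, because f is non-increasing. *)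
Lemma level_sum_le_Gfun n :
  ((\sum_(k < n) level k / (- f (level k.+1)))%:E <=
   \int[mu]_(y in `[1%R, level n[) ((- f y)^-1)%:E)%E.
Proof.
have mi D : measurable_fun D (fun y => ((- f y)^-1)%:E).
  apply/measurable_EFinP/measurable_funTS.
  apply: (measurableT_comp measurable_invr).
  exact: (measurableT_comp _ measurable_generator).
elim: n => [|n IH].
  by rewrite big_ord0 integral_ge0// => y /=; rewrite in_itv/= => /andP[y1];
    rewrite /level expr0 ltNge y1.
have l1 : 1 <= level n by rewrite exprn_ege1// ler1n.
have ln : level n < level n.+1 by rewrite levelS ltrDl level_gt0.
have i0 y : 1 <= y -> (0 <= ((- f y)^-1)%:E)%E.
  move=> y1; rewrite lee_fin invr_ge0 oppr_ge0 ltW// generator_lt0//.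
  exact: lt_le_trans y1.
rewrite big_ord_recr/= EFinD (@itv_bndbnd_setU _ _ (BLeft 1) (BLeft (level n)))//.
rewrite ge0_integral_setU//=.
- apply: leeD => //.
  apply: (@le_trans _ _ (\int[mu]_(y in `[level n, level n.+1[)
     ((- f (level n.+1))^-1)%:E)%E).
    rewrite integral_cst//= lebesgue_measure_itv/= lte_fin ln.
    by rewrite levelS -EFinB -EFinM lee_fin addrK mulrC.
  apply: ge0_le_integral => //.
  + by move=> y _; apply: i0; apply: le_trans l1 _; exact: ltW.
  + exact: mi.
  + move=> y /=; rewrite in_itv/= => /andP[y1 y2]; rewrite lee_fin.
    have y0 : 0 < y by apply: lt_le_trans y1; exact: level_gt0.
    rewrite lef_pV2 ?posrE ?oppr_gt0 ?generator_lt0 ?level_gt0//.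
    by rewrite lerN2 generator_mono// ltW.
- exact: mi.
- by move=> y [] /=; rewrite in_itv/= => /andP[y1 _]; apply: i0 => //; exact: le_trans y1.
- by apply/disj_setPS => y [] /=; rewrite !in_itv/= => /andP[_ y1] /andP[]; rewrite leNgt y1.
- by rewrite bnd_simp ltW.
Qed.

(* The tails of sum_k 2^k / (- f (2^k)) are comparable with those of the integral
   defining G. *)
Lemma level_sum_tail (e : R) : 0 < e -> exists j0, forall j n, (j0 <= j)%N ->
  \sum_(j <= k < n) level k / (- f (level k)) <= e.
Proof.
move=> e0.
pose S n := \sum_(0 <= k < n) level k / (- f (level k.+1)).
have t0 k : 0 <= level k / (- f (level k)).
  by rewrite divr_ge0 ?(ltW (level_gt0 _))// oppr_ge0 ltW// generator_lt0 ?level_gt0.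
have s0 k : 0 <= level k / (- f (level k.+1)).
  by rewrite divr_ge0 ?(ltW (level_gt0 _))// oppr_ge0 ltW// generator_lt0 ?level_gt0.
have Sb n : S n <= fine (Gfun f 1).
  have /andP[G0 Goo] : (0 < Gfun f 1 < +oo)%E by case: gf => _ [_]; apply.
  rewrite -lee_fin fineK ?ge0_fin_numE ?(ltW G0)//.
  rewrite /S big_mkord; apply: le_trans (level_sum_le_Gfun n) _.
  rewrite /Gfun; apply: ge0_subset_integral => //=.
  - apply/measurable_EFinP/measurable_funTS.
    apply: (measurableT_comp measurable_invr).
    exact: (measurableT_comp _ measurable_generator).
  - move=> y /=; rewrite in_itv/= andbT => y1.
    rewrite lee_fin invr_ge0 oppr_ge0 ltW// generator_lt0//.
    exact: lt_le_trans y1.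
  - by move=> y /=; rewrite !in_itv/= andbT => /andP[].
have hS : has_sup (range S).
  split; first by exists (S 0%N); exists 0%N.
  by exists (fine (Gfun f 1)) => _ [n _ <-]; exact: Sb.
(* Past [j0] the tail of the bounded increasing sums [S] is below e / 2. The sum to be bounded is
   the shifted one, and [level k.+1 = 2 * level k] costs the factor 2. *)
have [_ [j0 _ <-] hj] := sup_adherent (divr_gt0 e0 (ltr0Sn _ 1)) hS.
exists j0.+1 => j n; case: j => // j jj.
have [nj|jn] := leqP n j.+1; first by rewrite big_geq ?ltW.
case: n jn => // n jn.
rewrite big_add1/=.
apply: (@le_trans _ _ (2 * \sum_(j <= k < n) level k / (- f (level k.+1)))).
  rewrite mulr_sumr; apply: ler_sum => k _.
  have -> : level k.+1 = 2 * level k by rewrite /level exprS.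
  by rewrite -mulrA.
have Sn : S n = S j0 + \sum_(j0 <= k < n) level k / (- f (level k.+1)).
  by rewrite /S -big_cat_nat//; exact: leq_trans jj (ltnW jn).
have Sj : \sum_(j <= k < n) level k / (- f (level k.+1)) <=
    \sum_(j0 <= k < n) level k / (- f (level k.+1)).
  rewrite [leRHS](big_cat_nat (n := j))//=; last exact: ltnW.
  by rewrite lerDr sumr_ge0.
have : S n <= sup (range S) by apply: ub_le_sup; [exact: hS.2|exists n].
move: hj Sj; rewrite Sn.
set a := sup _; set b := S j0; set c := \sum_(j0 <= k < n) _; set c' := \sum_(j <= k < n) _.
lra.
Qed.

Lemma deriv_nonneg_local (g g' : R -> R) (x e : R) : deriv_nonneg g g' -> 0 <= x -> 0 < e ->
  exists2 d, 0 < d & forall y, 0 <= y -> y != x -> `|y - x| < d ->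
    `|(g y - g x) / (y - x) - g' x| < e.
Proof.
move=> dg x0 e0; have /cvgrPdist_lt /(_ e e0) := dg x x0.
rewrite near_withinE => /nbhs_ballP[d /= d0 h]; exists d => // y y0 yx yd.
rewrite distrC; apply: h; last by split => //; exact/eqP.
by rewrite /ball/= distrC.
Qed.

(** Composing with max(., 0) discards the values of g on the negative half-line. Near m the
    difference quotient is bounded by |g' m| + 1, and the projection onto [0, oo[ is 1-Lipschitz. *)
Lemma deriv_nonneg_continuous (g g' : R -> R) : deriv_nonneg g g' ->
  continuous (fun x : R => g (Num.max x 0)).
Proof.
move=> dg x; apply/cvgrPdist_lt => e e0; set m := Num.max x 0.
have m0 : 0 <= m by rewrite le_max lexx orbT.
have [d d0 h] := deriv_nonneg_local dg m0 ltr01.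
near=> y; set k := Num.max y 0.
have k0 : 0 <= k by rewrite le_max lexx orbT.
have mk : `|k - m| <= `|y - x|.
  have h1 := ler_norm (y - x); have h2 := ler_norm (x - y); rewrite distrC in h2.
  rewrite /k /m ler_norml; case: (leP y 0) => y0; case: (leP x 0) => x0;
    apply/andP; split; lra.
have [->|km] := eqVneq k m; first by rewrite subrr normr0.
have yx1 : `|y - x| < d.
  by near: y; apply/nbhs_ballP; exists d => // z; rewrite /ball/= distrC.
have yx2 : `|y - x| < e / (`|g' m| + 1).
  near: y; apply/nbhs_ballP; exists (e / (`|g' m| + 1)).
    by rewrite /= divr_gt0// ltr_wpDl.
  by move=> z; rewrite /ball/= distrC.
have := h k k0 km (le_lt_trans mk yx1).
set q := (_ / _) => hq.
have -> : g m - g k = - (q * (k - m)).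
  by rewrite /q divfK ?subr_eq0// opprB.
rewrite normrN normrM.
have q1 : `|q| < `|g' m| + 1.
  have -> : q = g' m + (q - g' m) by ring.
  by apply: le_lt_trans (ler_normD _ _) _; rewrite ltrD2l.
apply: (@le_lt_trans _ _ ((`|g' m| + 1) * `|y - x|)).
  by rewrite ler_pM// ltW.
by rewrite mulrC -ltr_pdivlMr// ltr_wpDl.
Unshelve. all: by end_near. Qed.

Lemma deriv_nonneg_is_derive (g g' : R -> R) (x : R) : deriv_nonneg g g' -> 0 < x ->
  is_derive x 1 g (g' x).
Proof.
move=> dg x0.
suff h : (h^-1 *: ((g \o shift x) (h *: (1 : R)) - g x)) @[h --> 0^'] --> g' x.
  by split; [apply/cvg_ex; exists (g' x)|exact/cvg_lim].
apply/cvgrPdist_lt => e e0.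
have [d d0 h] := deriv_nonneg_local dg (ltW x0) e0.
near=> t.
have t0 : t != 0 by near: t; exact: nbhs_dnbhs_neq.
have td : `|t| < d by near: t; exact: dnbhs0_lt.
have tx : `|t| < x by near: t; exact: dnbhs0_lt.
have := h (t + x).
rewrite addrK distrC /= /shift/= [t *: 1]mulr1 => hh.
rewrite /GRing.scale/= mulrC; apply: hh => //.
  by move: tx; rewrite ltr_norml => /andP[]; lra.
by apply: contra_neq t0 => e1; lra.
Unshelve. all: by end_near. Qed.

(** The mean value theorem is applied to g composed with max(., 0), which is continuous on the
    closed segment even when it starts at 0. *)
Lemma deriv_nonneg_MVT (g g' : R -> R) (x y : R) : deriv_nonneg g g' -> 0 <= x -> x <= y ->
  exists2 c, x <= c <= y & g y - g x = g' c * (y - x).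
Proof.
move=> dg x0 xy.
have [|c|c cxy] := @MVT_segment R (fun z => g (Num.max z 0)) g' x y xy.
- move=> z; rewrite in_itv/= => /andP[xz _].
  have z0 : 0 < z by exact: le_lt_trans xz.
  have := deriv_nonneg_is_derive dg z0.
  apply: near_eq_is_derive => //.
  near=> t; rewrite max_l// ltW//; near: t; exact: lt_nbhsr.
- by apply: continuous_subspaceT => z; exact: (deriv_nonneg_continuous dg).
rewrite !max_l ?(le_trans x0 xy)// => e; by exists c.
Unshelve. all: by end_near. Qed.

(** The second derivative is bounded by some L on the compact [0, U], so f1 is L-Lipschitz there and
    bounded by |f1 0| + L U. By the mean value theorem the remainder is (f1 z - f1 x) (y - x) with z
    between x and y. The function f1 serves for all U; only K and L depend on U. *)
Lemma generator_taylor : exists f1 : R -> R,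
  continuous (fun x : R => f1 (Num.max x 0)) /\
  forall U, 0 <= U -> exists K L, [/\ 0 <= K, 0 <= L,
    (forall x, 0 <= x <= U -> `|f1 x| <= K) &
    (forall x y, 0 <= x <= U -> 0 <= y <= U ->
       `|f y - f x - f1 x * (y - x)| <= L * (y - x) ^+ 2)].
Proof.
have [[_ _ _ _ [f1 [f2 [df df1 cf2]]]] _] := gf.
exists f1; split; first exact: deriv_nonneg_continuous df1.
move=> U U0.
have cf2U : {within `[0, U], continuous f2}.
  apply: (continuous_subspaceW _ cf2) => z /=.
  by rewrite !in_itv/= andbT => /andP[].
have [c _ hc] := EVT_max U0 cf2U; have [c' _ hc'] := EVT_min U0 cf2U.
pose L := `|f2 c| + `|f2 c'|; exists (`|f1 0| + L * U), L.
have L0 : 0 <= L by rewrite addr_ge0.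
have f2L x : 0 <= x <= U -> `|f2 x| <= L.
  move=> xU; have := hc x; have := hc' x; rewrite in_itv/= => /(_ xU) h1 /(_ xU) h2.
  have h3 := ler_norm (f2 c); have h4 := ler_norm (- f2 c'); rewrite normrN in h4.
  have h5 : 0 <= `|f2 c| by []. have h6 : 0 <= `|f2 c'| by [].
  by rewrite ler_norml /L; apply/andP; split; lra.
have lip x y : 0 <= x -> x <= y -> y <= U -> `|f1 y - f1 x| <= L * (y - x).
  move=> x0 xy yU; have [z /andP[xz zy] ->] := deriv_nonneg_MVT df1 x0 xy.
  rewrite normrM [X in _ * X]ger0_norm ?subr_ge0// ler_wpM2r ?subr_ge0//.
  by apply: f2L; rewrite (le_trans x0 xz) (le_trans zy).
split=> //; first by rewrite addr_ge0// mulr_ge0.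
  move=> x /andP[x0 xU]; have -> : f1 x = f1 0 + (f1 x - f1 0) by ring.
  apply: le_trans (ler_normD _ _) _; rewrite lerD2l.
  apply: le_trans (lip 0 x (lexx _) x0 xU) _.
  by rewrite subr0 ler_wpM2l.
move=> x y /andP[x0 xU] /andP[y0 yU].
have [xy|/ltW yx] := leP x y.
  have [z /andP[xz zy] ->] := deriv_nonneg_MVT df x0 xy.
  rewrite -mulrBl normrM expr2 mulrA [X in _ * X <= _]ger0_norm ?subr_ge0//.
  rewrite ler_wpM2r ?subr_ge0//; apply: le_trans (lip x z x0 xz (le_trans zy yU)) _.
  by rewrite ler_wpM2l// lerD2r.
have [z /andP[yz zx] e] := deriv_nonneg_MVT df y0 yx.
have -> : f y - f x - f1 x * (y - x) = (f1 x - f1 z) * (x - y).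
  have -> : f y = f x - f1 z * (x - y) by rewrite -e; ring.
  ring.
rewrite -sqrrN opprB normrM expr2 mulrA [X in _ * X <= _]ger0_norm ?subr_ge0//.
rewrite ler_wpM2r ?subr_ge0//.
apply: le_trans (lip z x (le_trans y0 yz) zx xU) _.
by rewrite ler_wpM2l// lerD2l lerN2.
Qed.

End generator.

(** * Measurability, boundedness and time integrals of paths *)

Section processes.
Context {R : realType} {disp : measure_display} {Omega : measurableType disp}.
Variable P : probability Omega R.
Local Notation mu := (@lebesgue_measure R).
Local Notation rintegrable := (rintegrable P).
Local Notation mean := (mean P).

Lemma itv_integrable (s t K : R) (g : R -> R) (b0 b1 : bool) :
  measurable_fun [set` Interval (BSide b0 s) (BSide b1 t)] g ->
  (forall v, [set` Interval (BSide b0 s) (BSide b1 t)] v -> `|g v| <= K) ->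
  mu.-integrable [set` Interval (BSide b0 s) (BSide b1 t)] (EFin \o g).
Proof.
move=> mg gK; apply: measurable_bounded_integrable => //.
  by rewrite /= lebesgue_measure_itv/=; case: ifP => _; rewrite ?ltry// -EFinB ltry.
exists K; split; first exact: num_real.
by move=> x Kx v /= vst; apply: le_trans (gK v vst) (ltW Kx).
Qed.

Lemma Rintegral_itv_cst (s t c : R) : s <= t -> \int[mu]_(v in `[s, t]) c = c * (t - s).
Proof.
move=> st; rewrite Rintegral_cst//= lebesgue_measure_itv/= lte_fin.
move: st; rewrite le_eqVlt => /predU1P[->|->]; last by [].
by rewrite ltxx subrr !mulr0.
Qed.

Lemma Rintegral_itv_norm_le (s t K : R) (g : R -> R) : s <= t ->
  measurable_fun `[s, t] g -> (forall v, s <= v <= t -> `|g v| <= K) ->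
  `|\int[mu]_(v in `[s, t]) g v| <= K * (t - s).
Proof.
move=> st mg gK; rewrite -Rintegral_itv_cst//.
have ig : mu.-integrable `[s, t] (EFin \o g).
  by apply: (@itv_integrable _ _ K) => // v; rewrite /= in_itv; exact: gK.
apply: le_trans (le_normr_Rintegral _ ig) _ => //.
apply: le_Rintegral => //.
- exact: integrable_norm.
- by apply: (@itv_integrable _ _ `|K|).
Qed.

(** Fubini's theorem for a bounded integrand. The bound on the means is asked on [s, t[ only, the
    end point being Lebesgue null. *)
Lemma fubini_mean_le (G : measurableTypeR R * Omega -> R) (s t C c : R) : s <= t ->
  measurable_fun setT G -> (forall z, `|G z| <= C) ->
  (forall v, s <= v < t -> mean (fun w => G (v, w)) <= c) ->
  rintegrable (fun w => \int[mu]_(v in `[s, t]) G (v, w)) /\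
  mean (fun w => \int[mu]_(v in `[s, t]) G (v, w)) <= c * (t - s).
Proof.
move=> st mG GC Gc.
have C0 : 0 <= C by apply: le_trans (GC (0, point)).
pose H (z : measurableTypeR R * Omega) : \bar R := (\1_(`[s, t[ `*` setT) z * G z)%:E.
have mI : measurable (`[s, t[%classic `*` setT : set (measurableTypeR R * Omega)) by exact: measurableX.
have mH : measurable_fun setT H.
  by apply/measurable_EFinP/measurable_funM => //; exact: measurable_indic.
have Ifin : ((mu \x P) (`[s, t[%classic `*` setT) < +oo)%E.
  rewrite product_measure1E//=.
  have /= -> := @probability_setT _ _ _ P.
  rewrite mule1 lebesgue_measure_itv/=; case: ifP => _; rewrite ?ltry//.
have iH : (mu \x P)%E.-integrable setT H.
  have iC : (mu \x P)%E.-integrable setT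
      (fun z => C%:E * (\1_(`[s, t[%classic `*` setT) z)%:E)%E.
    apply: integrableZl => //; apply/integrableP; split.
      by apply/measurable_EFinP; exact: measurable_indic.
    under eq_integral do rewrite gee0_abs ?lee_fin//.
    by rewrite integral_indic// setIT.
  apply: (le_integrable measurableT mH _ iC) => z _.
  rewrite /H/= lee_fin !normrM mulrC.
  by rewrite ler_wpM2r// (le_trans (GC z))// ler_norm.
have fub := @Fubini _ _ _ _ _ mu P H iH.
have pth w : (\int[mu]_v H (v, w) = (\int[mu]_(v in `[s, t]) G (v, w))%:E)%E.
  have iG : mu.-integrable `[s, t[ (EFin \o (fun v => G (v, w))).
    apply: (@itv_integrable _ _ C) => [|v _]; last exact: GC.
    by apply: measurable_funTS; exact: (measurableT_comp mG (measurable_pair2 w)).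
  rewrite -Rintegral_itv_bndo_bndc// /Rintegral fineK; last exact: integrable_fin_num.
  rewrite [RHS]integral_mkcond; apply: eq_integral => v _.
  rewrite /H patchE indicE/=; case: ifPn => [/set_mem vst|/negP vst].
    by rewrite mem_set// mul1r.
  rewrite memNset ?mul0r// => -[h _]; apply: vst; exact: mem_set.
have iP : rintegrable (fun w => \int[mu]_(v in `[s, t]) G (v, w)).
  have mP : measurable_fun setT (fun w => \int[mu]_(v in `[s, t]) G (v, w)).
    apply/measurable_EFinP.
    rewrite (_ : EFin \o _ = fubini_G mu H); last by apply/funext => w; rewrite /= -pth.
    exact: measurable_fubini_G iH.
  apply: (@rintegrable_bounded _ _ _ P _ (C * (t - s)) mP) => w.
  by apply: Rintegral_itv_norm_le => //; apply: measurable_funTS;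
    exact: (measurableT_comp mG (measurable_pair2 w)).
split=> //; rewrite -lee_fin mean_EFin//.
under eq_integral do rewrite -pth.
rewrite -fub.
have inn v : (\int[P]_w H (v, w) = (\1_(`[s, t[) v * mean (fun w => G (v, w)))%:E)%E.
  have iG : rintegrable (fun w => G (v, w)).
    apply: (@rintegrable_bounded _ _ _ _ _ C) => [|w]; last exact: GC.
    exact: (measurableT_comp mG (measurable_pair1 v)).
  rewrite EFinM mean_EFin// -integralZl//.
  apply: eq_integral => w _; rewrite /H EFinM; congr (_%:E * _)%E.
  rewrite !indicE; congr (_%:R); congr nat_of_bool.
  by apply/idP/idP => /set_mem => [[h _]|h]; apply: mem_set.
have iF := @integrable_fubini_F _ _ _ _ _ mu P H iH.
apply: (@le_trans _ _ (\int[mu]_v (c * \1_(`[s, t[) v)%:E)%E).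
  apply: le_integral => //.
    by under eq_fun do rewrite EFinM; apply: integrableZl => //; exact: integrable_indic_itv.
  move=> v _ /=; rewrite inn lee_fin [leRHS]mulrC !indicE.
  case: (boolP (v \in _)) => [/set_mem /=|_]; rewrite ?mul0r//.
  by rewrite in_itv/= => vst; rewrite !mul1r; exact: Gc.
under eq_integral do rewrite EFinM.
rewrite integralZl//; last exact: integrable_indic_itv.
rewrite integral_indic//= setIT lebesgue_measure_itv/= lte_fin.
move: st; rewrite le_eqVlt => /predU1P[->|->]; last by rewrite -EFinB -EFinM.
by rewrite ltxx mule0 subrr mulr0.
Qed.

(** By right continuity the process is the pointwise limit of its values at the next point, strictly
    to the right, of the grid of mesh 1 / (m + 1) cut at S. Each approximation is a finite sum of
    products of a function of time and a function of w. *)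
Lemma jointly_measurable (S : R) (Y : R -> Omega -> R) : 0 < S ->
  (forall t, 0 <= t <= S -> measurable_fun setT (Y t)) ->
  (forall w t, 0 <= t < S -> Y u w @[u --> t^'+] --> Y t w) ->
  measurable_fun setT (fun z : measurableTypeR R * Omega => if 0 <= z.1 < S then Y z.1 z.2 else 0).
Proof.
move=> S0 mY rY.
pose gr (m k : nat) : R := Num.min S (k.+1%:R / m.+1%:R).
pose I (m k : nat) := [set v : R | 0 <= v < S /\ Num.truncn (v * m.+1%:R) = k].
pose h (m : nat) (z : measurableTypeR R * Omega) : R :=
  \sum_(k < (Num.truncn (S * m.+1%:R)).+1) \1_(I m k) z.1 * Y (gr m k) z.2.
have mI m k : measurable (I m k).
  rewrite (_ : I m k = `[0, S[%classic `&` `[k%:R / m.+1%:R, k.+1%:R / m.+1%:R[).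
    exact: measurableI.
  apply/seteqP; split => v /=; rewrite !in_itv/=.
    move=> [vS <-]; split => //; rewrite ler_pdivrMr// ltr_pdivlMr//.
    by apply: truncn_itv; rewrite mulr_ge0//; case/andP: vS.
  move=> [vS]; rewrite ler_pdivrMr// ltr_pdivlMr// => hv; split => //.
  exact/truncn_def.
have gr0 m k : 0 <= gr m k <= S by rewrite le_min ge_min lexx (ltW S0) divr_ge0.
have mh m : measurable_fun setT (h m).
  apply: measurable_sum => k; apply: measurable_funM.
    have mi : measurable_fun setT (\1_(I m k) : measurableTypeR R -> R) by apply: measurable_indic; exact: mI.
    exact: (measurableT_comp mi measurable_fst).
  exact: (measurableT_comp (mY _ (gr0 m k)) measurable_snd).
apply: (measurable_fun_cvg mh) => -[v w] _ /=.
have hE m : h m (v, w) = if 0 <= v < S then Y (gr m (Num.truncn (v * m.+1%:R))) w else 0.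
  rewrite /h/=; case: ifPn => vS; last first.
    by apply: big1 => k _; rewrite indicE memNset ?mul0r// => -[h1 _]; rewrite h1 in vS.
  have km : (Num.truncn (v * m.+1%:R) < (Num.truncn (S * m.+1%:R)).+1)%N.
    by rewrite ltnS le_truncn// ler_pM2r//; case/andP: vS => _ /ltW.
  rewrite (bigD1 (Ordinal km))//= indicE mem_set// mul1r big1 ?addr0// => k kk.
  rewrite indicE memNset ?mul0r// => -[_ e].
  by move/negP: kk; apply; apply/eqP/val_inj; rewrite /= e.
case: ifPn => vS; last first.
  by rewrite (_ : h ^~ (v, w) = fun=> 0); [exact: cvg_cst|apply/funext => m; rewrite hE (negbTE vS)].
have [v0 vltS] := andP vS.
apply/cvgrPdist_lt => e e0.
have /cvgrPdist_lt /(_ e e0) := rY w v vS.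
rewrite near_withinE => /nbhs_ballP[d /= d0 hd].
near=> m; rewrite hE vS; apply: hd.
  rewrite /ball/= distrC ger0_norm.
    rewrite ltrBlDr; apply: (@le_lt_trans _ _ ((Num.truncn (v * m.+1%:R)).+1%:R / m.+1%:R)).
      by rewrite ge_min lexx orbT.
    have h1 : (Num.truncn (v * m.+1%:R))%:R <= v * m.+1%:R by rewrite truncn_le mulr_ge0.
    have h2 : 1 < d * m.+1%:R.
      rewrite -ltr_pdivrMl// mulr1; near: m.
      exists (Num.truncn d^-1) => // n /= hn.
      by apply: lt_le_trans (truncnS_gt _) _; rewrite ler_nat.
    rewrite ltr_pdivrMr// -[_.+1%:R]natr1 mulrDl; lra.
  rewrite subr_ge0 le_min (ltW vltS)/= ler_pdivlMr//; exact/ltW/truncnS_gt.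
by rewrite lt_min vltS/= ltr_pdivlMr//; exact: truncnS_gt.
Unshelve. all: by end_near. Qed.

(** A single path is treated as a process that does not depend on w. *)
Lemma jointly_measurable_path (S : R) (Y : R -> R) : 0 < S ->
  (forall t, 0 <= t < S -> Y u @[u --> t^'+] --> Y t) ->
  measurable_fun `[0, S] Y.
Proof.
move=> S0 rY; apply/measurable_fun_itv_bndo_bndcP.
have := @jointly_measurable S (fun v (_ : Omega) => Y v) S0
  (fun t _ => measurable_cst _) (fun _ => rY).
move=> /(fun h => measurableT_comp h (measurable_pair2 (point : Omega))) h.
apply: (eq_measurable_fun (fun v : R => if 0 <= v < S then Y v else 0)).
  by move=> v /set_mem /=; rewrite in_itv/= => ->.
exact: measurable_funTS.
Qed.

(** At time T the sets of [progressive] lie in the full product sigma-algebra, since [F T] contains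
    all measurable sets; the preimages under a path are their sections. *)
Lemma progressive_path (F : R -> set (set Omega)) (T : R) (X : R -> Omega -> R) :
  0 <= T -> F T = @measurable _ Omega -> progressive F T X ->
  forall w, measurable_fun `[0, T] (X ^~ w).
Proof.
move=> T0 FT pX w _ B mB.
have := pX T; rewrite T0 lexx => /(_ isT B mB).
set A := [set z | _] => FA.
have mA : measurable (A : set (measurableTypeR R * Omega)).
  apply: FA; split; first exact: sigma_algebra_measurable.
  move=> _ [C [D [mC FD ->]]]; apply: measurableX => //.
  by rewrite FT in FD.
rewrite (_ : _ `&` _ = ysection A w); first exact: measurable_ysection.
apply/seteqP; split => v; rewrite /ysection/= in_itv/=.
  by move=> [vT Bv]; apply: mem_set.
by move=> /set_mem [].
Qed.

(** Consider the supremum c of the times up to which the path is bounded. The left limit at c shows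
    that c is one of them, and right continuity at c would lead further if c < s. *)
Lemma cadlag_bounded (s : R) (y : R -> R) : 0 <= s -> cadlag s y ->
  exists K, forall t, 0 <= t <= s -> `|y t| <= K.
Proof.
move=> s0 [yr yl].
pose E := [set t | 0 <= t <= s /\ exists K, forall u, 0 <= u <= t -> `|y u| <= K].
have E0 : E 0.
  split; first by rewrite lexx.
  by exists `|y 0| => u; rewrite -eq_le => /eqP <-.
have Es : has_sup E.
  by split; [exists 0|exists s => t [/andP[]]].
set c := sup E.
have c0 : 0 <= c by apply: ub_le_sup => //; exact: Es.2.
have cs : c <= s by apply: ge_sup; [exact: Es.1|move=> t [/andP[]]].
have Ec : E c.
  split; first by rewrite c0.
  move: c0; rewrite le_eqVlt => /predU1P[<-|c0]; first exact: E0.2.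
  have /cvg_ex[/= l] := yl c (introT andP (conj c0 cs)).
  move=> /cvgrPdist_lt /(_ 1 ltr01); rewrite near_withinE => /nbhs_ballP[d /= d0 hd].
  have [e [_ [K hK]] ce] := sup_adherent d0 Es.
  exists (Num.max K (Num.max (`|l| + 1) `|y c|)) => u /andP[u0 uc].
  have [ue|eu] := leP u e; first by rewrite le_max hK ?u0.
  move: uc; rewrite le_eqVlt => /predU1P[->|uc]; first by rewrite !le_max lexx !orbT.
  rewrite !le_max; apply/orP; right; apply/orP; left.
  have := hd u; rewrite /ball/= distrC => /(_ _ uc).
  have -> : `|u - c| < d.
    by rewrite distrC gtr0_norm ?subr_gt0// ltrBlDr -ltrBlDl (lt_trans _ eu).
  move=> /(_ isT) h; have -> : y u = l - (l - y u) by ring.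
  by apply: le_trans (ler_normB _ _) _; rewrite lerD2l ltW.
move: cs; rewrite le_eqVlt => /predU1P[<-|cs]; first exact: Ec.2.
exfalso.
have /cvgrPdist_lt /(_ 1 ltr01) := yr c (introT andP (conj c0 cs)).
rewrite near_withinE => /nbhs_ballP[d /= d0 hd].
pose c' := Num.min s (c + d / 2).
have cc' : c < c' by rewrite lt_min cs ltrDl divr_gt0.
suff : c' <= c by rewrite leNgt cc'.
apply: ub_le_sup; first exact: Es.2.
split; first by rewrite ge_min lexx le_min s0 addr_ge0// divr_ge0// ltW.
have [_ [K hK]] := Ec.
exists (Num.max K (`|y c| + 1)) => u /andP[u0 uc'].
have [uc|cu] := leP u c; first by rewrite le_max hK ?u0.
rewrite le_max; apply/orP; right.
have := hd u; rewrite /ball/= distrC => /(_ _ cu).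
have -> : `|u - c| < d.
  rewrite gtr0_norm ?subr_gt0// ltrBlDl; apply: le_lt_trans uc' _.
  by rewrite gt_min ltrD2l ltr_pdivrMr// ltr_pMr// ltr1n orbT.
move=> /(_ isT) h; have -> : y u = y c - (y c - y u) by ring.
by apply: le_trans (ler_normB _ _) _; rewrite lerD2l ltW.
Qed.

End processes.

Section uniform_continuity.
Context {R : realType}.

(** Heine's theorem: continuity at x with error e / 2 serves all points near x, and compactness, in
    its near-covering form, yields a common d. *)
Lemma itv_unif_continuous (a b : R) (g : R -> R) :
  {within `[a, b], continuous g} -> forall e, 0 < e -> exists2 d, 0 < d &
    forall u v, a <= u <= b -> a <= v <= b -> `|u - v| < d -> `|g u - g v| < e.
Proof.
move=> cg e e0.
have cK : near_covering_within (`[a, b]%classic : set R).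
  by apply/near_covering_withinP/compact_near_coveringP; exact: segment_compact.
have loc x : `[a, b]%classic x -> exists2 d, 0 < d &
    forall u, a <= u <= b -> `|x - u| < d -> `|g x - g u| < e / 2.
  move=> xab; have /cvgrPdist_lt /(_ (e / 2)) := cg x.
  move=> /(_ (divr_gt0 e0 (ltr0Sn _ 1))).
  rewrite /nbhs/= /nbhs_subspace; case: ifPn => [_|/negP]; last by case; apply: mem_set.
  rewrite near_withinE => /nbhs_ballP[d /= d0 hd]; exists d => // u uab xu.
  by apply: hd => //; rewrite /= in_itv.
have h := cK R (0^'+)
    (fun d x => forall u, a <= u <= b -> `|x - u| < d -> `|g x - g u| < e) _.
have /h : forall x, `[a, b]%classic x -> \forall x' \near x & d \near 0^'+,
    `[a, b]%classic x' ->
    forall u, a <= u <= b -> `|x' - u| < d -> `|g x' - g u| < e.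
  move=> x xab; have [d d0 hd] := loc x xab.
  have d20 : 0 < d / 2 by rewrite divr_gt0.
  exists (ball x (d / 2), [set r | r < d / 2]).
    split => /=; first exact: nbhsx_ballx.
    exact: nbhs_right_lt.
  move=> [x' r] /= [xx' rd]; rewrite in_itv/= => x'ab u uab x'u.
  have h1 : `|g x - g x'| < e / 2.
    apply: hd => //; apply: lt_le_trans xx' _.
    by rewrite ler_pdivrMr// ler_pMr// ler1n.
  have h2 : `|g x - g u| < e / 2.
    apply: hd => //; have -> : x - u = (x - x') + (x' - u) by ring.
    apply: le_lt_trans (ler_normD _ _) _; have := lt_trans x'u rd.
    by rewrite /ball/= in xx'; lra.
  have -> : g x' - g u = (g x - g u) - (g x - g x') by ring.
  by apply: le_lt_trans (ler_normB _ _) _; lra.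
move=> {}h; have [d /= [d0 hd]] := filter_ex (filterI (@nbhs_right_gt R 0) h).
by exists d => // u v uab vab uv; apply: hd => //; rewrite /= in_itv.
Qed.

End uniform_continuity.

(** * A priori bound *)

Section drift_solution.
Context {R : realType} {disp : measure_display} {Omega : measurableType disp}.
Variable P : probability Omega R.
Local Notation mu := (@lebesgue_measure R).
Local Notation rintegrable := (rintegrable P).
Local Notation mean := (mean P).
Local Notation cond_mean_zero := (cond_mean_zero P).

Definition drift (f : R -> R) (a lam y : R -> Omega -> R) (v : R) (w : Omega) : R :=
  a v w * f (y v w) + lam v w.

(* [ds_dynamics] is y_s = E [ y_t + int_s^t (a_v f (y_v) + lam_v) dv | F_s ]. *)
Record drift_solution (F : R -> set (set Omega)) (S a_lo a_hi lam_hi : R) (f : R -> R)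
    (a lam y : R -> Omega -> R) : Prop := DriftSolution {
  ds_adapted : forall t, 0 <= t <= S -> meas_wrt (F t) (y t);
  ds_continuous : forall w, {within `[0, S], continuous (y ^~ w)};
  ds_ge0 : forall t w, 0 <= t <= S -> 0 <= y t w;
  ds_integrable : forall t, 0 <= t <= S -> rintegrable (y t);
  ds_a : forall t w, 0 <= t <= S -> a_lo <= a t w <= a_hi;
  ds_lam : forall t w, 0 <= t <= S -> 0 <= lam t w <= lam_hi;
  ds_ma : forall w, measurable_fun `[0, S] (a ^~ w);
  ds_mlam : forall w, measurable_fun `[0, S] (lam ^~ w);
  ds_drift_integrable : forall s t, 0 <= s -> s <= t -> t <= S ->
    rintegrable (fun w => \int[mu]_(v in `[s, t]) drift f a lam y v w);
  ds_dynamics : forall s t, 0 <= s -> s <= t -> t <= S ->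
    cond_mean_zero (F s) (fun w => y s w - y t w
      - \int[mu]_(v in `[s, t]) drift f a lam y v w) }.

Variables (F : R -> set (set Omega)) (S a_lo a_hi lam_hi : R) (f : R -> R).
Variables (a lam y : R -> Omega -> R).
Hypothesis gf : singular_generator f.
Hypothesis S0 : 0 < S.
Hypothesis a_lo0 : 0 < a_lo.
Hypothesis Fsub : forall t : R, 0 <= t <= S -> sub_sigma (F t).
Hypothesis Fmono : forall s t : R, 0 <= s -> s <= t -> t <= S -> F s `<=` F t.
Hypothesis dsP : drift_solution F S a_lo a_hi lam_hi f a lam y.

Lemma ds_measurable t : 0 <= t <= S -> measurable_fun setT (y t).
Proof. by move=> tS; apply: rintegrable_measurable; exact: (ds_integrable dsP). Qed.

Lemma ds_path_measurable w : measurable_fun `[0, S] (y ^~ w).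
Proof. by apply: subspace_continuous_measurable_fun => //; exact: (ds_continuous dsP). Qed.

Lemma ds_f_path_bounded w : exists K : R, forall t, 0 <= t <= S -> `|f (y t w)| <= K.
Proof.
have [c _ hc] := EVT_max (ltW S0) (ds_continuous dsP (w := w)).
exists (- f (y c w)) => t tS.
rewrite ler0_norm; last by apply: (generator_le0 gf); exact: (ds_ge0 dsP).
by rewrite lerN2; apply: (generator_mono gf); apply: hc; rewrite in_itv.
Qed.

Lemma ds_drift_measurable w : measurable_fun `[0, S] (fun v => drift f a lam y v w).
Proof.
apply: measurable_funD; last exact: (ds_mlam dsP).
apply: measurable_funM; first exact: (ds_ma dsP).
apply: (measurableT_comp (measurable_generator gf)); exact: ds_path_measurable.
Qed.

Lemma ds_path_integrable (s t : R) (g : R -> R) : 0 <= s -> t <= S ->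
  measurable_fun `[0, S] g -> (exists K : R, forall v, 0 <= v <= S -> `|g v| <= K) ->
  mu.-integrable `[s, t] (EFin \o g).
Proof.
move=> s0 tS mg [K gK]; apply: (@itv_integrable _ _ _ K).
  apply: measurable_funS mg => // v /=; rewrite !in_itv/= => /andP[sv vt].
  by rewrite (le_trans s0 sv) (le_trans vt tS).
move=> v /=; rewrite in_itv/= => /andP[sv vt]; apply: gK.
by rewrite (le_trans s0 sv) (le_trans vt tS).
Qed.

Lemma ds_drift_path_integrable s t w : 0 <= s -> t <= S ->
  mu.-integrable `[s, t] (EFin \o (fun v => drift f a lam y v w)).
Proof.
move=> s0 tS; apply: ds_path_integrable => //; first exact: ds_drift_measurable.
have [K hK] := ds_f_path_bounded w.
exists (a_hi * K + lam_hi) => v vS.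
have /andP[a1 a2] := ds_a dsP w vS; have /andP[l1 l2] := ds_lam dsP w vS.
apply: le_trans (ler_normD _ _) _; rewrite [`|lam v w|]ger0_norm// lerD// normrM.
rewrite ler_pM// ?hK// ger0_norm//; exact: le_trans (ltW a_lo0) a1.
Qed.

Lemma ds_right_continuous w t : 0 <= t < S -> y u w @[u --> t^'+] --> y t w.
Proof.
move=> /andP[t0 tS].
have [cin c0 _] := (continuous_within_itvP _ S0).1 (ds_continuous dsP (w := w)).
move: t0; rewrite le_eqVlt => /predU1P[<-//|t0].
by apply: cvg_at_right_filter; apply: cin; rewrite in_itv/= t0.
Qed.

(** Carries a bound on means at fixed times over to the weighted time integral. The integrand is set
    to 0 outside [0, S[, which makes it bounded and jointly measurable on the whole product space;
    hence the strict t < S. *)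
Lemma ds_mean_path_le (q : R -> R) (zeta : Omega -> R) (s t B c : R) :
  measurable_fun setT q ->
  (forall v w, 0 <= v <= S -> `|q (y v w)| <= B) ->
  measurable_fun setT zeta -> (exists K : R, forall w, `|zeta w| <= K) ->
  0 <= s -> s <= t -> t < S ->
  (forall v, s <= v < t -> mean (fun w => zeta w * q (y v w)) <= c) ->
  rintegrable (fun w => zeta w * \int[mu]_(v in `[s, t]) q (y v w)) /\
  mean (fun w => zeta w * \int[mu]_(v in `[s, t]) q (y v w)) <= c * (t - s).
Proof.
move=> mq qB mz [K zK] s0 st tS hc.
pose G (z : measurableTypeR R * Omega) : R :=
  \1_(`[0, S[%classic : set R) z.1 *
  (zeta z.2 * q (if 0 <= z.1 < S then y z.1 z.2 else 0)).
have mG : measurable_fun setT G.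
  apply: measurable_funM.
    have mi : measurable_fun setT (\1_(`[0, S[%classic) : measurableTypeR R -> R).
      exact: measurable_indic.
    exact: (measurableT_comp mi measurable_fst).
  apply: measurable_funM; first exact: (measurableT_comp mz measurable_snd).
  apply: (measurableT_comp mq); apply: jointly_measurable => //.
    exact: ds_measurable.
  by move=> w u uS; exact: ds_right_continuous.
have GE v w : 0 <= v < S -> G (v, w) = zeta w * q (y v w).
  by move=> vS; rewrite /G/= vS indicE mem_set ?mul1r// /= in_itv.
have K0 : 0 <= K by apply: le_trans (zK point).
have GC z : `|G z| <= K * B.
  case: z => v w; have [vS|vS] := boolP (0 <= v < S).
    rewrite GE// normrM ler_pM//; apply: qB.
    by case/andP: vS => -> /ltW.
  rewrite /G/= indicE memNset; last by rewrite /= in_itv/=; exact/negP.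
  rewrite mul0r normr0 mulr_ge0//; apply: le_trans (qB 0 point _) => //.
  by rewrite lexx ltW.
have Gc v : s <= v < t -> mean (fun w => G (v, w)) <= c.
  move=> svt; have /andP[sv vt] := svt.
  under [mean _]eq_Rintegral => w _.
    rewrite GE; last by rewrite (le_trans s0 sv) (lt_trans vt tS).
    over.
  exact: hc.
have [] := @fubini_mean_le _ _ _ P G s t _ c st mG GC Gc.
have -> : (fun w => \int[mu]_(v in `[s, t]) G (v, w)) =
    (fun w => zeta w * \int[mu]_(v in `[s, t]) q (y v w)).
  apply/funext => w; rewrite -RintegralZl//.
    apply: eq_Rintegral => v /set_mem /=; rewrite in_itv/= => /andP[sv vt].
    by rewrite GE// (le_trans s0 sv) (le_lt_trans vt tS).
  apply: (@ds_path_integrable s t (fun v => q (y v w))) => //; first exact: ltW.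
    exact: (measurableT_comp mq (ds_path_measurable _)).
  by exists B => v vS; exact: qB.
by [].
Qed.

(** Measures how far f(y) stays above f(c) on [s, t]: the integrand vanishes while y >= c. *)
Definition deficit (c s t : R) (w : Omega) : R :=
  \int[mu]_(v in `[s, t]) Num.max (f (y v w) - f c) 0.

Lemma deficit_bound c v w : 0 <= c -> 0 <= v <= S ->
  `|Num.max (f (y v w) - f c) 0| <= - f c.
Proof.
move=> c0 vS; rewrite ger0_norm; last by rewrite le_max lexx orbT.
rewrite ge_max oppr_ge0 (generator_le0 gf c0) andbT.
by have := generator_le0 gf (ds_ge0 dsP w vS); lra.
Qed.

Lemma measurable_deficit_fun c : measurable_fun setT (fun x => Num.max (f x - f c) 0).
Proof.
apply: measurable_maxr => //; apply: measurable_funB => //.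
exact: measurable_generator.
Qed.

Lemma deficit_ge0 c s t w : 0 <= deficit c s t w.
Proof. by apply: Rintegral_ge0 => v _; rewrite le_max lexx orbT. Qed.

Lemma deficit_le c s t w : 0 <= c -> 0 <= s -> s <= t -> t <= S ->
  deficit c s t w <= - f c * (t - s).
Proof.
move=> c0 s0 st tS; apply: le_trans (ler_norm _) _.
apply: Rintegral_itv_norm_le => //.
  apply: measurable_funS (measurableT_comp (measurable_deficit_fun c) (ds_path_measurable w)) => //.
  move=> v /=; rewrite !in_itv/= => /andP[sv vt].
  by rewrite (le_trans s0 sv) (le_trans vt tS).
move=> v /andP[sv vt]; apply: deficit_bound => //.
by rewrite (le_trans s0 sv) (le_trans vt tS).
Qed.

Lemma deficit_measurable c s t : 0 <= c -> 0 <= s -> s <= t -> t < S ->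
  measurable_fun setT (deficit c s t).
Proof.
move=> c0 s0 st tS.
have [] := @ds_mean_path_le (fun x => Num.max (f x - f c) 0) (fun=> 1) s t (- f c) (- f c)
  (measurable_deficit_fun c) (fun v w => @deficit_bound c v w c0) (measurable_cst _) _ s0 st tS.
- by exists 1 => w; rewrite normr1.
- move=> v /andP[sv vt]; have vS : 0 <= v <= S.
    by rewrite (le_trans s0 sv) (ltW (lt_trans vt tS)).
  rewrite -[leRHS](mean_cst P); apply: le_mean.
  + apply: (@rintegrable_bounded _ _ _ P _ (- f c)).
      apply: measurable_funM => //.
      exact: (measurableT_comp (measurable_deficit_fun c) (ds_measurable vS)).
    by move=> w; rewrite mul1r; exact: deficit_bound.
  + exact: rintegrable_cst.
  + by move=> w; rewrite mul1r; apply: le_trans (ler_norm _) _; exact: deficit_bound.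
move=> /rintegrable_measurable + _.
by under eq_fun do rewrite mul1r.
Qed.

(** Write a f(y) = a f(c) + a (f(y) - f(c)). The first term is at most a_lo f(c), whose margin over
    lam_hi is m; the second is at most a_hi times the integrand of [deficit]. *)
Lemma drift_integral_le c m s t w : 0 <= c -> m + lam_hi <= a_lo * - f c ->
  0 <= s -> s <= t -> t <= S ->
  \int[mu]_(v in `[s, t]) drift f a lam y v w <= a_hi * deficit c s t w - m * (t - s).
Proof.
move=> c0 mc s0 st tS.
have ig : mu.-integrable `[s, t] (EFin \o (fun v => Num.max (f (y v w) - f c) 0)).
  apply: (@ds_path_integrable s t (fun v => Num.max (f (y v w) - f c) 0)) => //.
    exact: (measurableT_comp (measurable_deficit_fun c) (ds_path_measurable w)).
  by exists (- f c) => v; exact: deficit_bound.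
have ia : mu.-integrable `[s, t]
    (EFin \o (fun v => a_hi * Num.max (f (y v w) - f c) 0)).
  exact: (@integrableZl _ _ _ _ _ _ a_hi _ ig).
have im : mu.-integrable `[s, t] (EFin \o (fun=> m : R)).
  by apply: (@itv_integrable _ _ _ `|m|).
rewrite /deficit -RintegralZl// -(Rintegral_itv_cst m st) -RintegralB//.
apply: le_Rintegral => //.
- exact: ds_drift_path_integrable.
- exact: (@integrableB _ _ _ _ _ _ _ _ ia im).
move=> v /=; rewrite in_itv/= => /andP[sv vt].
have vS : 0 <= v <= S by rewrite (le_trans s0 sv) (le_trans vt tS).
have /andP[a1 a2] := ds_a dsP w vS; have /andP[l1 l2] := ds_lam dsP w vS.
have fc := generator_le0 gf c0.
have h1 : a v w * (f (y v w) - f c) <= a_hi * Num.max (f (y v w) - f c) 0.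
  apply: (@le_trans _ _ (a v w * Num.max (f (y v w) - f c) 0)).
    rewrite ler_wpM2l ?le_max ?lexx// (le_trans (ltW a_lo0))//.
  by rewrite ler_wpM2r// le_max lexx orbT.
rewrite /drift; nra.
Qed.

(** Testing the dynamics with the indicator of {y_s > u} turns y_s - u into its positive part. Since
    c <= u, this event lies in {y_s > c}, where the deficit is counted, and the drift raises the
    level at time t by m (t - s). *)
Lemma comparison_step c u m s t : 0 <= c -> c <= u -> m + lam_hi <= a_lo * - f c ->
  0 <= s -> s <= t -> t < S ->
  mean (fun w => Num.max (y s w - u) 0) <=
  mean (fun w => Num.max (y t w - (u + m * (t - s))) 0) +
  a_hi * mean (fun w => \1_[set w' | c < y s w'] w * deficit c s t w).
Proof.
move=> c0 cu mc s0 st tS.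
have sS : 0 <= s <= S by rewrite s0 (le_trans st (ltW tS)).
have tS' : 0 <= t <= S by rewrite (le_trans s0 st) ltW.
have sFs := Fsub sS.
pose rho : Omega -> R := \1_[set w | u < y s w].
have brho : bounded_meas (F s) rho.
  apply: bounded_meas_indic; first by case: sFs.
  have := ds_adapted dsP sS (measurable_itv `]u, +oo[).
  rewrite (_ : _ @^-1` _ = [set w | u < y s w])//.
  by apply/seteqP; split => w /=; rewrite in_itv/= andbT.
have rE w : rho w * (y s w - u) = Num.max (y s w - u) 0.
  rewrite /rho indicE; have [us|us] := ltP u (y s w).
    by rewrite mem_set// mul1r max_l// subr_ge0 ltW.
  rewrite memNset ?mul0r ?max_r// ?subr_le0// /=.
  by apply/negP; rewrite -leNgt.
have iy r : 0 <= r <= S -> rintegrable (y r) by move=> rS; exact: (ds_integrable dsP).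
pose J w := \int[mu]_(v in `[s, t]) drift f a lam y v w.
have iJ : rintegrable J by apply: (ds_drift_integrable dsP) => //; exact: ltW.
have [_ dyn] := ds_dynamics dsP s0 st (ltW tS).
have iM (X : Omega -> R) k : rintegrable X -> rintegrable (fun w => Num.max (X w - k) 0).
  move=> iX; have iXk : rintegrable (fun w => X w - k).
    by apply: rintegrableB => //; exact: rintegrable_cst.
  apply: (rintegrable_le _ _ iXk).
    by apply: measurable_maxr => //; exact: (rintegrable_measurable iXk).
  by move=> w; rewrite maxEle; case: ifP => // _; rewrite normr0.
have mI : measurable [set w | c < y s w].
  have := ds_measurable sS measurableT (measurable_itv `]c, +oo[).
  rewrite setTI (_ : _ @^-1` _ = [set w | c < y s w])//.
  by apply/seteqP; split => w /=; rewrite in_itv/= andbT.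
have iD : rintegrable (fun w => \1_[set w' | c < y s w'] w * deficit c s t w).
  apply: (@rintegrable_bounded _ _ _ P _ (- f c * (t - s))).
    apply: measurable_funM; first exact: measurable_indic.
    exact: deficit_measurable.
  move=> w; rewrite normrM; apply: (@le_trans _ _ (1 * `|deficit c s t w|)).
    by rewrite ler_wpM2r// indicE ger0_norm// lern1 leq_b1.
  rewrite mul1r ger0_norm ?deficit_ge0//; apply: deficit_le => //; exact: ltW.
have step w : rho w * (y t w + J w - u) <= Num.max (y t w - (u + m * (t - s))) 0 +
    a_hi * (\1_[set w' | c < y s w'] w * deficit c s t w).
  have J_le := drift_integral_le w c0 mc s0 st (ltW tS); rewrite -/(J w) in J_le.
  have ahi0 : 0 <= a_hi.
    by have /andP[h1 h2] := ds_a dsP w sS; exact: le_trans (ltW a_lo0) (le_trans h1 h2).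
  have D0 := deficit_ge0 c s t w.
  have h1 : 0 <= a_hi * deficit c s t w by rewrite mulr_ge0.
  rewrite /rho !indicE; have [us|us] := ltP u (y s w).
    rewrite mem_set// mem_set /=; last exact: le_lt_trans us.
    rewrite !mul1r.
    have : y t w - (u + m * (t - s)) <= Num.max (y t w - (u + m * (t - s))) 0.
      by rewrite le_max lexx.
    lra.
  rewrite memNset; last by apply/negP; rewrite -leNgt.
  rewrite mul0r addr_ge0// ?le_max ?lexx ?orbT//.
  by case: (_ \in _); rewrite ?mul0r ?mulr0// mul1r.
have irJ : rintegrable (fun w => rho w * (y t w + J w - u)).
  apply: rintegrable_bM sFs brho _; apply: rintegrableB; last exact: rintegrable_cst.
  by apply: rintegrableD => //; exact: iy.
have -> : mean (fun w => Num.max (y s w - u) 0) = mean (fun w => rho w * (y t w + J w - u)).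
  rewrite -[RHS]add0r -[X in _ = X + _](dyn rho brho) -meanD//.
    by apply: eq_Rintegral => w _; rewrite -rE /J; ring.
  apply: rintegrable_bM sFs brho _; apply: rintegrableB => //.
  by apply: rintegrableB; exact: iy.
rewrite -meanZ// -meanD.
- apply: le_mean => //; apply: rintegrableD; last exact: rintegrableZ.
  by apply: iM; exact: iy.
- by apply: iM; exact: iy.
- exact: rintegrableZ.
Qed.

(** If y starts a step above c, then f(y) - f(c) is at most the oscillation of f(y) over that step,
    which is uniformly small on each path. The sum is bounded by - f(c) (r - s), so dominated
    convergence applies. *)
Lemma deficit_sum_small c s r e : 0 <= c -> 0 <= s -> s <= r -> r < S -> 0 < e ->
  exists n, (0 < n)%N /\
    \sum_(j < n) mean (fun w =>
      \1_[set w' | c < y (s + j%:R * ((r - s) / n%:R)) w'] w *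
      deficit c (s + j%:R * ((r - s) / n%:R)) (s + j.+1%:R * ((r - s) / n%:R)) w) < e.
Proof.
move=> c0 s0 sr rS e0.
pose g n j := s + j%:R * ((r - s) / n.+1%:R).
have gS n j : g n j <= g n j.+1.
  by rewrite /g lerD2l ler_wpM2r ?ler_nat// divr_ge0// subr_ge0.
have g0 n : g n 0%N = s by rewrite /g mul0r addr0.
have gr n : g n n.+1 = r by rewrite /g; field.
have sg n j : s <= g n j.
  by rewrite /g lerDl mulr_ge0// divr_ge0// subr_ge0.
have gle n j : (j <= n.+1)%N -> g n j <= r.
  by move=> jn; rewrite -(gr n) /g lerD2l ler_wpM2r ?ler_nat// divr_ge0// subr_ge0.
have gB n j : (j <= n.+1)%N -> 0 <= g n j <= S.
  by move=> jn; rewrite (le_trans s0 (sg _ _)) (le_trans (gle _ _ jn) (ltW rS)).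
have gd n j : g n j.+1 - g n j = (r - s) / n.+1%:R by rewrite /g -[j.+1%:R]natr1; ring.
pose X n j w := \1_[set w' | c < y (g n j) w'] w * deficit c (g n j) (g n j.+1) w.
have X0 n j w : 0 <= X n j w by rewrite mulr_ge0// ?deficit_ge0// indicE.
have XE n j w : 0 <= c -> X n j w = if c < y (g n j) w then deficit c (g n j) (g n j.+1) w else 0.
  move=> _; rewrite /X indicE; case: ifPn => h; first by rewrite mem_set// mul1r.
  by rewrite memNset ?mul0r//; exact/negP.
have Xle n (j : 'I_n.+1) w : X n j w <= - f c * ((r - s) / n.+1%:R).
  have fc := generator_le0 gf c0.
  rewrite XE//; case: ifP => _; last by rewrite mulr_ge0 ?oppr_ge0// divr_ge0// subr_ge0.
  apply: le_trans (deficit_le _ _ _ _ _) _ => //.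
  - exact: le_trans s0 (sg _ _).
  - by case/andP: (gB n _ (ltn_ord j)).
  - by rewrite gd.
have iX n (j : 'I_n.+1) : rintegrable (X n j).
  apply: (@rintegrable_bounded _ _ _ P _ (- f c * ((r - s) / n.+1%:R))); last first.
    by move=> w; rewrite ger0_norm.
  apply: measurable_funM.
    apply: measurable_indic.
    have := ds_measurable (gB n j (ltnW (ltn_ord j))) measurableT (measurable_itv `]c, +oo[).
    rewrite setTI (_ : _ @^-1` _ = [set w | c < y (g n j) w])//.
    by apply/seteqP; split => w /=; rewrite in_itv/= andbT.
  apply: deficit_measurable => //; first exact: le_trans s0 (sg _ _).
  exact: le_lt_trans (gle n _ (ltn_ord j)) rS.
pose Z n w := \sum_(j < n.+1) X n j w.
have iZ n : rintegrable (Z n) by exact: rintegrable_sum.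
have Z0 n w : 0 <= Z n w by apply: sumr_ge0.
have Zle n w : Z n w <= - f c * (r - s).
  apply: (@le_trans _ _ (\sum_(j < n.+1) - f c * ((r - s) / n.+1%:R))).
    exact: ler_sum.
  by rewrite sumr_const card_ord -mulrnAr -[_ *+ n.+1]mulr_natr divfK.
have Zcvg w : Z ^~ w @ \oo --> 0.
  apply/cvgrPdist_lt => d d0.
  have cfy : {within `[0, S], continuous (fun v => f (y v w))}.
    move=> v; apply: continuous_comp; first exact: (ds_continuous dsP).
    exact: (generator_continuous gf).
  (* Adding 1 keeps the divisor positive when r = s and makes the total d' (r - s) strictly smaller
     than d. *)
  pose d' := d / (r - s + 1).
  have rs1 : 0 < r - s + 1 by lra.
  have d'0 : 0 < d' by rewrite divr_gt0.
  have [k k0 hk] := itv_unif_continuous cfy d'0.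
  near=> n.
  have nk : (r - s) / n.+1%:R < k.
    rewrite ltr_pdivrMr// mulrC -ltr_pdivrMr//; near: n.
    exists (Num.truncn ((r - s) / k)) => // n /= hn.
    by apply: lt_le_trans (truncnS_gt _) _; rewrite ler_nat.
  rewrite sub0r normrN ger0_norm//.
  apply: (@le_lt_trans _ _ (\sum_(j < n.+1) d' * ((r - s) / n.+1%:R))); last first.
    rewrite sumr_const card_ord -mulrnAr -[_ *+ n.+1]mulr_natr divfK//.
    by rewrite /d' -mulrA mulrC -ltr_pdivlMr// divff ?gt_eqF// mulrC ltr_pdivrMr// mul1r ltrDl.
  apply: ler_sum => j _; rewrite XE//; case: ifPn => cy; last first.
    by rewrite mulr_ge0 ?(ltW d'0)// divr_ge0// subr_ge0.
  have := gB n j (ltnW (ltn_ord j)) => gj; have gj1 := gB n _ (ltn_ord j).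
  rewrite -(gd n j).
  apply: le_trans (ler_norm _) _; apply: Rintegral_itv_norm_le => //.
    apply: measurable_funS (measurableT_comp (measurable_deficit_fun c) (ds_path_measurable w)) => //.
    move=> v /=; rewrite !in_itv/= => /andP[sv vt].
    by case/andP: gj => h1 _; case/andP: gj1 => _ h2; rewrite (le_trans h1 sv) (le_trans vt h2).
  move=> v /andP[sv vt].
  have vS : 0 <= v <= S.
    by case/andP: gj => h1 _; case/andP: gj1 => _ h2; rewrite (le_trans h1 sv) (le_trans vt h2).
  rewrite ger0_norm ?le_max ?lexx ?orbT// ge_max (ltW d'0) andbT.
  have := hk v (g n j) vS gj; rewrite ger0_norm ?subr_ge0// => /(_ _).
  have -> : v - g n j < k.
    by apply: le_lt_trans nk; rewrite -(gd n j) lerD2r.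
  move=> /(_ isT) h; have := generator_mono gf (ltW cy).
  by have := ler_norm (f (y v w) - f (y (g n j) w)); lra.
have mZ n : measurable_fun setT (fun w => (Z n w)%:E).
  by apply/measurable_EFinP; exact: rintegrable_measurable (iZ n).
have cZ : \forall w \ae P, setT w -> (Z n w)%:E @[n --> \oo] --> cst 0%E w.
  by apply: aeW => w _; apply: cvg_EFin; [exact: nearW|exact: Zcvg].
have bZ : \forall w \ae P, forall n, setT w ->
    (`|(Z n w)%:E| <= (EFin \o (fun=> (- f c * (r - s))%R)) w)%E.
  by apply: aeW => w n _; rewrite /= lee_fin ger0_norm.
have [_ _] := dominated_convergence measurableT mZ (measurable_cst 0%E) cZ
  (rintegrable_cst P (- f c * (r - s))) bZ.
rewrite integral_cst// mul0e => /(_ [set x | (x < e%:E)%E]) cvgZ.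
have /filter_ex[n] : \forall n \near \oo, (\int[P]_w (Z n w)%:E < e%:E)%E.
  apply: cvgZ; apply: open_nbhs_nbhs; split; first exact: open_ereal_lt_ereal.
  by rewrite /= lte_fin.
rewrite -mean_EFin// lte_fin => hn; exists n.+1; split => //.
by rewrite -mean_sum// => j; exact: iX.
Unshelve. all: by end_near. Qed.

(* On {y > c} the drift is at most - m, so t |-> max (y_t - (c + m (t - s)), 0) is a
   submartingale up to the deficits of the time steps which start above c; the sum of these
   over a fine grid is small, by continuity of the paths. *)
Lemma comparison c m s r : 0 <= c -> 0 <= m -> m + lam_hi <= a_lo * - f c ->
  0 <= s -> s <= r -> r < S ->
  mean (fun w => Num.max (y s w - c) 0) <=
  mean (fun w => Num.max (y r w - (c + m * (r - s))) 0).
Proof.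
move=> c0 m0 mc s0 sr rS.
apply/ler_addgt0Pr => e e0.
have sS : 0 <= s <= S by rewrite s0 (le_trans sr (ltW rS)).
have ahi0 : 0 < a_hi.
  by have /andP[h1 h2] := ds_a dsP point sS; exact: lt_le_trans a_lo0 (le_trans h1 h2).
have [n [n0]] := deficit_sum_small c0 s0 sr rS (divr_gt0 e0 ahi0).
have nR : (0 : R) < n%:R by rewrite ltr0n.
pose k := (r - s) / n%:R.
have k0 : 0 <= k by rewrite divr_ge0 ?subr_ge0// ltW.
have nk : n%:R * k = r - s by rewrite /k mulrC divfK// gt_eqF.
rewrite -/k => small.
suff ind i : (i <= n)%N -> mean (fun w => Num.max (y s w - c) 0) <=
    mean (fun w => Num.max (y (s + i%:R * k) w - (c + m * (i%:R * k))) 0) +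
    a_hi * \sum_(j < i) mean (fun w => \1_[set w' | c < y (s + j%:R * k) w'] w *
      deficit c (s + j%:R * k) (s + j.+1%:R * k) w).
  have := ind n (leqnn _); rewrite nk subrKC => h; apply: le_trans h _.
  by rewrite lerD2l mulrC -ler_pdivlMr// ltW.
elim: i => [_|i IH ni].
  by rewrite big_ord0 !mul0r !mulr0 !addr0.
apply: le_trans (IH (ltnW ni)) _.
rewrite big_ord_recr/= mulrDr addrA [leRHS]addrAC lerD2r.
have ik : i.+1%:R * k - i%:R * k = k by rewrite -natr1; ring.
have ile : s + i.+1%:R * k <= r.
  by rewrite -lerBrDl -nk ler_wpM2r// ler_nat.
have := @comparison_step c (c + m * (i%:R * k)) m (s + i%:R * k) (s + i.+1%:R * k) c0 _ mc.
have -> : c + m * (i%:R * k) + m * (s + i.+1%:R * k - (s + i%:R * k)) = c + m * (i.+1%:R * k).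
  by rewrite -[i.+1%:R]natr1; ring.
apply.
- by rewrite lerDl mulr_ge0// mulr_ge0.
- by rewrite addr_ge0// mulr_ge0.
- by rewrite lerD2l ler_wpM2r// ler_nat.
- exact: le_lt_trans ile rS.
Qed.

(** Iterates [comparison] with the rate a_lo (- f (level k)) / 2, the other half of the drift bound
    absorbing lam_hi. The duration [level k] divided by this rate is exactly what raises [level k]
    to [level k.+1]. *)
Lemma level_chain j n r : (j <= n)%N ->
  (forall k, (j <= k < n)%N -> lam_hi <= a_lo * - f (level k) / 2) ->
  r < S ->
  0 <= r - \sum_(j <= k < n) level k / (a_lo * - f (level k) / 2) ->
  mean (fun w => Num.max
    (y (r - \sum_(j <= k < n) level k / (a_lo * - f (level k) / 2)) w - level j) 0) <=
  mean (fun w => Num.max (y r w - level n) 0).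
Proof.
have mk0 k : 0 < a_lo * - f (level k) / 2.
  by rewrite divr_gt0// mulr_gt0// oppr_gt0 (generator_lt0 gf)// level_gt0.
elim: n r => [|n IH] r.
  by rewrite leqn0 => /eqP ->; rewrite big_geq// subr0.
rewrite leq_eqVlt => /predU1P[->|]; first by rewrite big_geq// subr0.
rewrite ltnS => jn hl rS.
rewrite big_nat_recr//= [X in r - X]addrC opprD addrA => r0.
set d := level n / (a_lo * - f (level n) / 2) in r0 *.
have d0 : 0 <= d by rewrite divr_ge0 ?(ltW (mk0 _))// ltW// level_gt0.
have rd : r - d <= r by rewrite lerBlDr lerDl.
have rd0 : 0 <= r - d.
  apply: le_trans r0 _; rewrite lerBlDr lerDl sumr_ge0// => k _.
  by rewrite divr_ge0 ?(ltW (mk0 _))// ltW// level_gt0.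
apply: le_trans (IH _ jn _ (le_lt_trans rd rS) r0) _.
  by move=> k /andP[jk kn]; apply: hl; rewrite jk ltnS ltnW.
have := @comparison (level n) (a_lo * - f (level n) / 2) (r - d) r.
have -> : level n + a_lo * - f (level n) / 2 * (r - (r - d)) = level n.+1.
  rewrite levelS; congr (_ + _); rewrite subKr /d mulrC divfK// gt_eqF//.
apply => //.
- by rewrite ltW// level_gt0.
- exact: ltW.
- by have := hl n; rewrite jn ltnSn => /(_ isT); lra.
Qed.

(** Dominated by X, and zero for each w as soon as n exceeds X w, because 2^n >= n. *)
Lemma mean_excess_cvg (X : Omega -> R) : rintegrable X -> (forall w, 0 <= X w) ->
  mean (fun w => Num.max (X w - (level n : R)) 0) @[n --> \oo] --> 0.
Proof.
move=> iX X0.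
have mX := rintegrable_measurable iX.
have mZr n : measurable_fun setT (fun w => Num.max (X w - level n) 0).
  by apply: measurable_maxr => //; exact: measurable_funB.
have mZ n : measurable_fun setT (fun w => (Num.max (X w - level n) 0)%:E).
  by apply/measurable_EFinP; exact: mZr.
have Zle n w : `|Num.max (X w - level n) 0| <= X w.
  rewrite ger0_norm ?le_max ?lexx ?orbT// ge_max X0 andbT lerBlDr lerDl.
  by rewrite ltW// level_gt0.
have iZ n : rintegrable (fun w => Num.max (X w - level n) 0).
  apply: (rintegrable_le _ _ iX); first exact: mZr.
  by move=> w; rewrite (ger0_norm (X0 w)).
have cZ : \forall w \ae P, setT w ->
    (Num.max (X w - level n) 0)%:E @[n --> \oo] --> cst 0%E w.
  apply: aeW => w _; apply: cvg_near_cst.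
  exists (Num.truncn (X w)).+1 => // n /= hn; rewrite max_r// subr_le0.
  apply: le_trans (ltW (truncnS_gt _)) _.
  apply: (@le_trans _ _ n%:R); first by rewrite ler_nat.
  by rewrite /level -natrX ler_nat ltnW// ltn_expl.
have bZ : \forall w \ae P, forall n, setT w ->
    (`|(Num.max (X w - level n) 0)%:E| <= (EFin \o X) w)%E.
  by apply: aeW => w n _; rewrite /= lee_fin.
have [_ _] := dominated_convergence measurableT mZ (measurable_cst 0%E) cZ iX bZ.
rewrite integral_cst// mul0e => h.
have : (mean (fun w => Num.max (X w - level n) 0))%:E @[n --> \oo] --> 0%E.
  by under eq_fun do rewrite mean_EFin//.
by move/fine_cvgP => [].
Qed.

(** The chain is started at t + e from an arbitrarily high [level n]; its total duration is at most
    e, and the mean excess at its start tends to 0. The time left between t and the end of the chain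
    is bridged by [comparison] with rate 0. *)
Lemma apriori_bound j e t :
  (forall k, (j <= k)%N -> lam_hi <= a_lo * - f (level k) / 2) ->
  (forall n, \sum_(j <= k < n) level k / (a_lo * - f (level k) / 2) <= e) ->
  0 <= t -> 0 <= e -> t + e < S -> {ae P, forall w, y t w <= level j}.
Proof.
move=> hl he t0 e0 teS.
have tS : 0 <= t <= S by rewrite t0/= (le_trans _ (ltW teS))// lerDl.
have lj0 : 0 < (level j : R) := level_gt0 j.
have iM : rintegrable (fun w => Num.max (y t w - level j) 0).
  apply: (rintegrable_le _ _ (ds_integrable dsP tS)).
    apply: measurable_maxr => //; apply: measurable_funB => //; exact: ds_measurable.
  move=> w; rewrite [leRHS]ger0_norm; last exact: (ds_ge0 dsP).
  rewrite ger0_norm ?le_max ?lexx ?orbT// ge_max (ds_ge0 dsP)// andbT lerBlDr lerDl ltW//.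
have M0 w : 0 <= Num.max (y t w - level j) 0 by rewrite le_max lexx orbT.
suff : mean (fun w => Num.max (y t w - level j) 0) <= 0.
  move=> /(mean_le0_ae iM M0); apply: filterS => w h.
  by rewrite -subr_le0 -h le_max lexx.
have teS' : 0 <= t + e <= S by rewrite addr_ge0// ltW.
have cv := mean_excess_cvg (ds_integrable dsP teS') (fun w => ds_ge0 dsP w teS').
rewrite -[leRHS](cvg_lim _ cv)//; apply: limr_ge; first by apply/cvg_ex; exists 0.
near=> n.
have jn : (j <= n)%N by near: n; exists j.
pose D := \sum_(j <= k < n) level k / (a_lo * - f (level k) / 2).
have tD : t <= t + e - D by have := he n; rewrite -/D; lra.
have D0 : 0 <= D.
  apply: sumr_ge0 => k _; rewrite divr_ge0 ?(ltW (level_gt0 _))//.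
  by rewrite divr_ge0// mulr_ge0 ?ltW// oppr_gt0 (generator_lt0 gf)// level_gt0.
apply: (@le_trans _ _ (mean (fun w => Num.max (y (t + e - D) w - level j) 0))).
  have h1 : 0 + lam_hi <= a_lo * - f (level j).
    have := hl j (leqnn _); have : 0 < a_lo * - f (level j).
      by rewrite mulr_gt0// oppr_gt0 (generator_lt0 gf)// level_gt0.
    lra.
  have h2 : t + e - D < S by apply: le_lt_trans teS; rewrite lerBlDr lerDl.
  have := comparison (ltW lj0) (lexx 0) h1 t0 tD h2.
  by rewrite mul0r addr0.
apply: level_chain => //.
- by move=> k /andP[jk _]; exact: hl.
- exact: le_trans t0 tD.
Unshelve. all: by end_near. Qed.

End drift_solution.

(** * Discretization error *)

Section euler_error.
Context {R : realType} {disp : measure_display} {Omega : measurableType disp}.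
Variable P : probability Omega R.
Local Notation mu := (@lebesgue_measure R).
Local Notation rintegrable := (rintegrable P).
Local Notation mean := (mean P).
Local Notation cond_mean_zero := (cond_mean_zero P).

Variables (F : R -> set (set Omega)) (S a_lo a_hi lam_hi : R) (f : R -> R).
Variables (a lam y : R -> Omega -> R).
Hypothesis gf : singular_generator f.
Hypothesis S0 : 0 < S.
Hypothesis a_lo0 : 0 < a_lo.
Hypothesis lam_hi0 : 0 <= lam_hi.
Hypothesis Fsub : forall t : R, 0 <= t <= S -> sub_sigma (F t).
Hypothesis Fmono : forall s t : R, 0 <= s -> s <= t -> t <= S -> F s `<=` F t.
Hypothesis dsP : drift_solution P F S a_lo a_hi lam_hi f a lam y.
Variables (U K L : R) (f1 : R -> R).
Hypothesis U0 : 0 <= U.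
Hypothesis yU : forall t w, 0 <= t <= S -> y t w <= U.
Hypothesis K0 : 0 <= K.
Hypothesis L0 : 0 <= L.
Hypothesis f1_cont : continuous (fun x : R => f1 (Num.max x 0)).
Hypothesis f1K : forall x : R, 0 <= x <= U -> `|f1 x| <= K.
Hypothesis f1L : forall x y : R, 0 <= x <= U -> 0 <= y <= U ->
  `|f y - f x - f1 x * (y - x)| <= L * (y - x) ^+ 2.

(** Bounds |a f(y) + lam| while y stays in [0, U]. *)
Let c := a_hi * - f U + lam_hi.

Let a_hi0 : 0 <= a_hi.
Proof.
have /andP[h1 h2] : a_lo <= a 0 point <= a_hi by apply: (ds_a dsP); rewrite lexx ltW.
exact: le_trans (ltW a_lo0) (le_trans h1 h2).
Qed.

Let c0 : 0 <= c.
Proof. by rewrite addr_ge0// mulr_ge0// oppr_ge0 (generator_le0 gf). Qed.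

Let yb t w : 0 <= t <= S -> 0 <= y t w <= U.
Proof. by move=> tS; rewrite (ds_ge0 dsP)//= yU. Qed.

Let fb x : 0 <= x <= U -> `|f x| <= - f U.
Proof.
move=> /andP[x0 xU]; rewrite ler0_norm ?(generator_le0 gf)// lerN2.
exact: (generator_mono gf).
Qed.

Lemma solution_bounded_meas t : 0 <= t <= S -> bounded_meas (F t) (y t).
Proof.
move=> tS; split; first exact: (ds_adapted dsP).
by exists U => w; have /andP[h1 h2] := yb w tS; rewrite ger0_norm.
Qed.

Lemma drift_integral_norm_le s t w : 0 <= s -> s <= t -> t <= S ->
  `|\int[mu]_(v in `[s, t]) drift f a lam y v w| <= c * (t - s).
Proof.
move=> s0 st tS; apply: Rintegral_itv_norm_le => //.
  apply: measurable_funS (ds_drift_measurable gf dsP w) => // v /=.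
  by rewrite !in_itv/= => /andP[sv vt]; rewrite (le_trans s0 sv) (le_trans vt tS).
move=> v /andP[sv vt].
have vS : 0 <= v <= S by rewrite (le_trans s0 sv) (le_trans vt tS).
have /andP[a1 a2] := ds_a dsP w vS; have /andP[l1 l2] := ds_lam dsP w vS.
apply: le_trans (ler_normD _ _) _; rewrite [`|lam v w|]ger0_norm// lerD// normrM.
by rewrite ler_pM// ?fb ?yb// ger0_norm//; exact: le_trans (ltW a_lo0) a1.
Qed.

(** The weight removes the martingale part, so that only the drift integral, of order t - s,
    remains. *)
Lemma weighted_increment_le zeta s t : bounded_meas (F s) zeta ->
  0 <= s -> s <= t -> t <= S ->
  `|mean (fun w => zeta w * (y t w - y s w))| <= c * (t - s) * mean (fun w => `|zeta w|).
Proof.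
move=> bz s0 st tS.
have sS : 0 <= s <= S by rewrite s0 (le_trans st).
have tS' : 0 <= t <= S by rewrite (le_trans s0 st).
have [iD dyn] := ds_dynamics dsP s0 st tS.
have iJ := ds_drift_integrable dsP s0 st tS.
have iz := bounded_meas_rintegrable P (Fsub sS) bz.
have bI X : rintegrable X -> rintegrable (fun w => zeta w * X w).
  exact: rintegrable_bM (Fsub sS) bz.
have iy : rintegrable (fun w => y t w - y s w).
  by apply: rintegrableB; exact: (ds_integrable dsP).
have -> : mean (fun w => zeta w * (y t w - y s w)) =
    - mean (fun w => zeta w * \int[mu]_(v in `[s, t]) drift f a lam y v w).
  apply/eqP; rewrite -addr_eq0 -meanD; [|exact: bI|exact: bI].
  rewrite -oppr_eq0 -meanN; last by apply: rintegrableD; exact: bI.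
  rewrite -[X in _ == X](dyn zeta bz); apply/eqP.
  by apply: eq_Rintegral => w _; ring.
rewrite normrN; apply: le_trans (norm_mean_le (bI _ iJ)) _.
rewrite -meanZ; last exact: rintegrable_norm.
apply: le_mean.
- by apply: rintegrable_norm; exact: bI.
- by apply: rintegrableZ; exact: rintegrable_norm.
- move=> w; rewrite normrM mulrC ler_wpM2r//; exact: drift_integral_norm_le.
Qed.

(* (y_v - y_s)^2 = y_v^2 - y_s^2 - 2 y_s (y_v - y_s) replaces the bracket of y by increments of
   E y^2, which telescope along the grid. *)
Lemma weighted_square_increment_le zeta s v t : bounded_meas (F s) zeta ->
  (forall w, 0 <= zeta w) -> 0 <= s -> s <= v -> v <= t -> t <= S ->
  mean (fun w => zeta w * (y v w - y s w) ^+ 2) <=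
  mean (fun w => zeta w * (y t w ^+ 2 - y s w ^+ 2)) + 4 * U * c * (t - s) * mean zeta.
Proof.
move=> bz z0 s0 sv vt tS.
have st := le_trans sv vt; have vS := le_trans vt tS; have v0 := le_trans s0 sv.
have sS : 0 <= s <= S by rewrite s0 (le_trans st).
have vS' : 0 <= v <= S by rewrite v0.
have tS' : 0 <= t <= S by rewrite (le_trans s0 st).
have sFs := Fsub sS; have sFv := Fsub vS'; have sFt := Fsub tS'.
have iz := bounded_meas_rintegrable P sFs bz.
have bI X : rintegrable X -> rintegrable (fun w => zeta w * X w).
  exact: rintegrable_bM sFs bz.
have mz0 : 0 <= mean zeta by exact: mean_ge0.
have by_ r : 0 <= r <= S -> bounded_meas (F r) (y r) by exact: solution_bounded_meas.
have iyy r r' : 0 <= r <= S -> 0 <= r' <= S -> rintegrable (fun w => y r w * y r' w).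
  move=> rS r'S; apply: rintegrable_bM (Fsub rS) (by_ r rS) _.
  exact: (ds_integrable dsP).
have bzv : bounded_meas (F v) zeta.
  by case: bz => mz bz; split => //; apply: meas_wrtS mz; exact: Fmono.
have main r r' : 0 <= r -> r <= r' -> r' <= S -> bounded_meas (F r) zeta ->
    `|mean (fun w => zeta w * (y r w * (y r' w - y r w)))| <= U * c * (r' - r) * mean zeta.
  move=> r0 rr' r'S bzr; have rS : 0 <= r <= S by rewrite r0 (le_trans rr').
  have bzy : bounded_meas (F r) (fun w => zeta w * y r w).
    by apply: bounded_measM => //; [case: (Fsub rS)|exact: by_].
  have := weighted_increment_le bzy r0 rr' r'S.
  rewrite (_ : (fun w => zeta w * y r w * _) = (fun w => zeta w * (y r w * (y r' w - y r w)))); last first.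
    by apply/funext => w; rewrite mulrA.
  move=> h; apply: le_trans h _.
  rewrite -[U * c]mulrC -!mulrA; rewrite ler_wpM2l// mulrCA ler_wpM2l ?subr_ge0//.
  rewrite -meanZ//; apply: le_mean.
  - apply: rintegrable_norm; apply: bI; exact: (ds_integrable dsP).
  - exact: rintegrableZ.
  - move=> w; have /andP[y1 y2] := yb w rS.
    by rewrite normrM !ger0_norm// mulrC ler_wpM2r.
have h1 := main _ _ s0 sv vS bz; have h2 := main _ _ v0 vt tS bzv.
have i1 : rintegrable (fun w => zeta w * (y s w * (y v w - y s w))).
  by apply: bI; under eq_fun do rewrite mulrBr; apply: rintegrableB; exact: iyy.
have i2 : rintegrable (fun w => zeta w * (y v w * (y t w - y v w))).
  by apply: bI; under eq_fun do rewrite mulrBr; apply: rintegrableB; exact: iyy.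
have i3 : rintegrable (fun w => zeta w * (y t w ^+ 2 - y s w ^+ 2)).
  by apply: bI; apply: rintegrableB; exact: iyy.
have i0 : rintegrable (fun w => zeta w * (y v w - y s w) ^+ 2).
  apply: bI; rewrite (_ : (fun w => _) = fun w => y v w * y v w - y v w * y s w
      - (y s w * y v w - y s w * y s w)); last by apply/funext => w; ring.
  by apply: rintegrableB; apply: rintegrableB; exact: iyy.
(* The right side exceeds the left by zeta (y_t - y_v)^2, which is dropped to get a bound uniform in
   v. Each mixed term costs 2 U c (t - s), whence the constant 4. *)
apply: (@le_trans _ _ (mean (fun w => zeta w * (y t w ^+ 2 - y s w ^+ 2) +
    (-2 * (zeta w * (y v w * (y t w - y v w))) +
     -2 * (zeta w * (y s w * (y v w - y s w))))))).
  apply: le_mean => //.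
    by apply: rintegrableD => //; apply: rintegrableD; exact: rintegrableZ.
  move=> w; have := z0 w; have := sqr_ge0 (y t w - y v w); set z := zeta w => q0 zw0.
  have -> : z * (y t w ^+ 2 - y s w ^+ 2) + (-2 * (z * (y v w * (y t w - y v w))) +
     -2 * (z * (y s w * (y v w - y s w)))) =
     z * (y v w - y s w) ^+ 2 + z * (y t w - y v w) ^+ 2 by ring.
  by rewrite lerDl mulr_ge0.
rewrite meanD//; last by apply: rintegrableD; exact: rintegrableZ.
rewrite meanD; [|exact: rintegrableZ|exact: rintegrableZ].
rewrite !meanZ// lerD2l.
move: h1 h2; rewrite !ler_norml => /andP[h1 _] /andP[h2 _].
have UcE : 0 <= U * c * mean zeta by rewrite !mulr_ge0.
have : U * c * (v - s) * mean zeta <= U * c * (t - s) * mean zeta.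
  by rewrite ler_wpM2r// ler_wpM2l ?mulr_ge0// lerD2r.
have : U * c * (t - v) * mean zeta <= U * c * (t - s) * mean zeta.
  by rewrite ler_wpM2r// ler_wpM2l ?mulr_ge0// lerD2l lerN2.
nra.
Qed.

(** Expand f(y_v) at y_s. The factor f1(y_s) is known at time s and joins the weight, so the first
    order term contributes only order t - s; the remainder is handled by the square increments. In
    the application [eps] is the sign of the error times abar. *)
Lemma weighted_generator_oscillation_le zeta eps s t : bounded_meas (F s) zeta ->
  (forall w, 0 <= zeta w) -> bounded_meas (F s) eps -> (forall w, `|eps w| <= a_hi) ->
  0 <= s -> s <= t -> t < S ->
  rintegrable (fun w => zeta w * eps w * \int[mu]_(v in `[s, t]) f (y v w)) /\
  mean (fun w => zeta w * eps w * \int[mu]_(v in `[s, t]) f (y v w)) <=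
  (t - s) * (mean (fun w => zeta w * eps w * f (y s w)) +
    (a_hi * (K * c + 4 * L * U * c) * (t - s) * mean zeta +
     a_hi * L * mean (fun w => zeta w * (y t w ^+ 2 - y s w ^+ 2)))).
Proof.
move=> bz z0 be ea s0 st tS.
have sS : 0 <= s <= S by rewrite s0 (le_trans st (ltW tS)).
have tS' : 0 <= t <= S by rewrite (le_trans s0 st) ltW.
have sFs := Fsub sS; have sG : sigma_algebra setT (F s) by case: sFs.
have bze := bounded_measM sG bz be.
have iz := bounded_meas_rintegrable P sFs bz.
have mz0 : 0 <= mean zeta by exact: mean_ge0.
have bI X : rintegrable X -> rintegrable (fun w => zeta w * X w).
  exact: rintegrable_bM sFs bz.
have beI X : rintegrable X -> rintegrable (fun w => zeta w * eps w * X w).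
  exact: rintegrable_bM sFs bze.
have ify r : 0 <= r <= S -> rintegrable (fun w => f (y r w)).
  move=> rS; apply: (@rintegrable_bounded _ _ _ P _ (- f U)).
    apply: (measurableT_comp (measurable_generator gf)).
    exact: rintegrable_measurable (ds_integrable dsP rS).
  by move=> w; apply: fb; exact: yb.
have bf1 : bounded_meas (F s) (fun w => f1 (y s w)).
  split; last by exists K => w; apply: f1K; exact: yb.
  rewrite (_ : (fun w => _) = fun w => f1 (Num.max (y s w) 0)); last first.
    by apply/funext => w; rewrite max_l//; case/andP: (yb w sS).
  apply: (@meas_wrt_comp _ _ _ _ (fun x => f1 (Num.max x 0))).
    exact: continuous_measurable_fun.
  exact: (ds_adapted dsP).
have bzef1 := bounded_measM sG bze bf1.
rewrite [X in _ <= X]mulrC.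
apply: (ds_mean_path_le S0 dsP (B := - f U)) => //.
- exact: measurable_generator gf.
- by move=> v w vS; apply: fb; exact: yb.
- by apply: meas_wrt_measurable sFs _; case: bze.
- by case: bze.
move=> v /andP[sv vt].
have vS : v < S by exact: lt_trans tS.
have vS' : 0 <= v <= S by rewrite (le_trans s0 sv) ltW.
have i1 : rintegrable (fun w => zeta w * eps w * f (y s w)) by apply: beI; exact: ify.
have i2 : rintegrable (fun w => zeta w * eps w * f1 (y s w) * (y v w - y s w)).
  apply: rintegrable_bM sFs bzef1 _.
  by apply: rintegrableB; exact: (ds_integrable dsP).
have i3 : rintegrable (fun w => zeta w * (y v w - y s w) ^+ 2).
  apply: bI; have iyy r r' : 0 <= r <= S -> 0 <= r' <= S -> rintegrable (fun w => y r w * y r' w).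
    move=> rS r'S; apply: rintegrable_bM (Fsub rS) (solution_bounded_meas rS) _.
    exact: (ds_integrable dsP).
  rewrite (_ : (fun w => _) = fun w => y v w * y v w - y v w * y s w
      - (y s w * y v w - y s w * y s w)); last by apply/funext => w; ring.
  by apply: rintegrableB; apply: rintegrableB; exact: iyy.
apply: (@le_trans _ _ (mean (fun w => zeta w * eps w * f (y s w) +
   (zeta w * eps w * f1 (y s w) * (y v w - y s w) +
    a_hi * L * (zeta w * (y v w - y s w) ^+ 2))))).
  apply: le_mean.
  - by apply: beI; exact: ify.
  - by apply: rintegrableD => //; apply: rintegrableD => //; exact: rintegrableZ.
  - move=> w; rewrite -lerBlDl -lerBlDl.
    have -> : zeta w * eps w * f (y v w) - zeta w * eps w * f (y s w)
       - zeta w * eps w * f1 (y s w) * (y v w - y s w) =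
      zeta w * (eps w * (f (y v w) - f (y s w) - f1 (y s w) * (y v w - y s w))) by ring.
    have -> : a_hi * L * (zeta w * (y v w - y s w) ^+ 2) =
      zeta w * (a_hi * (L * (y v w - y s w) ^+ 2)) by ring.
    rewrite ler_wpM2l//; apply: le_trans (ler_norm _) _; rewrite normrM.
    by rewrite ler_pM// f1L// yb.
rewrite meanD//; last by apply: rintegrableD => //; exact: rintegrableZ.
rewrite lerD2l meanD//; last exact: rintegrableZ.
rewrite meanZ//.
have h1 := weighted_increment_le bzef1 s0 sv (ltW vS).
have h2 := weighted_square_increment_le bz z0 s0 sv (ltW vt) (ltW tS).
have h3 : mean (fun w => `|zeta w * eps w * f1 (y s w)|) <= a_hi * K * mean zeta.
  rewrite -meanZ//; apply: le_mean.
  - by apply: rintegrable_norm; exact: (bounded_meas_rintegrable P sFs bzef1).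
  - exact: rintegrableZ.
  - move=> w; rewrite !normrM (ger0_norm (z0 w)) -mulrA mulrC ler_wpM2r//.
    by rewrite ler_pM// f1K// yb.
have h4 := ler_norm (mean (fun w => zeta w * eps w * f1 (y s w) * (y v w - y s w))).
have h5 : c * (v - s) * mean (fun w => `|zeta w * eps w * f1 (y s w)|) <=
    c * (t - s) * (a_hi * K * mean zeta).
  apply: ler_pM => //.
  - by rewrite mulr_ge0// subr_ge0.
  - exact: mean_ge0.
  - by rewrite ler_wpM2l// lerD2r ltW.
have h6 : a_hi * L * mean (fun w => zeta w * (y v w - y s w) ^+ 2) <=
   a_hi * L * (mean (fun w => zeta w * (y t w ^+ 2 - y s w ^+ 2)) +
      4 * U * c * (t - s) * mean zeta).
  by rewrite ler_wpM2l// mulr_ge0.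
apply: le_trans (lerD (le_trans (le_trans h4 h1) h5) h6) _.
by rewrite le_eqVlt; apply/orP; left; apply/eqP; ring.
Qed.

(** [X k] stands for the integrated errors of a and lam from the k-th grid point to the last one;
    [X_step] charges them step by step, so that they telescope. *)
Variables (N : nat) (h : R) (abar lbar Ybar X : nat -> Omega -> R).
Hypothesis h0 : 0 < h.
Hypothesis NhS : N%:R * h < S.
Hypothesis abar_meas : forall k, (k < N)%N -> meas_wrt (F (k%:R * h)) (abar k).
Hypothesis abar_bound : forall k w, (k < N)%N -> 0 <= abar k w <= a_hi.
Hypothesis lbar_meas : forall k, (k < N)%N -> bounded_meas (F (k%:R * h)) (lbar k).
Hypothesis Ybar_meas : forall k, (k <= N)%N -> meas_wrt (F (k%:R * h)) (Ybar k).
Hypothesis Ybar_int : forall k, (k <= N)%N -> rintegrable (Ybar k).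
Hypothesis Ybar_gen : forall k, (k < N)%N ->
  rintegrable (fun w => abar k w * f (Ybar k w)).
Hypothesis Ybar_euler : forall k, (k < N)%N -> cond_mean_zero (F (k%:R * h))
  (fun w => Ybar k w - Ybar k.+1 w - h * (abar k w * f (Ybar k w)) - h * lbar k w).
Hypothesis X_int : forall k, (k <= N)%N -> rintegrable (X k).
Hypothesis X_N : forall w, 0 <= X N w.
Hypothesis X_step : forall k w, (k < N)%N ->
  \int[mu]_(v in `[k%:R * h, k.+1%:R * h]) `|a v w - abar k w| +
  \int[mu]_(v in `[k%:R * h, k.+1%:R * h]) `|lam v w - lbar k w| <= X k w - X k.+1 w.

Let gridS k : (k <= N)%N -> 0 <= k%:R * h /\ k%:R * h < S.
Proof.
move=> kN; split; first by rewrite mulr_ge0// ltW.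
by apply: le_lt_trans NhS; rewrite ler_wpM2r ?ler_nat// ltW.
Qed.

Let gridS' k : (k <= N)%N -> 0 <= k%:R * h <= S.
Proof. by move=> /gridS[-> /ltW]. Qed.

Let gridh k : k.+1%:R * h - k%:R * h = h.
Proof. by rewrite -natr1; ring. Qed.

(** The drift splits into (a - abar) f(y) + (lam - lbar) + abar f(y) + lbar. The two data errors
    carry the weights - f U and 1, both at most 1 - f U; since abar is frozen on the step, what
    remains is the oscillation of f(y). *)
Lemma euler_local_error k w (eps : R) : (k < N)%N -> `|eps| <= 1 ->
  eps * (\int[mu]_(v in `[k%:R * h, k.+1%:R * h]) drift f a lam y v w
    - h * (abar k w * f (y (k%:R * h) w)) - h * lbar k w) <=
  (1 - f U) * (X k w - X k.+1 w) +
  eps * abar k w * (\int[mu]_(v in `[k%:R * h, k.+1%:R * h]) f (y v w)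
     - h * f (y (k%:R * h) w)).
Proof.
have arith (u i1 i2 : R) : 0 <= u -> 0 <= i1 -> 0 <= i2 ->
  u * i1 + i2 <= (1 + u) * (i1 + i2) by move=> *; nra.
move=> kN eps1.
have [s0 _] := gridS (ltnW kN); have [t0 tS] := gridS kN.
have st : k%:R * h <= k.+1%:R * h by rewrite ler_wpM2r ?ler_nat// ltW.
have tS' := ltW tS.
set s := k%:R * h in s0 st *; set t := k.+1%:R * h in t0 tS tS' st *.
have ts : t - s = h := gridh k.
have pI (g : R -> R) (B : R) : measurable_fun `[0, S] g ->
    (forall v, 0 <= v <= S -> `|g v| <= B) -> mu.-integrable `[s, t] (EFin \o g).
  by move=> mg gB; apply: (ds_path_integrable s0 tS' mg); exists B.
have mfy : measurable_fun `[0, S] (fun v => f (y v w)).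
  exact: (measurableT_comp (measurable_generator gf) (ds_path_measurable dsP w)).
have ma := ds_ma dsP w; have ml := ds_mlam dsP w.
have fyb v : 0 <= v <= S -> `|f (y v w)| <= - f U by move=> vS; apply: fb; exact: yb.
have ab v : 0 <= v <= S -> `|a v w| <= a_hi.
  move=> vS; have /andP[a1 a2] := ds_a dsP w vS.
  by rewrite ger0_norm//; exact: le_trans (ltW a_lo0) a1.
have lb v : 0 <= v <= S -> `|lam v w| <= lam_hi.
  by move=> vS; have /andP[a1 a2] := ds_lam dsP w vS; rewrite ger0_norm.
have abk := abar_bound w kN.
have iaf : mu.-integrable `[s, t] (EFin \o (fun v => (a v w - abar k w) * f (y v w))).
  apply: (pI _ ((a_hi + a_hi) * - f U)).
    by apply: measurable_funM => //; apply: measurable_funB.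
  move=> v vS; rewrite normrM ler_pM// ?fyb//.
  apply: le_trans (ler_normB _ _) _; rewrite lerD ?ab//.
  by case/andP: abk => h1 h2; rewrite ger0_norm.
have ila : mu.-integrable `[s, t] (EFin \o (fun v => lam v w - lbar k w)).
  apply: (pI _ (lam_hi + `|lbar k w|)); first exact: measurable_funB.
  by move=> v vS; apply: le_trans (ler_normB _ _) _; rewrite lerD ?lb.
have ify : mu.-integrable `[s, t] (EFin \o (fun v => f (y v w))) by exact: pI fyb.
have ina : mu.-integrable `[s, t] (EFin \o (fun v => `|a v w - abar k w|)).
  apply: (pI _ (a_hi + a_hi)).
    by apply: measurableT_comp => //; exact: measurable_funB.
  move=> v vS; rewrite normr_id; apply: le_trans (ler_normB _ _) _; rewrite lerD ?ab//.
  by case/andP: abk => h1 h2; rewrite ger0_norm.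
have inl : mu.-integrable `[s, t] (EFin \o (fun v => `|lam v w - lbar k w|)).
  by apply: integrable_norm.
have icst (r : R) : mu.-integrable `[s, t] (EFin \o (fun=> r)).
  by apply: (pI _ `|r|).
have dec : \int[mu]_(v in `[s, t]) drift f a lam y v w =
   \int[mu]_(v in `[s, t]) ((a v w - abar k w) * f (y v w)) +
   \int[mu]_(v in `[s, t]) (lam v w - lbar k w) +
   abar k w * \int[mu]_(v in `[s, t]) f (y v w) + lbar k w * h.
  rewrite -[in RHS]ts -Rintegral_itv_cst// -RintegralZl// -RintegralD//.
  have iaby : mu.-integrable `[s, t] (EFin \o (fun v => abar k w * f (y v w))).
    exact: (@integrableZl _ _ _ _ _ _ (abar k w) _ ify).
  have i12 : mu.-integrable `[s, t] (EFin \o (fun v =>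
      (a v w - abar k w) * f (y v w) + (lam v w - lbar k w))).
    exact: (@integrableD _ _ _ _ _ _ _ _ iaf ila).
  rewrite -RintegralD// -RintegralD//.
    by apply: eq_Rintegral => v _; rewrite /drift; ring.
  exact: (@integrableD _ _ _ _ _ _ _ _ i12 iaby).
rewrite dec.
set A := \int[mu]_(v in `[s, t]) ((a v w - abar k w) * f (y v w)).
set B := \int[mu]_(v in `[s, t]) (lam v w - lbar k w).
set C := \int[mu]_(v in `[s, t]) f (y v w).
have -> : eps * (A + B + abar k w * C + lbar k w * h - h * (abar k w * f (y s w))
    - h * lbar k w) = eps * (A + B) + eps * abar k w * (C - h * f (y s w)) by ring.
rewrite lerD2r; apply: le_trans (ler_norm _) _; rewrite normrM.
apply: (@le_trans _ _ `|A + B|); first by rewrite ler_piMl.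
apply: le_trans (ler_normD _ _) _.
have X1 := X_step w kN.
have Ale : `|A| <= - f U * \int[mu]_(v in `[s, t]) `|a v w - abar k w|.
  apply: le_trans (le_normr_Rintegral _ iaf) _ => //.
  rewrite -RintegralZl//; apply: le_Rintegral => //.
  - exact: integrable_norm.
  - exact: (@integrableZl _ _ _ _ _ _ (- f U) _ ina).
  - move=> v /=; rewrite in_itv/= => /andP[sv vt].
    rewrite normrM mulrC ler_wpM2r// fyb//.
    by rewrite (le_trans s0 sv) (le_trans vt tS').
have Ble : `|B| <= \int[mu]_(v in `[s, t]) `|lam v w - lbar k w|.
  exact: le_normr_Rintegral.
have I1 : 0 <= \int[mu]_(v in `[s, t]) `|a v w - abar k w| by exact: Rintegral_ge0.
have I2 : 0 <= \int[mu]_(v in `[s, t]) `|lam v w - lbar k w| by exact: Rintegral_ge0.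
have fU0 : 0 <= - f U by rewrite oppr_ge0 (generator_le0 gf).
apply: (@le_trans _ _ ((1 - f U) * (\int[mu]_(v in `[s, t]) `|a v w - abar k w| +
    \int[mu]_(v in `[s, t]) `|lam v w - lbar k w|))).
  exact: le_trans (lerD Ale Ble) (arith _ _ _ fU0 I1 I2).
by rewrite ler_wpM2l// addr_ge0.
Qed.

Let A := a_hi * (K * c + 4 * L * U * c).
Let B := a_hi * L.

Lemma measurable_sg : measurable_fun [set: R] (@Num.sg R).
Proof.
apply: nondecreasing_measurable => // x x' xx'.
by case: (sgrP x) xx' => hx; case: (sgrP x') => hx' //; lra.
Qed.

(* The error is tested with its sign: the monotonicity of f removes the difference
   f (y_k) - f (Ybar_k). *)
Lemma euler_step zeta k : (k < N)%N -> bounded_meas (F (k%:R * h)) zeta ->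
  (forall w, 0 <= zeta w) ->
  mean (fun w => zeta w * `|y (k%:R * h) w - Ybar k w|) +
    (1 - f U) * mean (fun w => zeta w * X k.+1 w) <=
  mean (fun w => zeta w * `|y (k.+1%:R * h) w - Ybar k.+1 w|) +
    (1 - f U) * mean (fun w => zeta w * X k w) +
    h * (A * h * mean zeta +
      B * mean (fun w => zeta w * (y (k.+1%:R * h) w ^+ 2 - y (k%:R * h) w ^+ 2))).
Proof.
move=> kN bz z0.
have [s0 _] := gridS (ltnW kN); have [t0 tS] := gridS kN.
have st : k%:R * h <= k.+1%:R * h by rewrite ler_wpM2r ?ler_nat// ltW.
have sS := gridS' (ltnW kN); have tS' := gridS' kN.
have loc := fun w eps => @euler_local_error k w eps kN.
have am := abar_meas kN; have ab := fun w => abar_bound w kN.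
have Ym := Ybar_meas (ltnW kN); have iY := Ybar_int (ltnW kN); have iY1 := Ybar_int kN.
have iG := Ybar_gen kN; have [iE zE] := Ybar_euler kN.
have bl := lbar_meas kN.
have iX := X_int (ltnW kN); have iX1 := X_int kN.
have ts := gridh k.
set s := k%:R * h in s0 st sS loc am Ym zE bl ts bz *.
set t := k.+1%:R * h in t0 tS tS' st loc ts *.
have sFs := Fsub sS; have sG : sigma_algebra setT (F s) by case: sFs.
(* The sign of the error is known at the beginning of the step, so it can be absorbed into the
   weight. *)
pose e w := Num.sg (y s w - Ybar k w).
have em : meas_wrt (F s) e.
  apply: meas_wrt_comp measurable_sg _; apply: meas_wrtB => //.
  exact: (ds_adapted dsP).
have e1 w : `|e w| <= 1 by rewrite /e normr_sg; case: (_ != 0).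
have be : bounded_meas (F s) e by split; [|exists 1].
have bze := bounded_measM sG bz be.
pose ea w := e w * abar k w.
have bab : bounded_meas (F s) (abar k).
  by split => //; exists a_hi => w; have /andP[h1 h2] := ab w; rewrite ger0_norm.
have bea : bounded_meas (F s) ea by exact: bounded_measM.
have eab w : `|ea w| <= a_hi.
  rewrite /ea normrM; apply: (@le_trans _ _ (1 * `|abar k w|)); first by rewrite ler_wpM2r.
  by rewrite mul1r; have /andP[h1 h2] := ab w; rewrite ger0_norm.
have [iC hC] := weighted_generator_oscillation_le bz z0 bea eab s0 st tS.
have iys := ds_integrable dsP sS; have iyt := ds_integrable dsP tS'.
have iJ := ds_drift_integrable dsP s0 st (ltW tS).
have [iD zD] := ds_dynamics dsP s0 st (ltW tS).
have bI Z : rintegrable Z -> rintegrable (fun w => zeta w * Z w).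
  exact: rintegrable_bM sFs bz.
have bzI Z : rintegrable Z -> rintegrable (fun w => zeta w * e w * Z w).
  exact: rintegrable_bM sFs bze.
have ify : rintegrable (fun w => zeta w * ea w * f (y s w)).
  apply: rintegrable_bM sFs (bounded_measM sG bz bea) _.
  apply: (@rintegrable_bounded _ _ _ P _ (- f U)).
    exact: (measurableT_comp (measurable_generator gf) (rintegrable_measurable iys)).
  by move=> w; apply: fb; exact: yb.
have id0 : rintegrable (fun w => zeta w * `|y s w - Ybar k w|).
  by apply: bI; apply: rintegrable_norm; exact: rintegrableB.
have id1 : rintegrable (fun w => zeta w * `|y t w - Ybar k.+1 w|).
  by apply: bI; apply: rintegrable_norm; exact: rintegrableB.
have iX' : rintegrable (fun w => zeta w * X k w) by exact: bI.
have iX1' : rintegrable (fun w => zeta w * X k.+1 w) by exact: bI.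
pose Z1 w := zeta w * e w * (y s w - y t w - \int[mu]_(v in `[s, t]) drift f a lam y v w).
pose Z2 w := zeta w * e w *
  (Ybar k w - Ybar k.+1 w - h * (abar k w * f (Ybar k w)) - h * lbar k w).
have iZ1 : rintegrable Z1 by exact: bzI.
have iZ2 : rintegrable Z2 by exact: bzI.
have key w : zeta w * `|y s w - Ybar k w| <=
    (Z1 w - Z2 w) + (zeta w * `|y t w - Ybar k.+1 w| +
     ((1 - f U) * (zeta w * X k w) - (1 - f U) * (zeta w * X k.+1 w) +
      (zeta w * ea w * \int[mu]_(v in `[s, t]) f (y v w) -
       h * (zeta w * ea w * f (y s w))))).
  have -> : `|y s w - Ybar k w| = e w * (y s w - Ybar k w) by rewrite /e normrEsg.
  have := loc w (e w) (e1 w).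
  rewrite /Z1 /Z2 /ea; set J := \int[mu]_(v in _) drift f a lam y v w.
  set C := \int[mu]_(v in _) f (y v w) => loc1.
  have h1 : e w * (y t w - Ybar k.+1 w) <= `|y t w - Ybar k.+1 w|.
    by apply: le_trans (ler_norm _) _; rewrite normrM ler_piMl.
  have h2 : e w * (f (y s w) - f (Ybar k w)) <= 0.
    rewrite /e; case: sgrP => hs; rewrite ?mul0r//.
      by rewrite mul1r subr_le0 (generator_mono gf)//; lra.
    by rewrite mulN1r oppr_le0 subr_ge0 (generator_mono gf)//; lra.
  have h3 : h * (abar k w * (e w * (f (y s w) - f (Ybar k w)))) <= 0.
    by rewrite pmulr_rle0// mulr_ge0_le0//; case/andP: (ab w).
  rewrite -subr_ge0.
  have -> : zeta w * e w * (y s w - y t w - J) -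
      zeta w * e w * (Ybar k w - Ybar k.+1 w - h * (abar k w * f (Ybar k w)) - h * lbar k w) +
      (zeta w * `|y t w - Ybar k.+1 w| +
       ((1 - f U) * (zeta w * X k w) - (1 - f U) * (zeta w * X k.+1 w) +
        (zeta w * (e w * abar k w) * C - h * (zeta w * (e w * abar k w) * f (y s w))))) -
      zeta w * (e w * (y s w - Ybar k w)) =
    zeta w * ((`|y t w - Ybar k.+1 w| - e w * (y t w - Ybar k.+1 w)) +
      (((1 - f U) * (X k w - X k.+1 w) + e w * abar k w * (C - h * f (y s w))) -
       e w * (J - h * (abar k w * f (y s w)) - h * lbar k w)) -
      h * (abar k w * (e w * (f (y s w) - f (Ybar k w))))) by ring.
  rewrite mulr_ge0//; lra.
have iR1 : rintegrable (fun w => zeta w * ea w * \int[mu]_(v in `[s, t]) f (y v w) -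
       h * (zeta w * ea w * f (y s w))) by apply: rintegrableB => //; exact: rintegrableZ.
have iR2 : rintegrable (fun w => (1 - f U) * (zeta w * X k w) -
    (1 - f U) * (zeta w * X k.+1 w)) by apply: rintegrableB; exact: rintegrableZ.
have iR3 := rintegrableD iR2 iR1; have iR4 := rintegrableD id1 iR3.
have iR5 := rintegrableB iZ1 iZ2; have iR6 := rintegrableD iR5 iR4.
have := le_mean id0 iR6 key.
rewrite (meanD iR5 iR4) (meanB iZ1 iZ2) (meanD id1 iR3) (meanD iR2 iR1).
rewrite (meanB (rintegrableZ _ iX') (rintegrableZ _ iX1')) (meanB iC (rintegrableZ _ ify)).
rewrite !meanZ// (zD _ bze) (zE _ bze) subrr add0r.
move: hC; rewrite ts -/A -/B.
set q1 := mean _; set q2 := mean _; set q3 := mean zeta; set q4 := mean _.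
lra.
Qed.

(** Summed over the steps, the decrements of X leave X i - X N with X N >= 0, and the increments of
    E[zeta y^2] leave at most U^2 E[zeta]. Hence the B terms contribute a single factor h instead of
    N h. The weight is known at time i h, hence at all later grid points. *)
Lemma euler_error zeta i EX EN : (i <= N)%N -> bounded_meas (F (i%:R * h)) zeta ->
  (forall w, 0 <= zeta w) ->
  mean (fun w => zeta w * X i w) <= EX * mean zeta ->
  mean (fun w => zeta w * `|y (N%:R * h) w - Ybar N w|) <= EN * mean zeta ->
  mean (fun w => zeta w * `|y (i%:R * h) w - Ybar i w|) <=
  (EN + (1 - f U) * EX + (A * (N%:R * h) + B * U ^+ 2) * h) * mean zeta.
Proof.
move=> iN bz z0 hX hN.
have sFi := Fsub (gridS' iN).
have bI Z : rintegrable Z -> rintegrable (fun w => zeta w * Z w).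
  exact: rintegrable_bM sFi bz.
have iz := bounded_meas_rintegrable P sFi bz.
have mz : 0 <= mean zeta by exact: mean_ge0.
have iy2 k : (k <= N)%N -> rintegrable (fun w => zeta w * y (k%:R * h) w ^+ 2).
  move=> kN; apply: bI.
  apply: rintegrable_bM (Fsub (gridS' kN)) (solution_bounded_meas (gridS' kN)) _.
  exact: (ds_integrable dsP (gridS' kN)).
have ind l : (i + l <= N)%N ->
  mean (fun w => zeta w * `|y (i%:R * h) w - Ybar i w|) +
    (1 - f U) * mean (fun w => zeta w * X (i + l)%N w) <=
  mean (fun w => zeta w * `|y ((i + l)%:R * h) w - Ybar (i + l)%N w|) +
    (1 - f U) * mean (fun w => zeta w * X i w) +
    h * (A * (l%:R * h) * mean zeta +
      B * (mean (fun w => zeta w * y ((i + l)%:R * h) w ^+ 2) -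
           mean (fun w => zeta w * y (i%:R * h) w ^+ 2))).
  elim: l => [_|l IH].
    by rewrite addn0 subrr mulr0 mulr0n mul0r mulr0 mul0r !addr0 mulr0 addr0.
  rewrite addnS => lN; have := IH (ltnW lN).
  have bzl : bounded_meas (F ((i + l)%:R * h)) zeta.
    case: bz => mz' bz; split => //; apply: meas_wrtS mz'.
    apply: Fmono; [by case: (gridS iN)| |by case: (gridS (ltnW lN)) => _ /ltW].
    by rewrite ler_wpM2r ?ler_nat ?leq_addr// ltW.
  have := euler_step lN bzl z0.
  under [X in B * X]eq_Rintegral do rewrite mulrBr.
  rewrite -/(mean _) (meanB (iy2 _ lN) (iy2 _ (ltnW lN))).
  rewrite -[l.+1%:R]natr1 mulrDl mul1r.
  set q1 := mean _; set q2 := mean _; set q3 := mean _; set q4 := mean _; set q5 := mean _.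
  set q6 := mean _; set q7 := mean _; set q8 := mean _; set q9 := mean _.
  lra.
have := ind (N - i)%N; rewrite subnKC// => /(_ (leqnn _)).
have XN : 0 <= mean (fun w => zeta w * X N w) by apply: mean_ge0 => w; rewrite mulr_ge0.
have yN : mean (fun w => zeta w * y (N%:R * h) w ^+ 2) <= U ^+ 2 * mean zeta.
  rewrite -meanZ//; apply: le_mean; [exact: iy2|exact: rintegrableZ|].
  move=> w; rewrite mulrC ler_wpM2r//.
  by have /andP[y1 y2] := yb w (gridS' (leqnn N)); rewrite ler_pXn2r// nnegrE.
have yi : 0 <= mean (fun w => zeta w * y (i%:R * h) w ^+ 2).
  by apply: mean_ge0 => w; rewrite mulr_ge0// sqr_ge0.
have A0 : 0 <= A by rewrite mulr_ge0// addr_ge0// !mulr_ge0.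
have B0 : 0 <= B by rewrite mulr_ge0.
have fU0 : 0 <= 1 - f U by have := generator_le0 gf U0; lra.
have hNi : (N - i)%:R * h <= N%:R * h by rewrite ler_wpM2r ?ler_nat ?leq_subr// ltW.
set e0 := mean _; set e1 := mean _ in XN *; set e2 := mean _ in hN *; set e3 := mean _ in hX *.
set e4 := mean _ in yN *; set e5 := mean _ in yi *; set z := mean zeta in mz hX hN yN *.
have p1 : 0 <= (1 - f U) * e1 by rewrite mulr_ge0.
have p2 : (1 - f U) * e3 <= (1 - f U) * (EX * z) by rewrite ler_wpM2l.
have p3 : A * ((N - i)%:R * h) * z <= A * (N%:R * h) * z by rewrite ler_wpM2r// ler_wpM2l.
have p4 : B * (e4 - e5) <= B * (U ^+ 2 * z) by rewrite ler_wpM2l//; lra.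
have p5 : h * (A * ((N - i)%:R * h) * z + B * (e4 - e5)) <=
   h * (A * (N%:R * h) * z + B * (U ^+ 2 * z)) by rewrite ler_wpM2l ?lerD// ltW.
move=> H.
have -> : (EN + (1 - f U) * EX + (A * (N%:R * h) + B * U ^+ 2) * h) * z =
  EN * z + (1 - f U) * (EX * z) + h * (A * (N%:R * h) * z + B * (U ^+ 2 * z)) by ring.
lra.
Qed.

(** Tested with the indicator of the event where the bound fails, the mean estimate forces this
    event to be null. *)
Lemma euler_error_ae i EX EN : (i <= N)%N ->
  (forall zeta, bounded_meas (F (i%:R * h)) zeta -> (forall w, 0 <= zeta w) ->
     mean (fun w => zeta w * X i w) <= EX * mean zeta) ->
  (forall zeta, bounded_meas (F (i%:R * h)) zeta -> (forall w, 0 <= zeta w) ->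
     mean (fun w => zeta w * `|y (N%:R * h) w - Ybar N w|) <= EN * mean zeta) ->
  {ae P, forall w, `|y (i%:R * h) w - Ybar i w| <=
     EN + (1 - f U) * EX + (A * (N%:R * h) + B * U ^+ 2) * h}.
Proof.
move=> iN hX hN; set D := EN + _ + _.
have sFi := Fsub (gridS' iN); have sG : sigma_algebra setT (F (i%:R * h)) by case: sFi.
have dm : meas_wrt (F (i%:R * h)) (fun w => `|y (i%:R * h) w - Ybar i w|).
  apply: (@meas_wrt_comp _ _ _ _ (fun x : R => `|x|)); first exact: normr_measurable.
  by apply: meas_wrtB; [|exact: (ds_adapted dsP (gridS' iN))|exact: Ybar_meas].
pose zeta : Omega -> R := \1_[set w | D < `|y (i%:R * h) w - Ybar i w|].
have bz : bounded_meas (F (i%:R * h)) zeta.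
  apply: bounded_meas_indic => //.
  have := dm _ (measurable_itv `]D, +oo[).
  rewrite (_ : _ @^-1` _ = [set w | D < `|y (i%:R * h) w - Ybar i w|])//.
  by apply/seteqP; split => w /=; rewrite in_itv/= andbT.
have z0 w : 0 <= zeta w by rewrite /zeta indicE.
have := euler_error iN bz z0 (hX _ bz z0) (hN _ bz z0); rewrite -/D => le.
have id : rintegrable (fun w => `|y (i%:R * h) w - Ybar i w|).
  apply: rintegrable_norm; apply: rintegrableB; last exact: Ybar_int.
  exact: (ds_integrable dsP (gridS' iN)).
have iz := bounded_meas_rintegrable P sFi bz.
have i1 := rintegrable_bM sFi bz id.
have i2 := rintegrableB i1 (rintegrableZ D iz).
have p w : 0 <= zeta w * `|y (i%:R * h) w - Ybar i w| - D * zeta w.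
  rewrite [D * _]mulrC -mulrBr /zeta indicE.
  have [dw|dw] := ltP D `|y (i%:R * h) w - Ybar i w|.
    by rewrite mem_set// mul1r subr_ge0 ltW.
  by rewrite memNset ?mul0r//=; apply/negP; rewrite -leNgt.
have m0 : mean (fun w => zeta w * `|y (i%:R * h) w - Ybar i w| - D * zeta w) <= 0.
  by rewrite (meanB i1 (rintegrableZ D iz)) meanZ// subr_le0.
apply: filterS (mean_le0_ae i2 p m0) => w.
rewrite /zeta indicE leNgt; have [dw|//] := ltP D `|y (i%:R * h) w - Ybar i w|.
by rewrite mem_set// mul1r mulr1 => /eqP; rewrite subr_eq0 gt_eqF.
Qed.

End euler_error.

(** * Reduction of the BSDE to its conditional mean dynamics *)

Section filtration.
Context {R : realType} {disp : measure_display} {Omega : measurableType disp}.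
Variables (P : probability Omega R) (d : nat) (W : 'I_d -> R -> Omega -> R).
Variables (F : R -> set (set Omega)) (T : R).
Hypothesis FE : forall t : R, 0 <= t <= T -> F t = brownian_filtration P W t.
Hypothesis FT : F T = @measurable disp Omega.

Lemma filtration_mono s t : 0 <= s -> s <= t -> t <= T -> F s `<=` F t.
Proof.
move=> s0 st tT; rewrite !FE ?s0 ?(le_trans s0 st) ?(le_trans st tT)//.
apply: sub_sigma_algebra2 => A [nA|[j [r [B [/andP[r0 rs] mB ->]]]]]; [by left|right].
by exists j, r, B; rewrite r0 (le_trans rs st).
Qed.

Lemma filtration_sub_sigma t : 0 <= t <= T -> sub_sigma (F t).
Proof.
move=> t0T; split.
  by rewrite FE//; exact: smallest_sigma_algebra.
by rewrite -FT; case/andP: t0T => t0 tT; exact: filtration_mono.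
Qed.

Lemma filtration_negligible t : 0 <= t <= T -> P.-negligible `<=` F t.
Proof. by move=> t0T A nA; rewrite FE//; apply: sub_sigma_algebra; left. Qed.

End filtration.

(** * Changes on null sets under a complete measure *)

Section complete.
Context {R : realType} {disp : measure_display} {Omega : measurableType disp}.
Variable P : probability Omega R.
Hypothesis cP : measure_is_complete P.
Implicit Types X Y : Omega -> R.

Lemma complete_measurable X Y : {ae P, forall w, X w = Y w} ->
  measurable_fun setT X -> measurable_fun setT Y.
Proof.
move=> XY mX; apply/measurable_EFinP.
apply: (ae_measurable_fun cP (f := EFin \o X)); last exact/measurable_EFinP.
by apply: filterS XY => w /= -> _.
Qed.

Lemma complete_rintegrable X Y : {ae P, forall w, X w = Y w} ->
  rintegrable P X -> rintegrable P Y.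
Proof.
move=> XY iX.
exact: (rintegrable_ae (complete_measurable XY (rintegrable_measurable iX)) XY iX).
Qed.

Lemma complete_cond_mean_zero G X Y : sub_sigma G -> {ae P, forall w, X w = Y w} ->
  cond_mean_zero P G X -> cond_mean_zero P G Y.
Proof.
move=> sG XY cX; apply: (cond_mean_zero_ae sG _ XY cX).
exact: complete_measurable XY (rintegrable_measurable cX.1).
Qed.

End complete.

Section bsde.
Context {R : realType} {disp : measure_display} {Omega : measurableType disp}.
Variable P : probability Omega R.
Local Notation mu := (@lebesgue_measure R).

(** The supremum over uncountably many times in [Sp_space] is not known to be measurable; the
    integral of a non-negative function, a supremum over simple functions below it, is monotone all
    the same. *)
Lemma le_integral_nonmeasurable (X : Omega -> \bar R) (Y : Omega -> \bar R) :
  (forall w, 0 <= X w)%E -> (forall w, X w <= Y w)%E ->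
  (\int[P]_w X w <= \int[P]_w Y w)%E.
Proof.
move=> X0 XY; rewrite !ge0_integralTE//; last by move=> w; exact: le_trans (XY w).
apply: le_ereal_sup => _ [h /= hX <-]; exists h => //= w.
exact: le_trans (hX w) (XY w).
Qed.

Lemma Sp_space_rintegrable (d : nat) (F : R -> set (set Omega)) (s t : R) Y
    (Z : 'I_d -> R -> Omega -> R) : Sp_space P F 1 s Y Z -> 0 <= t <= s ->
  measurable_fun setT (Y t) -> rintegrable P (Y t).
Proof.
move=> [_ Yoo _ _] ts mY; apply/integrableP; split; first exact/measurable_EFinP.
apply: le_lt_trans Yoo; apply: le_integral_nonmeasurable => w //.
apply: ereal_sup_ubound; exists t; first by rewrite /= in_itv.
by rewrite powRr1.
Qed.

Variables (T : R) (d : nat) (W : 'I_d -> R -> Omega -> R).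
Variables (F : R -> set (set Omega)).
Variables (eta_lo eta_hi lambda_hi : R) (eta lambda : R -> Omega -> R) (f : R -> R).
Hypothesis T0 : 0 < T.
Hypothesis FE : forall t : R, 0 <= t <= T -> F t = brownian_filtration P W t.
Hypothesis FT : F T = @measurable disp Omega.
Hypothesis cP : measure_is_complete P.
Hypothesis BM : brownian_motion P W F T.
Hypothesis eta_lo0 : 0 < eta_lo.
Hypothesis eta_lohi : eta_lo < eta_hi.
Hypothesis lambda_hi0 : 0 <= lambda_hi.
Hypothesis eta_prog : progressive F T eta.
Hypothesis lambda_prog : progressive F T lambda.
Hypothesis eta_lambda_bound : {ae P, forall w, forall t : R, 0 <= t <= T ->
  eta_lo <= eta t w <= eta_hi /\ 0 <= lambda t w <= lambda_hi}.
Hypothesis gf : singular_generator f.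

(** From time 0 on, the equation writes Y as a constant minus an integral with continuous primitive
    plus the continuous M. *)
Lemma bsde_path_continuous (S S' : R) (Y M g : R -> R) : 0 < S -> S < S' ->
  mu.-integrable `[0, S] (EFin \o g) ->
  {within `[0, S'], continuous M} ->
  (forall t, 0 <= t <= S -> Y 0 = Y t + \int[mu]_(u in `[0, t]) g u - (M t - M 0)) ->
  {within `[0, S], continuous Y}.
Proof.
move=> S0 SS' ig cM YE.
pose Y' t := (Y 0 - \int[mu]_(u in `[0, t]) g u) + (M t - M 0).
have eqY : {in `[0, S]%classic, Y' =1 Y}.
  move=> t /set_mem /=; rewrite in_itv/= => tS; rewrite /Y' (YE t tS); ring.
apply: (subspace_eq_continuous eqY).
have cM' : {within `[0, S], continuous M}.
  apply: continuous_subspaceW cM => t /=; rewrite !in_itv/= => /andP[-> tS].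
  exact: le_trans tS (ltW SS').
have cI := parameterized_integral_continuous (ltW S0) ig.
move=> t; apply: cvgD; first by apply: cvgB; [exact: cvg_cst|exact: cI].
by apply: cvgB; [exact: cM'|exact: cvg_cst].
Qed.

Variables (Y : R -> Omega -> R) (Z : 'I_d -> R -> Omega -> R).
Hypothesis Ysol : singular_bsde_solution P W F T eta lambda f Y Z.

(** All almost sure properties are gathered in one event [G] of full probability, and off [G] the
    processes are replaced by admissible constants, so that bounds and continuity hold for every w.
    Null sets belong to every F t, hence y stays adapted. *)
Lemma bsde_drift_solution S : 0 < S -> S < T ->
  exists (a lam y : R -> Omega -> R),
    drift_solution P F S eta_hi^-1 eta_lo^-1 lambda_hi f a lam y /\
    {ae P, forall w, forall t, 0 <= t <= S ->
      [/\ y t w = Y t w, a t w = (eta t w)^-1 & lam t w = lambda t w]}.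
Proof.
move=> S0 ST.
pose S' := (S + T) / 2.
have SS' : S < S' by rewrite /S'; lra.
have S'T : S' < T by rewrite /S'; lra.
have S'0 : 0 < S' by exact: lt_trans S0 SS'.
have [Yinf [M [Mito Ydyn]] Yge0 _] := Ysol.
have Y1 : Sp_space P F 1 S' Y Z.
  have := Yinf (T - S') 1; rewrite subKr; apply => //.
  by rewrite subr_gt0 S'T/= ltrBlDr ltrDl.
have [[Yad Ycad] _ _ _] := Y1.
have MS' : ito_integral P W F S' Z M by apply: Mito; rewrite (ltW S'0).
have [_ Mcont _] := MS'.
have Fsub := filtration_sub_sigma FE FT; have Fmono := filtration_mono FE.
pose Q w := [/\ (forall t : R, 0 <= t <= T ->
    eta_lo <= eta t w <= eta_hi /\ 0 <= lambda t w <= lambda_hi) /\ cadlag S' (Y ^~ w),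
  forall t, 0 <= t < T -> 0 <= Y t w,
  forall s t, 0 <= s -> s <= t -> t < T ->
           Y s w = Y t w
             + \int[mu]_(u in `[s, t]) ((eta u w)^-1 * f (Y u w) + lambda u w)
             - (M t w - M s w) &
  {within `[0, S'], continuous (M ^~ w)}].
have aeQ : {ae P, forall w, Q w}.
  apply: filterS (filterI eta_lambda_bound (filterI Ycad (filterI Yge0
    (filterI Ydyn Mcont)))) => w [? [? [? [? ?]]]]; by split.
pose G := [set w | Q w].
have nG : P.-negligible (~` G) by exact: aeQ.
pose y t w := if w \in G then Y t w else 0.
pose a t w := if w \in G then (eta t w)^-1 else eta_lo^-1.
pose lam t w := if w \in G then lambda t w else 0.
have aeG : {ae P, forall w, w \in G} by apply: filterS aeQ => w; exact: mem_set.
have yY t : {ae P, forall w, Y t w = y t w} by apply: filterS aeG => w; rewrite /y => ->.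
have tT t : 0 <= t <= S -> 0 <= t <= T.
  by move=> /andP[-> h]; exact: le_trans h (ltW ST).
have tS' t : 0 <= t <= S -> 0 <= t <= S'.
  by move=> /andP[-> h]; exact: le_trans h (ltW SS').
have yad t : 0 <= t <= S -> meas_wrt (F t) (y t).
  move=> tS; apply: (meas_wrt_ae _ _ (yY t)); first by case: (Fsub t (tT _ tS)).
    exact: filtration_negligible FE _ (tT _ tS).
  by apply: Yad; rewrite /= in_itv/= tS'.
have yint t : 0 <= t <= S -> rintegrable P (y t).
  move=> tS; apply: (complete_rintegrable cP (yY t)).
  apply: Sp_space_rintegrable Y1 (tS' _ tS) _.
  by apply: meas_wrt_measurable (Fsub t (tT _ tS)) _; apply: Yad; rewrite /= in_itv/= tS'.
have ehi0 : 0 < eta_hi by exact: lt_trans eta_lo0 eta_lohi.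
have ab t w : 0 <= t <= S -> eta_hi^-1 <= a t w <= eta_lo^-1.
  move=> tS; rewrite /a; case: ifPn => [/set_mem [[h _] _ _ _]|_].
    have [/andP[h1 h2] _] := h t (tT _ tS).
    have e0 := lt_le_trans eta_lo0 h1.
    by rewrite !lef_pV2// h1 h2.
  by rewrite lexx andbT lef_pV2// ltW.
have lb t w : 0 <= t <= S -> 0 <= lam t w <= lambda_hi.
  move=> tS; rewrite /lam; case: ifPn => [/set_mem [[h _] _ _ _]|_].
    by have [_] := h t (tT _ tS).
  by rewrite lexx.
have sub0S : (`[0, S]%classic : set R) `<=` `[0, T]%classic.
  by move=> v /=; rewrite !in_itv/=; exact: tT.
have sub0S' : (`[0, S]%classic : set R) `<=` `[0, S']%classic.
  by move=> v /=; rewrite !in_itv/=; exact: tS'.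
have ma w : measurable_fun `[0, S] (a ^~ w).
  rewrite (_ : a ^~ w = if w \in G then (fun t => (eta t w)^-1) else cst eta_lo^-1); last first.
    by apply/funext => t; rewrite /a; case: ifP.
  case: ifPn => // _.
  apply: (measurableT_comp (@measurable_invr R)).
  by apply: measurable_funS sub0S _ => //; exact: progressive_path (ltW T0) FT eta_prog w.
have ml w : measurable_fun `[0, S] (lam ^~ w).
  rewrite (_ : lam ^~ w = if w \in G then lambda ^~ w else cst 0); last first.
    by apply/funext => t; rewrite /lam; case: ifP.
  case: ifPn => // _.
  by apply: measurable_funS sub0S _ => //; exact: progressive_path (ltW T0) FT lambda_prog w.
have ig w : w \in G -> mu.-integrable `[0, S]
    (EFin \o (fun u => (eta u w)^-1 * f (Y u w) + lambda u w)).
  move=> wG; have [[hb hc] hp _ _] := set_mem wG.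
  have [K hK] := cadlag_bounded (ltW S'0) hc.
  have mY : measurable_fun `[0, S] (Y ^~ w).
    apply: measurable_funS sub0S' _ => //.
    by apply: (@jointly_measurable_path R disp Omega) => //; case: hc.
  apply: (@itv_integrable _ _ _ (eta_lo^-1 * - f K + lambda_hi)).
    apply: measurable_funD; last by have := ml w; rewrite /lam wG.
    apply: measurable_funM; first by have := ma w; rewrite /a wG.
    exact: (measurableT_comp (measurable_generator gf) mY).
  move=> v /=; rewrite in_itv/= => vS.
  have := ab v w vS; rewrite /a wG => /andP[a1 a2].
  have := lb v w vS; rewrite /lam wG => /andP[l1 l2].
  apply: le_trans (ler_normD _ _) _; rewrite [`|lambda v w|]ger0_norm// lerD// normrM.
  have Y0 : 0 <= Y v w.
    by apply: hp; case/andP: vS => -> h; exact: le_lt_trans h ST.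
  rewrite ler_pM//.
    by rewrite ger0_norm// (le_trans _ a1)// invr_ge0 ltW.
  rewrite ler0_norm ?(generator_le0 gf)// lerN2 (generator_mono gf)//.
  by apply: le_trans (ler_norm _) _; apply: hK; exact: tS'.
have drE s t w : w \in G -> 
   \int[mu]_(v in `[s, t]) drift f a lam y v w =
   \int[mu]_(u in `[s, t]) ((eta u w)^-1 * f (Y u w) + lambda u w).
  by move=> wG; apply: eq_Rintegral => v _; rewrite /drift /a /lam /y wG.
have Mmart s t : 0 <= s -> s <= t -> t <= S ->
    cond_mean_zero P (F s) (fun w => M t w - M s w).
  move=> s0 st tS; apply: (ito_integral_martingale Fsub Fmono BM _ MS' s0 st).
    exact: ltW.
  exact: le_trans tS (ltW SS').
have aedr s t : 0 <= s -> s <= t -> t <= S -> {ae P, forall w,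
    \int[mu]_(v in `[s, t]) drift f a lam y v w = y s w - y t w + (M t w - M s w)}.
  move=> s0 st tS; apply: filterS aeG => w wG; rewrite drE//.
  have [_ _ h _] := set_mem wG.
  by rewrite /y wG (h s t s0 st (le_lt_trans tS ST)); ring.
exists a, lam, y; split; last first.
  by apply: filterS aeG => w wG t tS; rewrite /y /a /lam wG.
split => //.
- move=> w; rewrite (_ : y ^~ w = if w \in G then Y ^~ w else cst 0); last first.
    by apply/funext => t; rewrite /y; case: ifP.
  case: ifPn => [wG|_]; last by move=> t; exact: cvg_cst.
  have [_ _ h hM] := set_mem wG.
  apply: (bsde_path_continuous S0 SS' (ig w wG) hM) => t /andP[t0 tS].
  exact: h (lexx 0) t0 (le_lt_trans tS ST).
- move=> t w /andP[t0 tS]; rewrite /y; case: ifPn => // /set_mem [_ h _ _].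
  by apply: h; rewrite t0 (le_lt_trans tS ST).
- move=> s t s0 st tS.
  have [iM _] := Mmart s t s0 st tS.
  have sS : 0 <= s <= S by rewrite s0 (le_trans st).
  have tS0 : 0 <= t <= S by rewrite (le_trans s0 st).
  apply: (@complete_rintegrable _ _ _ _ cP (fun w => y s w - y t w + (M t w - M s w))).
    by apply: filterS (aedr s t s0 st tS) => w ->.
  apply: rintegrableD => //; apply: rintegrableB; exact: yint.
- move=> s t s0 st tS.
  have sS : 0 <= s <= S by rewrite s0 (le_trans st).
  (* By the equation, the residual of the conditional mean dynamics is minus the martingale
     increment. *)
  apply: (@complete_cond_mean_zero _ _ _ _ cP _ (fun w => -1 * (M t w - M s w))).
  + exact: Fsub (tT _ sS).
  + by apply: filterS (aedr s t s0 st tS) => w ->; ring.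
  + apply: cond_mean_zeroM (Mmart s t s0 st tS); first exact: Fsub (tT _ sS).
    by apply: bounded_meas_cst; case: (Fsub s (tT _ sS)).
Qed.

End bsde.

(** * From the almost sure bound to a bound on every path *)

Section bounded_solution.
Context {R : realType} {disp : measure_display} {Omega : measurableType disp}.
Variable P : probability Omega R.
Local Notation mu := (@lebesgue_measure R).

(** The exceptional sets are united over the countably many times k / (m + 1) cut at S; uniform
    continuity of the path does the rest. *)
Lemma ae_le_path (S U : R) (y : R -> Omega -> R) : 0 < S ->
  (forall w, {within `[0, S], continuous (y ^~ w)}) ->
  (forall t, 0 <= t <= S -> {ae P, forall w, y t w <= U}) ->
  {ae P, forall w, forall t, 0 <= t <= S -> y t w <= U}.
Proof.
move=> S0 cy yU.
pose g (k m : nat) : R := Num.min S (k%:R / m.+1%:R).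
have gS k m : 0 <= g k m <= S by rewrite le_min ge_min lexx (ltW S0) divr_ge0.
have : {ae P, forall w, forall k m, y (g k m) w <= U}.
  by apply: ae_foralln => k; apply: ae_foralln => m; exact: yU.
apply: filterS => w h t tS; rewrite leNgt; apply/negP => Uy.
have e0 : 0 < y t w - U by rewrite subr_gt0.
have [d d0 hd] := itv_unif_continuous (cy w) e0.
pose m := Num.truncn d^-1.
pose k := Num.truncn (t * m.+1%:R).
have [t0 tle] := andP tS.
have /andP[k1 k2] : k%:R <= t * m.+1%:R < k.+1%:R by apply: truncn_itv; rewrite mulr_ge0.
have md : m.+1%:R^-1 < d.
  by rewrite invf_plt ?posrE//; exact: truncnS_gt.
have kt : k%:R / m.+1%:R <= t by rewrite ler_pdivrMr.
have gE : g k m = k%:R / m.+1%:R by rewrite /g min_r// (le_trans kt).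
have := hd t (g k m) tS (gS k m); rewrite gE.
rewrite ger0_norm ?subr_ge0// => /(_ _).
have -> : t - k%:R / m.+1%:R < d.
  rewrite ltrBlDr; apply: (@lt_le_trans _ _ (k.+1%:R / m.+1%:R)).
    by rewrite ltr_pdivlMr.
  by rewrite -natr1 mulrDl addrC lerD2r mul1r ltW.
move=> /(_ isT); have := h k m; rewrite gE => h1 h2.
have := ler_norm (y t w - y (k%:R / m.+1%:R) w); lra.
Qed.

(** Capping y at U makes the bound hold for every w, as the error analysis asks, and changes the
    paths on [0, S1] only on one null set, common to all times. *)
Lemma drift_solution_truncate (F : R -> set (set Omega)) (S S1 a_lo a_hi lam_hi U : R) f a lam y :
  measure_is_complete P -> (forall t : R, 0 <= t <= S -> sub_sigma (F t)) ->
  S1 <= S -> 0 <= U ->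
  drift_solution P F S a_lo a_hi lam_hi f a lam y ->
  {ae P, forall w, forall t, 0 <= t <= S1 -> y t w <= U} ->
  drift_solution P F S1 a_lo a_hi lam_hi f a lam (fun t w => Num.min (y t w) U).
Proof.
move=> cP Fsub S1S U0 ds yU.
have tS t : 0 <= t <= S1 -> 0 <= t <= S by move=> /andP[-> h]; exact: le_trans h S1S.
have sub : (`[0, S1]%classic : set R) `<=` `[0, S]%classic.
  by move=> v /=; rewrite !in_itv/=; exact: tS.
have minE t : 0 <= t <= S1 -> {ae P, forall w, y t w = Num.min (y t w) U}.
  by move=> t1; apply: filterS yU => w /(_ t t1) h; rewrite min_l.
have drE s t : 0 <= s -> t <= S1 -> {ae P, forall w,
    \int[mu]_(v in `[s, t]) drift f a lam y v w =
    \int[mu]_(v in `[s, t]) drift f a lam (fun t w => Num.min (y t w) U) v w}.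
  move=> s0 t1; apply: filterS yU => w h; apply: eq_Rintegral => v /set_mem /=.
  rewrite in_itv/= => /andP[sv vt]; rewrite /drift min_l// h//.
  by rewrite (le_trans s0 sv) (le_trans vt t1).
split.
- move=> t t1; apply: (@meas_wrt_comp _ _ _ _ (fun x => Num.min x U)).
    exact: measurable_minr.
  exact: (ds_adapted ds (tS _ t1)).
- move=> w; apply: continuous_subspaceW sub _.
  move=> t; apply: continuous_min; first exact: (ds_continuous ds).
  exact: cvg_cst.
- by move=> t w /tS t1; rewrite le_min U0 (ds_ge0 ds).
- by move=> t t1; apply: (complete_rintegrable cP (minE t t1)); exact: (ds_integrable ds (tS _ t1)).
- by move=> t w /tS; exact: (ds_a ds).
- by move=> t w /tS; exact: (ds_lam ds).
- by move=> w; apply: measurable_funS sub (ds_ma ds w).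
- by move=> w; apply: measurable_funS sub (ds_mlam ds w).
- move=> s t s0 st t1; apply: (complete_rintegrable cP (drE s t s0 t1)).
  exact: (ds_drift_integrable ds s0 st (le_trans t1 S1S)).
- move=> s t s0 st t1.
  have sS : 0 <= s <= S1 by rewrite s0 (le_trans st).
  have tS1 : 0 <= t <= S1 by rewrite (le_trans s0 st).
  have := ds_dynamics ds s0 st (le_trans t1 S1S).
  apply: (complete_cond_mean_zero cP) => //; first exact: Fsub (tS _ sS).
  apply: filterS (filterI (minE s sS) (filterI (minE t tS1) (drE s t s0 t1))).
  by move=> w /= [<- [<- <-]].
Qed.

End bounded_solution.

(** * Choice of the level, and step interpolation of the data *)

Section scheme.
Context {R : realType}.
Local Notation mu := (@lebesgue_measure R).

(** Both properties come from small tails of the series of [level k / - f (level k)]. The bound e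
    a_lo / 2 compensates the factor 2 / a_lo of the durations. The bound a_lo / (2 (lam_hi + 1)) on
    a single term, with [level k] at least 1, gives - f (level k) >= 2 (lam_hi + 1) / a_lo. *)
Lemma apriori_level (f : R -> R) (a_lo lam_hi e : R) : singular_generator f ->
  0 < a_lo -> 0 <= lam_hi -> 0 < e -> exists j,
  (forall k, (j <= k)%N -> lam_hi <= a_lo * - f (level k) / 2) /\
  (forall n, \sum_(j <= k < n) level k / (a_lo * - f (level k) / 2) <= e).
Proof.
move=> gf a0 l0 e0.
have e10 : 0 < e * a_lo / 2 by rewrite divr_gt0// mulr_gt0.
have e20 : 0 < a_lo / (2 * (lam_hi + 1)) by rewrite divr_gt0// mulr_gt0// ltr_wpDl.
have [j1 h1] := level_sum_tail gf e10; have [j2 h2] := level_sum_tail gf e20.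
have F0 k : 0 < - f (level k) by rewrite oppr_gt0 (generator_lt0 gf)// level_gt0.
exists (maxn j1 j2); split=> [k|n].
  rewrite geq_max => /andP[_ jk].
  have := h2 k k.+1 jk; rewrite big_nat1 ler_pdivrMr// => h.
  have lk1 : 1 <= (level k : R) by rewrite exprn_ege1// ler1n.
  have := le_trans lk1 h; rewrite mulrAC ler_pdivlMr ?mulr_gt0 ?ltr_wpDl//; lra.
have -> : \sum_(maxn j1 j2 <= k < n) level k / (a_lo * - f (level k) / 2) =
    2 / a_lo * \sum_(maxn j1 j2 <= k < n) level k / - f (level k).
  rewrite mulr_sumr; apply: eq_bigr => k _; field.
  by rewrite (lt_eqF (generator_lt0 gf (level_gt0 k))) (gt_eqF a0).
have := h1 _ n (leq_maxl j1 j2) => h.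
apply: le_trans (ler_wpM2l _ h) _; first by rewrite divr_ge0// ltW.
by rewrite le_eqVlt; apply/orP; left; apply/eqP; field; rewrite gt_eqF.
Qed.

(** Agrees with the interpolation by [Num.truncn] on [0, N h], in a form whose measurability is
    immediate; the extra cell of index N contains the end point N h. *)
Definition step_fun (h : R) (N : nat) (x : nat -> R) (s : R) : R :=
  \sum_(k < N.+1) \1_(`[k%:R * h, k.+1%:R * h[%classic : set R) s * x k.

Lemma measurable_step_fun h N x : measurable_fun setT (step_fun h N x).
Proof.
by apply: measurable_sum => k; exact: measurable_funM.
Qed.

Lemma step_funE h N x s k : 0 < h -> (k <= N)%N -> k%:R * h <= s < k.+1%:R * h ->
  step_fun h N x s = x k.
Proof.
move=> h0 kN ks; have kN' : (k < N.+1)%N by [].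
rewrite /step_fun (bigD1 (Ordinal kN'))//= indicE mem_set ?mul1r; last by rewrite /= in_itv.
rewrite big1 ?addr0// => i ik; rewrite indicE memNset ?mul0r// /= in_itv/= => is_.
move/negP: ik; apply; apply/eqP/val_inj => /=; apply/eqP.
have lt p q : p%:R * h <= s -> s < q.+1%:R * h -> (p <= q)%N.
  by move=> h1 h2; have := le_lt_trans h1 h2; rewrite ltr_pM2r// ltr_nat ltnS.
by case/andP: ks => k1 k2; case/andP: is_ => i1 i2; rewrite eqn_leq !lt.
Qed.

Lemma step_fun_truncn h N x s : 0 < h -> 0 <= s <= N%:R * h ->
  step_fun h N x s = x (Num.truncn (s / h)).
Proof.
move=> h0 /andP[s0 sN]; apply: step_funE => //.
  by rewrite -(natrK (R := R) N) le_truncn// ler_pdivrMr.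
rewrite -ler_pdivlMr// -ltr_pdivrMr//; apply: truncn_itv.
by rewrite divr_ge0// ltW.
Qed.

Lemma step_fun_bounded h N x : exists B : R, forall s, `|step_fun h N x s| <= B.
Proof.
exists (\sum_(k < N.+1) `|x k|) => s; apply: le_trans (ler_norm_sum _ _ _) _.
apply: ler_sum => k _; rewrite normrM ler_piMl//.
by rewrite indicE ger0_norm// lern1 leq_b1.
Qed.

(** On the k-th cell the step function is x k except at the right end point, which is removed by
    passing to half-open intervals. *)
Lemma step_fun_error_split h N x (g : R -> R) k : 0 < h -> (k < N)%N ->
  mu.-integrable `[0, N%:R * h] (EFin \o g) ->
  \int[mu]_(s in `[k%:R * h, N%:R * h]) `|g s - step_fun h N x s| =
  \int[mu]_(s in `[k%:R * h, k.+1%:R * h]) `|g s - x k| +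
  \int[mu]_(s in `[k.+1%:R * h, N%:R * h]) `|g s - step_fun h N x s|.
Proof.
move=> h0 kN ig.
have ist : mu.-integrable `[0, N%:R * h] (EFin \o step_fun h N x).
  have [B hB] := step_fun_bounded h N x.
  apply: (@itv_integrable _ _ _ B) => [|s _]; last exact: hB.
  by apply: measurable_funTS; exact: measurable_step_fun.
have ied : mu.-integrable `[0, N%:R * h] (EFin \o (fun s => `|g s - step_fun h N x s|)).
  have ib : mu.-integrable `[0, N%:R * h] (EFin \o (fun s => g s - step_fun h N x s)).
    exact: (@integrableB _ _ _ _ _ _ _ _ ig ist).
  exact: integrable_norm ib.
have k0 : 0 <= k%:R * h by rewrite mulr_ge0// ltW.
have kk : k%:R * h < k.+1%:R * h by rewrite ltr_pM2r// ltr_nat.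
have kN' : k.+1%:R * h <= N%:R * h by rewrite ler_wpM2r ?ler_nat// ltW.
have iS (b0 b1 : bool) p q : 0 <= p -> q <= N%:R * h ->
    mu.-integrable [set` Interval (BSide b0 p) (BSide b1 q)]
      (EFin \o (fun s => `|g s - step_fun h N x s|)).
  move=> p0 qN; apply: integrableS ied => //.
  by move=> s /=; case: b0; case: b1; rewrite !in_itv/= => /andP[s1 s2];
    apply/andP; split; lra.
have := @Rintegral_itvB R (fun s => `|g s - step_fun h N x s|)
  (BLeft (k%:R * h)) (BRight (N%:R * h)) (k.+1%:R * h).
rewrite !bnd_simp (ltW kk) kN' => /(_ (iS _ _ _ _ k0 (lexx _)) isT isT).
rewrite Rintegral_itv_obnd_cbnd; last first.
  by apply: iS => //; exact: le_trans k0 (ltW kk).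
move=> <-; suff -> : \int[mu]_(s in `[k%:R * h, k.+1%:R * h]) `|g s - x k| =
    \int[mu]_(s in `[k%:R * h, k.+1%:R * h]) `|g s - step_fun h N x s|.
  by rewrite addrC subrK.
have eqx s : s \in `[k%:R * h, k.+1%:R * h[%classic ->
    `|g s - step_fun h N x s| = `|g s - x k|.
  by move=> /set_mem /=; rewrite in_itv/= => sk; rewrite (step_funE _ h0 (ltnW kN) sk).
rewrite -Rintegral_itv_bndo_bndc; last first.
  apply: eq_integrable (iS true true _ _ k0 kN') => //.
  by move=> s /eqx /= ->.
rewrite -Rintegral_itv_bndo_bndc; last exact: iS.
by apply: eq_Rintegral => s /eqx.
Qed.

End scheme.

(** * The scheme as an instance of the abstract error bound *)

Section scheme_error.
Context {R : realType} {disp : measure_display} {Omega : measurableType disp}.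
Variable P : probability Omega R.
Local Notation mu := (@lebesgue_measure R).
Local Notation rintegrable := (rintegrable P).
Local Notation mean := (mean P).
Local Notation cond_mean_zero := (cond_mean_zero P).
Hypothesis cP : measure_is_complete P.

Lemma rintegrable_ae_le (X Z : Omega -> R) : measurable_fun setT X -> rintegrable Z ->
  {ae P, forall w, 0 <= X w <= Z w} -> rintegrable X.
Proof.
move=> mX iZ XZ.
have mm : measurable_fun setT (fun w => Num.min `|X w| `|Z w|).
  apply: measurable_minr; first exact: measurableT_comp.
  exact: rintegrable_measurable (rintegrable_norm iZ).
apply: (@complete_rintegrable _ _ _ _ cP (fun w => Num.min `|X w| `|Z w|)).
  apply: filterS XZ => w /andP[X0 h].
  by rewrite (ger0_norm X0) ger0_norm ?(le_trans X0)// min_l.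
apply: (rintegrable_le mm _ iZ) => w.
by rewrite ger0_norm ?le_min ?normr_ge0// ge_min lexx orbT.
Qed.

(** Turns a bound on a conditional expectation into its tested form, for any almost sure
    modification of the variable. *)
Lemma condexp_le_mean (G : set (set Omega)) (X X' zeta : Omega -> R) (c : R) : sub_sigma G ->
  condexp_le P G X c -> {ae P, forall w, X w = X' w} ->
  bounded_meas G zeta -> (forall w, 0 <= zeta w) ->
  mean (fun w => zeta w * X' w) <= c * mean zeta.
Proof.
move=> sG [V [cV Vc]] XX' bz z0; have [iX mV iV _] := cV.
have iX' : rintegrable X' := complete_rintegrable cP XX' iX.
have iz := bounded_meas_rintegrable P sG bz.
have izX' := rintegrable_bM sG bz iX'; have izX := rintegrable_bM sG bz iX.
have izV := rintegrable_bM sG bz iV.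
have -> : mean (fun w => zeta w * X' w) = mean (fun w => zeta w * X w).
  apply: ae_eq_mean; [exact: rintegrable_measurable izX'|exact: rintegrable_measurable izX|].
  by apply: filterS XX' => w ->.
rewrite -(condexp_mean sG cV bz) -meanZ//; apply: ae_le_mean => //.
  exact: rintegrableZ.
by apply: filterS Vc => w h; rewrite mulrC ler_wpM2r.
Qed.

Variables (F : R -> set (set Omega)) (T S Delta : R) (N : nat).
Variables (eta_lo a_lo lam_hi : R) (f : R -> R).
Variables (eta lambda xi Y a lam y : R -> Omega -> R).
Variables (abar lbar Ybar : nat -> Omega -> R) (xibar : Omega -> R).
Variables (C2 beta E0 : R) (Phi : R -> R).
Hypothesis gf : singular_generator f.
Hypothesis S0 : 0 < S.
Hypothesis a_lo0 : 0 < a_lo.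
Hypothesis eta_lo0 : 0 < eta_lo.
Hypothesis lam_hi0 : 0 <= lam_hi.
Hypothesis Fsub : forall t : R, 0 <= t <= S -> sub_sigma (F t).
Hypothesis Fmono : forall s t : R, 0 <= s -> s <= t -> t <= S -> F s `<=` F t.
Hypothesis dsP : drift_solution P F S a_lo eta_lo^-1 lam_hi f a lam y.
Variables (U K L : R) (f1 : R -> R).
Hypothesis U0 : 0 <= U.
Hypothesis yU : forall t w, 0 <= t <= S -> y t w <= U.
Hypothesis K0 : 0 <= K.
Hypothesis L0 : 0 <= L.
Hypothesis f1_cont : continuous (fun x : R => f1 (Num.max x 0)).
Hypothesis f1K : forall x : R, 0 <= x <= U -> `|f1 x| <= K.
Hypothesis f1L : forall x y : R, 0 <= x <= U -> 0 <= y <= U ->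
  `|f y - f x - f1 x * (y - x)| <= L * (y - x) ^+ 2.
Hypothesis DeltaT : Delta < T.
Hypothesis N0 : (0 < N)%N.
Hypothesis TDS : T - Delta < S.
Hypothesis same : {ae P, forall w, forall t, 0 <= t <= T - Delta ->
  [/\ y t w = Y t w, a t w = (eta t w)^-1 & lam t w = lambda t w]}.
Hypothesis disc : discretization_data P F T Delta N eta_lo lam_hi xi abar lbar xibar.
Hypothesis euler : implicit_euler P F T Delta N f abar lbar xibar Ybar.
Hypothesis discerr :
  discretization_error P F T Delta N C2 beta Phi eta lambda xi abar lbar xibar.
Hypothesis Yxi : {ae P, forall w, `|Y (T - Delta) w - xi (T - Delta) w| <= E0}.

Let h := mesh T Delta N.
Let a_hi := eta_lo^-1.

Let h0 : 0 < h.
Proof. by rewrite divr_gt0 ?ltr0n// subr_gt0. Qed.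

Let Nh : N%:R * h = T - Delta.
Proof. by rewrite mulrC divfK// pnatr_eq0 -lt0n. Qed.

Let gridS k : (k <= N)%N -> 0 <= k%:R * h <= S.
Proof.
move=> kN; rewrite mulr_ge0 ?(ltW h0)//=; apply: le_trans (ltW TDS).
by rewrite -Nh ler_wpM2r ?ler_nat// ltW.
Qed.

(** The data satisfy their bounds almost surely; clipping makes them hold for every w and keeps the
    data adapted. *)
Let clip (c x : R) := Num.max (Num.min x c) 0.

Let clip_id c x : 0 <= x <= c -> clip c x = x.
Proof. by move=> /andP[x0 xc]; rewrite /clip min_l// max_l. Qed.

Let clip_itv c x : 0 <= c -> 0 <= clip c x <= c.
Proof. by move=> c0; rewrite /clip le_max lexx orbT/= ge_max c0 andbT ge_min lexx orbT. Qed.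

Let clip_measurable c : measurable_fun setT (clip c).
Proof. by apply: measurable_maxr => //; exact: measurable_minr. Qed.

Let abar' k w := clip a_hi (abar k w).
Let lbar' k w := clip lam_hi (lbar k w).

Let a_hi0 : 0 <= a_hi. Proof. by rewrite invr_ge0 ltW. Qed.

Let clip_ae : {ae P, forall w, forall k, (k <= N)%N ->
  abar' k w = abar k w /\ lbar' k w = lbar k w}.
Proof.
have [ha hl _ _] := disc.
apply: ae_foralln => k; have [kN|kN] := leqP k N; last by apply: aeW.
have [_ h1] := ha k kN; have [_ h2] := hl k kN.
apply: filterS (filterI h1 h2) => w [b1 b2] _.
by rewrite /abar' /lbar' !clip_id.
Qed.

Let X k w := \int[mu]_(s in `[k%:R * h, N%:R * h]) `|a s w - step_fun h N (abar' ^~ w) s| +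
  \int[mu]_(s in `[k%:R * h, N%:R * h]) `|lam s w - step_fun h N (lbar' ^~ w) s|.

(** On one event of full probability the integrands agree at every time, so [X k] inherits the
    conditional bound of [discretization_error]. *)
Let X_ae k : (k <= N)%N -> {ae P, forall w,
  \int[mu]_(s in `[grid T Delta N k, T - Delta])
     `|(eta s w)^-1 - step_ext T Delta N abar s w| +
  \int[mu]_(s in `[grid T Delta N k, T - Delta])
     `|lambda s w - step_ext T Delta N lbar s w| = X k w}.
Proof.
move=> kN; apply: filterS (filterI same clip_ae) => w [hs hc].
rewrite /X -Nh /grid -/h; congr (_ + _); apply: eq_Rintegral => s /set_mem /=;
  rewrite in_itv/= => /andP[ks sN].
- have s0 : 0 <= s <= N%:R * h by rewrite sN andbT (le_trans _ ks)// mulr_ge0// ltW.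
  have [_ <- _] := hs s (eq_ind_r (fun z => 0 <= s <= z) s0 (esym Nh)).
  rewrite step_fun_truncn// /step_ext -/h (hc _ _).1//.
  by rewrite -(natrK (R := R) N) le_truncn// ler_pdivrMr.
- have s0 : 0 <= s <= N%:R * h by rewrite sN andbT (le_trans _ ks)// mulr_ge0// ltW.
  have [_ _ <-] := hs s (eq_ind_r (fun z => 0 <= s <= z) s0 (esym Nh)).
  rewrite step_fun_truncn// /step_ext -/h (hc _ _).2//.
  by rewrite -(natrK (R := R) N) le_truncn// ler_pdivrMr.
Qed.

Let X_step k w : (k < N)%N ->
  \int[mu]_(v in `[k%:R * h, k.+1%:R * h]) `|a v w - abar' k w| +
  \int[mu]_(v in `[k%:R * h, k.+1%:R * h]) `|lam v w - lbar' k w| <= X k w - X k.+1 w.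
Proof.
move=> kN.
have sub : (`[0, N%:R * h]%classic : set R) `<=` `[0, S]%classic.
  move=> v /=; rewrite !in_itv/= Nh => /andP[-> vN].
  exact: le_trans vN (ltW TDS).
have ia : mu.-integrable `[0, N%:R * h] (EFin \o a ^~ w).
  apply: (@itv_integrable _ _ _ a_hi).
    by apply: measurable_funS sub _ => //; exact: (ds_ma dsP).
  move=> v /sub /=; rewrite in_itv/= => vS; have /andP[a1 a2] := ds_a dsP w vS.
  by rewrite ger0_norm// (le_trans (ltW a_lo0)).
have il : mu.-integrable `[0, N%:R * h] (EFin \o lam ^~ w).
  apply: (@itv_integrable _ _ _ lam_hi).
    by apply: measurable_funS sub _ => //; exact: (ds_mlam dsP).
  move=> v /sub /=; rewrite in_itv/= => vS; have /andP[a1 a2] := ds_lam dsP w vS.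
  by rewrite ger0_norm.
rewrite /X (step_fun_error_split (abar' ^~ w) h0 kN ia).
rewrite (step_fun_error_split (lbar' ^~ w) h0 kN il).
set A := \int[mu]_(v in _) _; set B := \int[mu]_(v in _) _.
set C := \int[mu]_(v in _) _; set D := \int[mu]_(v in _) _.
lra.
Qed.

Let Ybar_meas k : (k <= N)%N -> meas_wrt (F (k%:R * h)) (Ybar k).
Proof. by move=> kN; have [hY _ _] := euler; case: (hY k kN). Qed.

(** For k >= 1 integrability is part of the conditional expectation taken at step k - 1. At k = 0
    the implicit term is non-positive, so Ybar lies between 0 and V + h lam_hi. *)
Let Ybar_int k : (k <= N)%N -> rintegrable (Ybar k).
Proof.
have [hY _ hE] := euler.
case: k => [_|k kN]; last by have [V [[]]] := hE k kN.
have [mY Y0] := hY 0%N (leq0n _); have [V [[_ _ iV _] YE]] := hE 0%N N0.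
have [ha hl _ _] := disc; have [_ ab] := ha 0%N (leq0n _); have [_ lb] := hl 0%N (leq0n _).
apply: (@rintegrable_ae_le _ (fun w => V w + h * lam_hi)).
- by apply: meas_wrt_measurable (mY); apply: Fsub; exact: gridS.
- by apply: rintegrableD => //; exact: rintegrable_cst.
apply: filterS (filterI Y0 (filterI YE (filterI ab lb))) => w [y0 [yE [/andP[a1 a2] /andP[l1 l2]]]].
rewrite y0/= yE -/h.
have h1 : h * abar 0%N w * f (Ybar 0%N w) <= 0.
  by rewrite mulr_ge0_le0 ?(generator_le0 gf)// mulr_ge0// ltW.
have h2 : h * lbar 0%N w <= h * lam_hi by rewrite ler_wpM2l// ltW.
lra.
Qed.

Let Ybar_ae k V : (k < N)%N ->
  {ae P, forall w, Ybar k w = V w + h * abar k w * f (Ybar k w) + h * lbar k w} ->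
  {ae P, forall w, Ybar k w - V w - h * lbar' k w = h * (abar' k w * f (Ybar k w))}.
Proof.
move=> kN YE; apply: filterS (filterI YE clip_ae) => w [e /(_ k (ltnW kN)) [-> ->]].
by rewrite {1}e; ring.
Qed.

Let lbar_meas k : (k <= N)%N -> bounded_meas (F (k%:R * h)) (lbar' k).
Proof.
move=> kN; have [_ hl _ _] := disc; have [ml _] := hl k kN; split.
  by apply: (meas_wrt_comp (clip_measurable lam_hi)).
by exists lam_hi => w; have /andP[h1 h2] := clip_itv (lbar k w) lam_hi0; rewrite ger0_norm.
Qed.

(** Ybar may be unbounded, so integrability of f(Ybar) is not immediate; solving the scheme for the
    implicit term expresses it through integrable variables. *)
Let Ybar_gen k : (k < N)%N -> rintegrable (fun w => abar' k w * f (Ybar k w)).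
Proof.
move=> kN; have [_ _ hE] := euler; have [V [[_ _ iV _] YE]] := hE k kN.
apply: (@complete_rintegrable _ _ _ _ cP
  (fun w => h^-1 * (Ybar k w - V w - h * lbar' k w))).
  by apply: filterS (Ybar_ae kN YE) => w ->; rewrite mulKf// gt_eqF.
apply: rintegrableZ; apply: rintegrableB.
  by apply: rintegrableB => //; exact: Ybar_int (ltnW kN).
apply: rintegrableZ; apply: bounded_meas_rintegrable (lbar_meas (ltnW kN)).
by apply: Fsub; exact: gridS (ltnW kN).
Qed.

Let Ybar_euler k : (k < N)%N -> cond_mean_zero (F (k%:R * h))
  (fun w => Ybar k w - Ybar k.+1 w - h * (abar' k w * f (Ybar k w)) - h * lbar' k w).
Proof.
move=> kN; have [_ _ hE] := euler; have [V [cV YE]] := hE k kN.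
have sF := Fsub (gridS (ltnW kN)).
have [iY _ iV _] := cV.
apply: (@complete_cond_mean_zero _ _ _ _ cP _ (fun w => V w - Ybar k.+1 w)) => //.
  by apply: filterS (Ybar_ae kN YE) => w <-; ring.
split; first exact: rintegrableB.
move=> zeta bz; under [mean _]eq_Rintegral do rewrite mulrBr.
rewrite -/(mean _) meanB; [|exact: rintegrable_bM sF bz iV|exact: rintegrable_bM sF bz iY].
by rewrite (condexp_mean sF cV bz) subrr.
Qed.

(** The terminal error is split at xi: E0 bounds |Y - xi|, and the hypothesis on xibar bounds the
    rest in conditional mean. *)
Lemma scheme_error i : (i <= N)%N -> {ae P, forall w,
  `|Y (grid T Delta N i) w - Ybar i w| <=
  (E0 + C2 * Phi Delta * h `^ beta) + (1 - f U) * (C2 * h `^ beta) +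
  (a_hi * (K * (a_hi * - f U + lam_hi) + 4 * L * U * (a_hi * - f U + lam_hi)) * (T - Delta)
   + a_hi * L * U ^+ 2) * h}.
Proof.
move=> iN.
have [ha hl _ _] := disc; have [hY YN _] := euler.
have X_int k : (k <= N)%N -> rintegrable (X k).
  move=> kN; have [[V [[iX _ _ _] _]] _] := discerr kN.
  exact: (complete_rintegrable cP (X_ae kN) iX).
have NhS : N%:R * h < S by rewrite Nh.
have sF := Fsub (gridS iN).
have := @euler_error_ae _ _ _ P F S a_lo a_hi lam_hi f a lam y gf S0 a_lo0 lam_hi0 Fsub Fmono
  dsP U K L f1 U0 yU K0 L0 f1_cont f1K f1L N h abar' lbar' Ybar X h0 NhS _ _ _ Ybar_meas
  Ybar_int Ybar_gen Ybar_euler X_int _ X_step i (C2 * h `^ beta)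
  (E0 + C2 * Phi Delta * h `^ beta) iN.
rewrite Nh => err.
have {}err : {ae P, forall w, `|y (i%:R * h) w - Ybar i w| <=
  (E0 + C2 * Phi Delta * h `^ beta) + (1 - f U) * (C2 * h `^ beta) +
  (a_hi * (K * (a_hi * - f U + lam_hi) + 4 * L * U * (a_hi * - f U + lam_hi)) * (T - Delta)
   + a_hi * L * U ^+ 2) * h}.
  apply: err.
  - move=> k kN; have [ma _] := ha k (ltnW kN).
    exact: (meas_wrt_comp (clip_measurable a_hi)).
  - by move=> k w kN; exact: clip_itv.
  - by move=> k kN; exact: lbar_meas (ltnW kN).
  - by move=> w; rewrite addr_ge0//; exact: Rintegral_ge0.
  - move=> zeta bz z0; have [cX _] := discerr iN.
    exact: condexp_le_mean sF cX (X_ae iN) bz z0.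
  - move=> zeta bz z0; have [_ cxi] := discerr iN.
    have [V [[ixi _ _ _] _]] := cxi.
    have := condexp_le_mean sF cxi (aeW _ (fun w => erefl)) bz z0 => hxi.
    have iz := bounded_meas_rintegrable P sF bz.
    have ixi' := rintegrable_bM sF bz ixi.
    rewrite mulrDl; apply: le_trans (lerD (lexx _) hxi).
    rewrite -(meanZ E0 iz) -meanD//; last exact: rintegrableZ.
    apply: ae_le_mean.
    + apply: rintegrable_bM sF bz _; apply: rintegrable_norm; apply: rintegrableB.
        by apply: (ds_integrable dsP); rewrite -Nh; exact: gridS.
      exact: Ybar_int.
    + by apply: rintegrableD => //; exact: rintegrableZ.
    have TD0 : 0 <= T - Delta <= T - Delta by rewrite lexx andbT -Nh mulr_ge0// ltW.
    apply: filterS (filterI same (filterI YN Yxi)) => w [/(_ _ TD0) [yE _ _] [-> hE]].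
    rewrite yE [E0 * _]mulrC -mulrDr ler_wpM2l//.
    have -> : Y (T - Delta) w - xibar w = (Y (T - Delta) w - xi (T - Delta) w) +
      (xi (T - Delta) w - xibar w) by ring.
    by apply: le_trans (ler_normD _ _) _; rewrite lerD2r.
apply: filterS (filterI same err) => w [hs].
have git : 0 <= i%:R * h <= T - Delta.
  have /andP[g0 _] := gridS iN; rewrite g0/= -Nh ler_wpM2r ?ler_nat//; exact: ltW.
by have [<- _ _] := hs _ git.
Qed.

End scheme_error.

(** * Choice of the constant and of the functions of Delta *)

Lemma error_arith (R : realFieldType) (C C2 q1 q2 ph g q3 q4 : R) :
  1 <= C -> 0 < C2 -> 0 <= q1 -> 0 <= q2 -> 0 <= ph * q2 -> 0 <= g * q2 ->
  q3 <= q4 -> 0 <= q4 ->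
  C * q1 + C2 * ph * q2 + g * (C2 * q2) + q3 <=
  (C + C2 + 1) * (q1 + q2 + (ph + g) * q2 + q4).
Proof.
move=> C1 C20 q10 q20 s0 t0 q34 q40.
rewrite -mulrA (mulrCA g) [(ph + g) * _]mulrDl.
move: (ph * q2) (g * q2) s0 t0 => s t s0 t0.
have C0 : 0 <= C by lra.
have := mulr_ge0 C0 q20; have := mulr_ge0 C0 s0; have := mulr_ge0 C0 t0.
have := mulr_ge0 C0 q40; have := mulr_ge0 (ltW C20) q10; have := mulr_ge0 (ltW C20) q20.
by have := mulr_ge0 (ltW C20) q40; lra.
Qed.

Theorem theorem1 (R : realType) (disp : measure_display)
  (Omega : measurableType disp) (P : probability Omega R)
  (T : R) (d : nat) (W : 'I_d -> R -> Omega -> R)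
  (F : R -> set (set Omega))
  (eta_lo eta_hi lambda_hi : R) (eta lambda : R -> Omega -> R) (f : R -> R) :
  0 < T -> (0 < d)%N ->
  (forall t : R, 0 <= t <= T -> F t = brownian_filtration P W t) ->
  F T = @measurable disp Omega ->
  usual_conditions P F T ->
  brownian_motion P W F T ->
  0 < eta_lo -> eta_lo < eta_hi -> 0 <= lambda_hi ->
  progressive F T eta -> progressive F T lambda ->
  {ae P, forall w, forall t : R, 0 <= t <= T ->
     eta_lo <= eta t w <= eta_hi /\ 0 <= lambda t w <= lambda_hi} ->
  bounded_ito_process P W F T eta ->
  singular_generator f ->
  exists Psi2 : R -> R,
  forall Phi : R -> R, (forall Delta : R, 0 < Delta <= T -> 0 <= Phi Delta) ->
  exists Psi1 : R -> R,
  forall (Y : R -> Omega -> R) (Z : 'I_d -> R -> Omega -> R),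
  singular_bsde_solution P W F T eta lambda f Y Z ->
  forall (tau : R) (xi : R -> Omega -> R) (C alpha : R),
  0 <= tau < T ->
  adapted F `[tau, T[ xi ->
  (forall t : R, tau <= t < T -> {ae P, forall w, 0 <= xi t w}) ->
  1 <= C -> 0 < alpha ->
  (forall t : R, tau <= t < T ->
     ('N[P]_+oo[EFin \o (Y t \- xi t)%R] <= (C * (T - t) `^ alpha)%:E)%E) ->
  forall (abar lbar : R -> nat -> nat -> Omega -> R)
         (xibar : R -> nat -> Omega -> R)
         (Ybar : R -> nat -> nat -> Omega -> R) (C2 beta : R),
  0 < C2 -> 0 < beta ->
  (forall (Delta : R) (N : nat),
     0 < Delta <= T - tau -> Delta < T -> (0 < N)%N ->
     [/\ discretization_data P F T Delta N eta_lo lambda_hi xi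
           (abar Delta N) (lbar Delta N) (xibar Delta N),
         implicit_euler P F T Delta N f
           (abar Delta N) (lbar Delta N) (xibar Delta N) (Ybar Delta N) &
         discretization_error P F T Delta N C2 beta Phi eta lambda xi
           (abar Delta N) (lbar Delta N) (xibar Delta N)]) ->
  exists C3 : R, 0 < C3 /\
    forall (Delta : R) (N i : nat),
      0 < Delta <= T - tau -> Delta < T -> (0 < N)%N -> (i <= N)%N ->
      {ae P, forall w,
         `|Y (grid T Delta N i) w - Ybar Delta N i w| <=
           C3 * (Delta `^ alpha + mesh T Delta N `^ beta
                 + Psi1 Delta * mesh T Delta N `^ beta
                 + Psi2 Delta * mesh T Delta N)}.
Proof.
move=> T0 _ FE FT [cP _ _] BM elo0 elohi lhi0 peta plam bounds _ gf.
have Fsub := filtration_sub_sigma FE FT; have Fmono := filtration_mono FE.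
have ehi0 : 0 < eta_hi by exact: lt_trans elo0 elohi.
pose a_lo := eta_hi^-1; pose a_hi := eta_lo^-1.
have a_lo0 : 0 < a_lo by rewrite invr_gt0.
have a_hi0 : 0 <= a_hi by rewrite invr_ge0 ltW.
have [f1 [f1c taylor]] := generator_taylor gf.
(* The margin D / 8 lets the chain of levels start before T - D / 4 from every time up to T - D / 2,
   since - D / 2 + D / 8 < - D / 4. For D <= 0 the value of j is arbitrary. *)
have /choice[j hj] : forall D : R, exists j : nat, 0 < D ->
    (forall k, (j <= k)%N -> lambda_hi <= a_lo * - f (level k) / 2) /\
    (forall n, \sum_(j <= k < n) level k / (a_lo * - f (level k) / 2) <= D / 8).
  move=> D; have [D0|_] := ltP 0 D; last by exists 0%N.
  have [j hj] := apriori_level gf a_lo0 lhi0 (divr_gt0 D0 (ltr0Sn _ 7)).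
  by exists j.
pose U D : R := level (j D).
have U0 D : 0 <= U D by exact/ltW/level_gt0.
have /choice[KL hKL] : forall D : R, exists KL : R * R,
    [/\ 0 <= KL.1, 0 <= KL.2, (forall x, 0 <= x <= U D -> `|f1 x| <= KL.1) &
    (forall x y, 0 <= x <= U D -> 0 <= y <= U D ->
       `|f y - f x - f1 x * (y - x)| <= KL.2 * (y - x) ^+ 2)].
  by move=> D; have [K [L h]] := taylor _ (U0 D); exists (K, L).
pose c D := a_hi * - f (U D) + lambda_hi.
have fU D : 0 <= - f (U D) by rewrite oppr_ge0 (generator_le0 gf).
have c0 D : 0 <= c D by rewrite addr_ge0// mulr_ge0.
pose A D := a_hi * ((KL D).1 * c D + 4 * (KL D).2 * U D * c D).
pose B D := a_hi * (KL D).2 * U D ^+ 2.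
have A0 D : 0 <= A D by have [k0 l0 _ _] := hKL D; rewrite mulr_ge0// addr_ge0// !mulr_ge0.
have B0 D : 0 <= B D by have [k0 l0 _ _] := hKL D; rewrite !mulr_ge0// exprn_ge0.
(* [A D] collects errors of order h^2 over N steps, hence h (T - D) <= h T; [B D] comes from the
   telescoped squares. *)
exists (fun D => A D * T + B D) => Phi Phi0.
exists (fun D => Phi D + (1 - f (U D))) => Y Z Ysol tau xi C alpha /andP[tau0 tauT] _ _ C1 alpha0 Yxi.
move=> abar lbar xibar Ybar C2 beta C20 beta0 scheme.
(* C is the coefficient of Delta^alpha, C2 that of the h^beta terms and 1 that of the h term; their
   sum dominates each of them. *)
exists (C + C2 + 1); split; first lra.
move=> D N i /andP[D0 Dtau] DT N0 iN.
have [disc eul err] := scheme D N (introT andP (conj D0 Dtau)) DT N0.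
(* Nested horizons: the dynamics are used up to S, the bound U(D) holds up to S1 < S, and the scheme
   ends at T - D < S1. *)
pose S := T - D / 4; pose S1 := T - D / 2.
have S0 : 0 < S by rewrite /S; lra.
have ST : S < T by rewrite /S; lra.
have S10 : 0 < S1 by rewrite /S1; lra.
have S1S : S1 <= S by rewrite /S /S1; lra.
have Fsub' (t : R) : 0 <= t <= S -> sub_sigma (F t).
  by move=> /andP[t0 tS]; apply: Fsub; rewrite t0 (le_trans tS (ltW ST)).
have [a [lam [y [ds same]]]] :=
  bsde_drift_solution T0 FE FT cP BM elo0 elohi lhi0 peta plam bounds gf Ysol S0 ST.
have yU : {ae P, forall w, forall t, 0 <= t <= S1 -> y t w <= U D}.
  have sub : (`[0, S1]%classic : set R) `<=` `[0, S]%classic.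
    by move=> v /=; rewrite !in_itv/= => /andP[-> h]; exact: le_trans h S1S.
  apply: ae_le_path => //.
    by move=> w; apply: continuous_subspaceW sub (ds_continuous ds (w := w)).
  move=> t /andP[t0 tS1]; have [hj1 hj2] := hj D D0.
  apply: (apriori_bound gf S0 a_lo0 Fsub' ds hj1 hj2 t0).
    by rewrite divr_ge0// ltW.
  by rewrite /S; rewrite /S1 in tS1; lra.
have ds1 := drift_solution_truncate cP Fsub' S1S (U0 D) ds yU.
have yU1 t w : 0 <= t <= S1 -> Num.min (y t w) (U D) <= U D by rewrite ge_min lexx orbT.
have [K0 L0 f1K f1L] := hKL D.
have Fsub1 (t : R) : 0 <= t <= S1 -> sub_sigma (F t).
  by move=> /andP[t0 tS]; apply: Fsub'; rewrite t0 (le_trans tS S1S).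
have Fmono1 (s t : R) : 0 <= s -> s <= t -> t <= S1 -> F s `<=` F t.
  by move=> s0 st tS; apply: Fmono => //; exact: le_trans tS (le_trans S1S (ltW ST)).
have TDS : T - D < S1 by rewrite /S1; lra.
have same1 : {ae P, forall w, forall t, 0 <= t <= T - D ->
    [/\ Num.min (y t w) (U D) = Y t w, a t w = (eta t w)^-1 & lam t w = lambda t w]}.
  apply: filterS (filterI same yU) => w [h1 h2] t /andP[t0 tTD].
  have tS1 : 0 <= t <= S1 by rewrite t0 (le_trans tTD (ltW TDS)).
  have tS : 0 <= t <= S by rewrite t0 (le_trans tTD)// (le_trans (ltW TDS)).
  by have [<- <- <-] := h1 t tS; rewrite min_l// h2.
have Yxi' : {ae P, forall w, `|Y (T - D) w - xi (T - D) w| <= C * D `^ alpha}.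
  have := Yxi (T - D); rewrite subKr => /(_ _).
  have -> : tau <= T - D < T by rewrite ltrBlDr ltrDl D0 andbT lerBrDr addrC -lerBrDr.
  (* The L-infinity norm unfolds to an essential supremum because [P setT] is positive. *)
  move=> /(_ isT); rewrite unlock.
  have /= -> := @probability_setT _ _ _ P; rewrite lte01 => /ess_supP.
  by apply: filterS => w /=; rewrite lee_fin.
have := scheme_error cP gf S10 a_lo0 elo0 lhi0 Fsub1 Fmono1 ds1 (U0 D) yU1 K0 L0 f1c f1K f1L
  DT N0 TDS same1 disc eul err Yxi' iN.
apply: filterS => w; move/le_trans; apply.
rewrite -/a_hi -/(c D) -/(A D) -/(B D).
have h0 : 0 <= mesh T D N by rewrite divr_ge0 ?ler0n// subr_ge0 ltW.
set h := mesh T D N in h0 *.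
have p1 : 0 <= D `^ alpha by exact: powR_ge0.
have p2 : 0 <= h `^ beta by exact: powR_ge0.
have D0T : 0 < D <= T by rewrite D0 ltW.
have p3 : 0 <= Phi D * h `^ beta by rewrite mulr_ge0// Phi0.
have p4 : 0 <= (1 - f (U D)) * h `^ beta by rewrite mulr_ge0//; have := fU D; lra.
have p5 : (A D * (T - D) + B D) * h <= (A D * T + B D) * h.
  by rewrite ler_wpM2r// lerD2r ler_wpM2l// lerBlDr lerDl ltW.
have p6 : 0 <= (A D * T + B D) * h by rewrite mulr_ge0// addr_ge0// mulr_ge0// ltW.
exact: error_arith.
Qed.
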